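(* Let $d \ge 1$, let $f$ be any probability density function on $\mathbb{R}^d$ (with respect to Lebesgue measure) whose differential entropy $H(f)$ exists and is finite, and let $X, X_1, X_2, \dots$ be independent and identically distributed $\mathbb{R}^d$-valued random vectors with density $f$. Let $H_n$ be the Kozachenko--Leonenko nearest neighbor entropy estimate based on $X_1,\dots,X_n$. Then $$\lim_{n\rightarrow \infty }\mathbb{E}\{|H_n-H(f)|\}=0$$ if and only if $$\mathbb{E}\{(\ln \|X\|)^+\}<\infty.$$
   Context: The differential entropy of a density $f$ on $\mathbb{R}^d$ is $H(f) = - \int f(x) \ln f(x)\, dx$ (with $0\ln 0=0$), when this integral exists. For a real number $a$, $a^+=\max\{a,0\}$; $\|\cdot\|$ is the Euclidean norm. Expectations of nonnegative random variables take values in $[0,\infty]$. For $n\ge 2$ and $1\le i\le n$, let $R_{n,i}(x)=\min_{j\ne i,\, j\le n}\|x-X_j\|$ for $x\in\mathbb{R}^d$. The Kozachenko--Leonenko nearest neighbor entropy estimate is $$H_n=\frac 1n \sum_{i=1}^{n}\ln \big((n-1)R_{n,i}(X_i)^d v_d\big)+ C_E,$$ where $v_d$ is the volume (Lebesgue measure) of the unit ball in $\mathbb{R}^d$ and $C_E=-\int_0^{\infty} e^{-t}\ln t\,dt$ is the Euler--Mascheroni constant ($0.5772\ldots$). Since $X_1,\dots,X_n$ are almost surely distinct, $H_n$ is almost surely a well-defined real number. *)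

(* Defs.v *)
From HB Require Import structures.
From mathcomp Require Import all_boot all_order all_algebra finmap.
From mathcomp Require Import all_classical all_reals all_analysis.

Set Implicit Arguments.
Unset Strict Implicit.
Unset Printing Implicit Defensive.

Import Order.TTheory GRing.Theory Num.Theory.
Import numFieldNormedType.Exports.

Local Open Scope classical_set_scope.
Local Open Scope ring_scope.

(* R^d with the product sigma-algebra, i.e. its Borel sigma-algebra. *)
Notation vec R d := (d.-tuple (measurableTypeR R)) (only parsing).

(* Lebesgue measure on R^d, by recursion on d: its image under
   x |-> (x_0, (x_1, ..., x_{d-1})) is the product of lebesgue_measure and
   Lebesgue measure on R^{d-1}; lebesgue_vec_box computes it on boxes. *)
Section lebesgue_vec.
Context {R : realType}.

Definition vcons (n : nat) (p : measurableTypeR R * vec R n) : vec R n.+1 :=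
  [tuple of p.1 :: p.2].

Definition vsplit (n : nat) (x : vec R n.+1) : measurableTypeR R * vec R n :=
  (thead x, [tuple of behead x]).

Lemma vconsK n : cancel (@vcons n) (@vsplit n).
Proof.
move=> [a v]; rewrite /vcons /vsplit /= theadE; congr pair.
exact/val_inj.
Qed.

Lemma vsplitK n : cancel (@vsplit n) (@vcons n).
Proof. by move=> x; rewrite /vcons /vsplit /= -tuple_eta. Qed.

Lemma measurable_vcons n : measurable_fun setT (@vcons n).
Proof. exact: measurable_cons. Qed.

Lemma measurable_vsplit n : measurable_fun setT (@vsplit n).
Proof.
have mh : measurable_fun setT (fun x : vec R n.+1 => thead x).
  exact: (measurable_tnth ord0).
exact: measurable_fun_pair mh (@measurable_behead _ _ n).
Qed.

Section step.
Variables (n : nat) (mu : {sigma_finite_measure set (vec R n) -> \bar R}).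

Definition lebesgue_cons : set (vec R n.+1) -> \bar R :=
  pushforward (@lebesgue_measure R \x mu)%E (@vcons n).

Let lebesgue_cons0 : lebesgue_cons set0 = 0%E.
Proof. by rewrite /lebesgue_cons /pushforward preimage_set0 measure0. Qed.

Let lebesgue_cons_ge0 A : (0 <= lebesgue_cons A)%E.
Proof. by rewrite /lebesgue_cons /pushforward measure_ge0. Qed.

Let lebesgue_cons_sigma_additive : semi_sigma_additive lebesgue_cons.
Proof.
move=> F mF tF mUF.
apply: (@measure_semi_sigma_additive _ _ _
  (pushforward (@lebesgue_measure R \x mu)%E (@vcons n))) => //.
exact: measurable_vcons.
Qed.

HB.instance Definition _ := isMeasure.Build _ _ _ lebesgue_cons
  lebesgue_cons0 lebesgue_cons_ge0 lebesgue_cons_sigma_additive.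

Let lebesgue_cons_sigma_finite : sigma_finite setT lebesgue_cons.
Proof.
have /sigma_finiteP[F [TF ndF Foo]] := sigma_finiteT (@lebesgue_measure R).
have /sigma_finiteP[G [TG ndG Goo]] := sigma_finiteT mu.
exists (fun k => @vsplit n @^-1` (F k `*` G k)).
  apply/seteqP; split => // x _; rewrite -preimage_bigcup /=.
  have [i _ Fi] : (\bigcup_i F i) (vsplit x).1 by rewrite -TF.
  have [j _ Gj] : (\bigcup_j G j) (vsplit x).2 by rewrite -TG.
  exists (maxn i j) => //; split.
    by move: Fi; exact/subsetPset/ndF/leq_maxl.
  by move: Gj; exact/subsetPset/ndG/leq_maxr.
move=> k; have [mF Fk] := Foo k; have [mG Gk] := Goo k; split.
  rewrite -[X in measurable X]setTI; apply: measurable_vsplit => //.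
  exact: measurableX.
rewrite /lebesgue_cons /pushforward -comp_preimage.
rewrite (_ : @vsplit n \o @vcons n = id); last first.
  by apply/funext => p /=; rewrite vconsK.
by rewrite preimage_id product_measure1E// lte_mul_pinfty// ge0_fin_numE.
Qed.

HB.instance Definition _ := Measure_isSigmaFinite.Build _ _ _ lebesgue_cons
  lebesgue_cons_sigma_finite.

End step.

Fixpoint lebesgue_vec (n : nat) :
    {sigma_finite_measure set (vec R n) -> \bar R} :=
  match n with
  | 0 => \d_([tuple] : vec R 0)
  | m.+1 => lebesgue_cons (lebesgue_vec m)
  end.

Lemma lebesgue_vec_box n (A : 'I_n -> set (measurableTypeR R)) :
  (forall i, measurable (A i)) ->
  lebesgue_vec n [set x | forall i, A i (tnth x i)] =
  (\prod_(i < n) lebesgue_measure (A i))%E.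
Proof.
elim: n A => [A _|n IHn A mA] /=.
  rewrite big_ord0 (_ : [set _ | _] = setT) ?diracT//.
  by apply/seteqP; split => // x _ [].
rewrite big_ord_recl -IHn//.
rewrite -[in RHS]product_measure1E//; last first.
  rewrite (_ : [set _ | _] = \bigcap_(i in [set: 'I_n])
      ((fun x : vec R n => tnth x i) @^-1` A (lift ord0 i))).
    apply: fin_bigcap_measurable => // i _.
    by rewrite -[X in measurable X]setTI; exact: measurable_tnth.
  by apply/seteqP; split => x /= Hx i; [move=> _; exact: Hx|exact: Hx].
rewrite /lebesgue_cons /pushforward; congr ((_ \x _)%E _).
apply/seteqP; split => -[a v] /=.
  move=> H; split; first by have := H ord0.
  by move=> i; have := H (lift ord0 i); rewrite tnthS.
move=> [Ha Hv] i; case: (unliftP ord0 i) => [j ->|->]; last by [].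
by rewrite tnthS.
Qed.

End lebesgue_vec.
Arguments lebesgue_vec R n : clear implicits.

Section euclidean.
Context {R : realType} {d : nat}.
Implicit Types x y : vec R d.

Definition vsub x y : vec R d := [tuple (tnth x i : R) - tnth y i | i < d].

Definition enorm x : R := Num.sqrt (\sum_(i < d) (tnth x i : R) ^+ 2).

End euclidean.

Definition unit_ball_volume (R : realType) (d : nat) : R :=
  fine (lebesgue_vec R d [set x | enorm x <= 1]).

Definition euler_mascheroni (R : realType) : R :=
  - \int[@lebesgue_measure R]_(t in `]0, +oo[) (expR (- t) * ln t).

Section densities.
Context {R : realType} {d : nat}.
Implicit Type f : vec R d -> R.

Definition is_density f :=
  [/\ measurable_fun setT f, (forall x, 0 <= f x) &
      (\int[lebesgue_vec R d]_x (f x)%:E = 1)%E].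

(* As ln 0 = 0, the integrand vanishes where f does. *)
Definition has_finite_entropy f :=
  (lebesgue_vec R d).-integrable setT (fun x => (f x * ln (f x))%:E).

Definition entropy f : R :=
  - \int[lebesgue_vec R d]_x (f x * ln (f x)).

Definition has_density dT (T : measurableType dT) (P : probability T R)
    (X : {RV P >-> vec R d}) f :=
  forall A : set (vec R d), measurable A ->
    distribution P X A = (\int[lebesgue_vec R d]_(x in A) (f x)%:E)%E.

End densities.

Definition mutually_independent (R : realType) dT (T : measurableType dT)
    (P : probability T R) dU (U : measurableType dU)
    (X : nat -> {RV P >-> U}) :=
  forall (J : {fset nat}) (A : nat -> set U), (forall i, measurable (A i)) ->
    P (\bigcap_(i in [set` J]) (X i @^-1` A i)) =
    (\prod_(i <- J) P (X i @^-1` A i))%E.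

Section kozachenko_leonenko.
Context {R : realType} {d : nat}.
(* The sample is x 1, ..., x n; x 0 is not part of it. *)
Variables (x : nat -> vec R d) (n : nat).

(* The minimum is taken in the extended reals, where +oo is neutral; for
   2 <= n its range is nonempty, so that it is finite. *)
Definition nn_distance (i : nat) (y : vec R d) : R :=
  fine (\big[mine/+oo]_(1 <= j < n.+1 | j != i) (enorm (vsub y (x j)))%:E)%E.

Definition kl_entropy : R :=
  n%:R^-1 * (\sum_(1 <= i < n.+1)
    ln ((n%:R - 1) * nn_distance i (x i) ^+ d * unit_ball_volume R d))
  + euler_mascheroni R.

End kozachenko_leonenko.

(* Main.v *)
Require Import Defs.
From HB Require Import structures.
From mathcomp Require Import all_boot all_order all_algebra finmap.
From mathcomp Require Import all_classical all_reals all_analysis.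
From mathcomp Require Import measurable_realfun ring lra.
Import Order.TTheory GRing.Theory Num.Theory.
Import numFieldNormedType.Exports.
Local Open Scope classical_set_scope.
Local Open Scope ring_scope.

(** Write m = n - 1, let mu be the law of X, b_r(x) = mu(ball x r), and let Z_i
    be the logarithm of m v rho^d, rho being the distance of X_i to the rest of
    the sample ([log_nn]); the estimate is the mean of the Z_i plus the
    Euler-Mascheroni constant.  Everything rests on the events Z_i > s.  If r is
    the radius for which m balls of radius r have total volume e^s
    ([vol_radius]), then Z_i > s says that the ball of radius r around X_i is
    void of other sample points, and by independence
      P(Z_i > s) = \int (1 - b_r)^m dmu        ([void_prob], [prob_void_event]).

    Limit law.  As m grows, r tends to 0 and m b_r(x) is close to e^s f(x), so
    these probabilities tend to \int exp(- e^s f) dmu ([void_lim_approx]).  This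
    is P(ln S - ln f(X) > s) for a standard exponential S independent of X, and
    the mean of ln S - ln f(X) is H(f) minus the Euler-Mascheroni constant
    ([mean_log_ratio]): the correct centring.  Since f is only integrable, the
    approximation of m b_r by e^s f is made in L1(lambda) ([mean_continuous]),
    and only then carried to mu, off a set {f > K} of small mu-mass.

    Law of large numbers.  If two sample points are more than 2r apart, their
    balls of radius r are disjoint and their void events are negatively
    correlated given the two points, whereas being closer has probability
    \int b_(2r) dmu, which tends to 0 ([prob_two_void_events]).  Hence, for each
    s, the proportion of the i with Z_i > s converges in L1 to its limit
    ([frequency_log_nn]), by a second moment estimate.

    From proportions to means.  A real z is, up to 1/N, the integral of the
    indicators of s < z over a grid of mesh 1/N in [-M, M], plus an excess that
    is at most the number of integers k >= M with k < z or z <= -k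
    ([levels_L1]).  The theorem thus reduces to the sums over k of P(Z_i > k)
    and of P(Z_i <= -k), uniformly in n.

    - Lower tail.  1 - (1 - b_r)^m <= min(1, m b_r), whose mu-integral is at most
      mu{f > K} + K e^s.  With s = -k and K = e^(k/2), the sum over k is finite
      because ln f is mu-integrable ([void_prob_ge_lower_tail],
      [lower_tail_sum]): this is the only use of the entropy hypothesis beyond
      the centring.
    - Upper tail.  If m >= e^(k/2), a void ball is a rare event except at points
      where mu is sparse, and a bounded region contains little mass made of
      sparse points ([sparse_mass]); if m < e^(k/2), the ball is so large that
      X or its neighbours must be far from the origin.  Both bounds involve only
      probabilities that norm X exceeds an exponential in k, so that they are
      summable as soon as the positive part of ln (norm X) is integrable
      ([void_prob_le_upper_tail], [upper_tail_sum]).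

    Conversely, suppose that a single n >= 2 has a finite mean error.  The lower
    tail makes the negative parts of the Z_i integrable, so Z_1 is integrable
    and the sum over k of P(Z_1 > k) is finite.  A point at distance M + r from
    the origin has a void r-ball as soon as the m others lie in the ball of
    radius M, which has positive probability; so P(norm X > M + r) is at most a
    constant times P(Z_1 > k), with r growing like e^(k/d), and the log moment
    is finite ([log_moment_lty]). *)

(** * Counting integers below a real number *)

Section counting.
Context {R : realType}.
Implicit Type z : R.

Lemma min_le_count z n :
  Num.min z n%:R <= \sum_(k < n) ((k%:R < z)%R%:R : R).
Proof.
elim: n => [|n IH]; first by rewrite big_ord0 ge_min lexx orbT.
rewrite big_ord_recr/=; case: (ltP n%:R z) => nz /=.
  rewrite (le_trans _ (lerD IH (lexx 1)))//.
  by rewrite (min_r (ltW nz)) -natr1 ge_min lexx orbT.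
by rewrite addr0 (le_trans _ IH)// le_min !ge_min lexx (le_trans nz)// /= nz.
Qed.

Lemma count_le_n z n : \sum_(k < n) ((k%:R < z)%R%:R : R) <= n%:R.
Proof.
elim: n => [|n IH]; first by rewrite big_ord0.
by rewrite big_ord_recr -natr1 lerD//=; case: (_ < _).
Qed.

Lemma count_le_max z n :
  \sum_(k < n) ((k%:R < z)%R%:R : R) <= Num.max 0 (z + 1).
Proof.
elim: n => [|n IH]; first by rewrite big_ord0 le_max lexx.
rewrite big_ord_recr/=; case: (ltP n%:R z) => nz /=; last by rewrite addr0.
rewrite le_max; apply/orP; right; rewrite lerD2r.
by rewrite (le_trans (count_le_n _ _))// ltW.
Qed.

Lemma count_ge0 z n : 0 <= \sum_(k < n) ((k%:R < z)%R%:R : R).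
Proof. by apply: sumr_ge0 => i _; case: (_ < _). Qed.

(** After the substitution a = N (z + M), the sum counts the integers of
    [0, 2MN) below a: it is a up to 1 when a lies in the range of the count, and
    the count saturates otherwise. *)
Lemma step_approx z (N M : nat) : (0 < N)%N ->
  `|- M%:R + N%:R^-1 * \sum_(k < 2 * M * N) ((- M%:R + k%:R / N%:R < z)%R%:R : R)
     - z| <= N%:R^-1 + Num.max 0 (`|z| - M%:R).
Proof.
move=> N0; have N0R : 0 < N%:R :> R by rewrite ltr0n.
have Ninv : 0 < N%:R^-1 :> R by rewrite invr_gt0.
pose a := N%:R * (z + M%:R).
have -> : \sum_(k < 2 * M * N) ((- M%:R + k%:R / N%:R < z)%R%:R : R) =
          \sum_(k < 2 * M * N) ((k%:R < a)%R%:R : R).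
  apply: eq_bigr => k _; congr (nat_of_bool _)%:R.
  by rewrite /a [N%:R * _]mulrC -ltr_pdivrMr// -ltrBlDr addrC.
set S := \sum_(k < _) _.
have S1 := min_le_count a (2 * M * N); have S2 := count_le_max a (2 * M * N).
have S3 := count_le_n a (2 * M * N); have S4 := count_ge0 a (2 * M * N).
rewrite -/S in S1 S2 S3 S4.
have K : (2 * M * N)%:R = N%:R * (2 * M%:R) :> R by rewrite !natrM; ring.
rewrite K in S1 S3.
have E (x : R) : N%:R^-1 * (N%:R * x) = x by rewrite mulrA mulVf ?mul1r// gt_eqF.
have M0 : 0 <= M%:R :> R by [].
have [/andP[T1 T2]|[zM|Mz]] :
    (- M%:R <= z <= M%:R) \/ (z < - M%:R) \/ (M%:R < z).
- case: (ltP z (- M%:R)) => ?; first by right; left.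
  by case: (ltP M%:R z) => ?; [right; right|left; apply/andP].
- rewrite min_l in S1; last by rewrite /a ler_pM2l//; lra.
  have a0 : 0 <= a by apply: mulr_ge0 => //; lra.
  rewrite max_r in S2; last by lra.
  have := ler_wpM2l (ltW Ninv) S1; rewrite /a E => U1.
  have := ler_wpM2l (ltW Ninv) S2; rewrite mulrDr /a E mulr1 => U2.
  rewrite max_l ?addr0 ?ler_norml; last by rewrite subr_le0 ler_norml T1.
  by apply/andP; split; lra.
- have a0 : a <= 0 by apply: mulr_ge0_le0 => //; lra.
  have U2 : N%:R^-1 * S <= N%:R^-1.
    rewrite ler_piMr ?(ltW Ninv)// (le_trans S2)// ge_max ler01/=; lra.
  have U1 : 0 <= N%:R^-1 * S by rewrite mulr_ge0// ltW.
  rewrite (@ltr0_norm _ z); last by lra.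
  rewrite max_r ?ler_norml; last by lra.
  by apply/andP; split; lra.
- have aK : N%:R * (2 * M%:R) <= a by rewrite /a ler_pM2l//; lra.
  rewrite min_r// in S1.
  have -> : S = N%:R * (2 * M%:R) by apply/eqP; rewrite eq_le S1 S3.
  rewrite E (@gtr0_norm _ z); last by lra.
  rewrite max_r ?ler_norml; last by lra.
  by apply/andP; split; lra.
Qed.

Lemma count_series_ge z :
  (z%:E <= \sum_(0 <= k <oo) ((k%:R < z)%R%:R : R)%:E)%E.
Proof.
pose n := (Num.truncn z).+1.
have zn : z < n%:R by rewrite truncnS_gt.
apply: (@le_trans _ _ (\sum_(0 <= k < n) ((k%:R < z)%R%:R : R)%:E)%E).
  by have := min_le_count z n; rewrite min_l ?(ltW zn)// sumEFin lee_fin big_mkord.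
by apply: nneseries_lim_ge => k _ _; rewrite lee_fin; case: (_ < _).
Qed.

Lemma count_series_le z :
  (\sum_(0 <= k <oo) ((k%:R < z)%R%:R : R)%:E <= (Num.max 0 (z + 1))%:E)%E.
Proof.
apply: lime_le.
  by apply: is_cvg_nneseries => k _ _; rewrite lee_fin; case: (_ < _).
by near=> n; rewrite sumEFin lee_fin big_mkord; exact: count_le_max.
Unshelve. all: by end_near. Qed.

(** Only one of the two indicators can contribute, according to the sign of z;
    writing both makes the bound linear in the two tails of z. *)
Lemma tail_excess z M :
  ((Num.max 0 (`|z| - M%:R))%:E <= \sum_(M <= k <oo)
   (((k%:R < z)%R%:R + (z <= - k%:R)%R%:R : R)%:E))%E.
Proof.
have [h|h] := leP (`|z| - M%:R) 0.
  by apply: nneseries_ge0 => k _ _; rewrite lee_fin addr_ge0.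
set y := `|z| - M%:R in h *; pose n := (Num.truncn y).+1.
have yn : y < n%:R by rewrite truncnS_gt.
apply: (@le_trans _ _ (\sum_(M <= k < n + M)
   (((k%:R < z)%R%:R + (z <= - k%:R)%R%:R : R)%:E))%E); last first.
  by apply: nneseries_lim_ge => k _ _; rewrite lee_fin addr_ge0.
rewrite sumEFin lee_fin -[X in \sum_(X <= _ < _) _]add0n big_addn addnK big_mkord.
have := min_le_count y n; rewrite min_l ?(ltW yn)// => /le_trans; apply.
apply: ler_sum => k _.
rewrite natrD; case: (ltP k%:R y) => h' /=; last first.
  by rewrite addr_ge0.
have : k%:R + M%:R < `|z| by rewrite /y in h'; lra.
case: (leP 0 z) => z0 kz.
  by move: kz; rewrite (ger0_norm z0) => ->; rewrite lerDl.
move: kz; rewrite (ltr0_norm z0) => kz.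
have -> : (z <= - (k%:R + M%:R)) = true by apply/ltW; rewrite ltrNr.
by rewrite lerDr.
Qed.

End counting.

(** * Integration against a density *)

Section image_measure.
Context d1 d2 (T1 : measurableType d1) (T2 : measurableType d2) (R : realType).
Variables (m : {measure set T1 -> \bar R}) (f : T1 -> T2).
Hypothesis mf : measurable_fun setT f.

Definition image_measure : {measure set T2 -> \bar R}.
Proof. by unshelve refine (pushforward m f : {measure set T2 -> \bar R}). Defined.

End image_measure.
Arguments image_measure {d1 d2 T1 T2 R} m {f} mf.

Lemma measurable_gt_level {dT} {T : measurableType dT} {R : realType}
  (z : T -> R) (a : R) : measurable_fun setT z -> measurable [set x | a < z x].
Proof.
move=> mz; have := mz measurableT _ (@measurable_itv R `]a, +oo[); rewrite setTI.
by congr measurable; apply/seteqP; split => x; rewrite /= in_itv/= andbT.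
Qed.

Lemma measurable_box {dU} {U : measurableType dU} (n : nat)
  (B : 'I_n -> set U) : (forall i, measurable (B i)) ->
  measurable [set y : n.-tuple U | forall i, B i (tnth y i)].
Proof.
move=> mB; rewrite (_ : [set _ | _] = \bigcap_(i in [set: 'I_n])
    ((fun y : n.-tuple U => tnth y i) @^-1` B i)).
  apply: fin_bigcap_measurable => // i _.
  by rewrite -[X in measurable X]setTI; exact: measurable_tnth.
by apply/seteqP; split => y /= Hy i; [move=> _; exact: Hy|exact: Hy].
Qed.

Section density_measure.
Context {dT} {T : measurableType dT} {R : realType}.
Variables (nu mu : {measure set T -> \bar R}) (f : T -> R).
Hypothesis mf : measurable_fun setT f.
Hypothesis f0 : forall x, 0 <= f x.
Hypothesis dens : forall A, measurable A -> nu A = (\int[mu]_(x in A) (f x)%:E)%E.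
Local Open Scope ereal_scope.
Import HBNNSimple.

Let mfE : measurable_fun setT (fun x => (f x)%:E).
Proof. exact/measurable_EFinP. Qed.

Let integral_density_indic A : measurable A ->
  \int[nu]_x (\1_A x)%:E = \int[mu]_x ((\1_A x)%:E * (f x)%:E).
Proof.
move=> mA; rewrite integral_indic// setIT dens// integral_mkcond.
apply: eq_integral => x _; rewrite patchE indicE.
by case: (x \in A); rewrite ?mul1e ?mul0e.
Qed.

(** The defining identity of the density is the case of an indicator; simple
    functions follow by linearity, and the general case by monotone
    convergence. *)
Lemma integral_density (g : T -> \bar R) :
  measurable_fun setT g -> (forall x, 0 <= g x) ->
  \int[nu]_x g x = \int[mu]_x (g x * (f x)%:E).
Proof.
move=> mg g0.
pose h := nnsfun_approx measurableT mg.
have hg x : (h n x)%:E @[n --> \oo] --> g x by exact: cvg_nnsfun_approx.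
have mh n : measurable_fun setT (fun x => (h n x)%:E).
  by apply/measurable_EFinP; exact: measurable_funP.
have ndh x : {homo (fun n => (h n x)%:E) : m n / (m <= n)%N >-> m <= n}.
  by move=> m n mn; rewrite lee_fin; exact/lefP/nd_nnsfun_approx.
transitivity (limn (fun n => \int[nu]_x (h n x)%:E)).
  rewrite -monotone_convergence//; last by move=> n x _; rewrite lee_fin.
  by apply: eq_integral => x _; apply/esym/cvg_lim => //; exact: hg.
transitivity (limn (fun n => \int[mu]_x ((h n x)%:E * (f x)%:E))); last first.
  rewrite -monotone_convergence//.
  - apply: eq_integral => x _; apply/cvg_lim => //.
    by apply: cvgeZr; [|exact: hg].
  - by move=> n; apply: emeasurable_funM.
  - by move=> n x _; rewrite mule_ge0// lee_fin.
  - by move=> x _ m n mn; rewrite lee_wpmul2r ?lee_fin//; exact/lefP/nd_nnsfun_approx.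
congr (limn _); apply/funext => n.
have mi r : measurable_fun setT (fun x => (r * \1_(h n @^-1` [set r]) x)%:E).
  by apply/measurable_EFinP; exact: measurable_funM.
transitivity (\int[nu]_x
   (\sum_(y \in range (h n)) (y * \1_(h n @^-1` [set y]) x)%:E)).
  by apply: eq_integral => t tE; rewrite /= fimfunE -fsumEFin.
rewrite ge0_integral_fsum//; last by move=> r x _; exact: nnfun_muleindic_ge0.
transitivity (\int[mu]_x (\sum_(y \in range (h n))
    (y * \1_(h n @^-1` [set y]) x)%:E * (f x)%:E)); last first.
  apply: eq_integral => x _; rewrite -ge0_mule_fsuml => [|y]; last first.
    exact: nnfun_muleindic_ge0.
  by rewrite fsumEFin // -(fimfunE _ x).
rewrite ge0_integral_fsum//; last 2 first.
- by move=> y; apply: emeasurable_funM.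
- move=> r x _; rewrite mule_ge0 ?lee_fin//.
  exact: (nnfun_muleindic_ge0 (h n)).
apply: eq_fsbigr => r rhn.
under eq_integral do rewrite EFinM.
rewrite integralZl_indic_nnsfun// integral_density_indic//.
under [RHS]eq_integral do rewrite EFinM -muleA.
rewrite ge0_integralZl//.
- by apply: emeasurable_funM => //; exact/measurable_EFinP.
- by move=> x _; rewrite mule_ge0// lee_fin.
- by move: rhn; rewrite inE => -[t _ <-]; rewrite lee_fin.
Qed.

End density_measure.

Lemma integral_prob_cst {dT} {T : measurableType dT} {R : realType}
  (P : probability T R) (c : R) : (\int[P]_x c%:E = c%:E)%E.
Proof.
rewrite integral_cst// [X in (_ * X)%E](_ : _ = 1%E) ?mule1//.
exact: probability_setT.
Qed.

Section ereal_sequences.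
Context {R : realType}.
Implicit Types u : nat -> \bar R.

Lemma cvge_eventually_lt u (l a : \bar R) : u @ \oo --> l -> (l < a)%E ->
  exists N, forall n, (N <= n)%N -> (u n < a)%E.
Proof.
move=> ul la; have /ul[N _ NP] := open_ereal_lt' la.
by exists N => n Nn; exact: NP.
Qed.

Lemma cvge_eventually_gt u (l a : \bar R) : u @ \oo --> l -> (a < l)%E ->
  exists N, forall n, (N <= n)%N -> (a < u n)%E.
Proof.
move=> ul la; have /ul[N _ NP] := open_ereal_gt' la.
by exists N => n Nn; exact: NP.
Qed.

(** The values may be infinite at first: this is how the convergence of
    extended expectations is established below. *)
Lemma cvge0_ge0P u : (forall n, (0 <= u n)%E) ->
  (forall e : R, 0 < e -> exists N, forall n, (N <= n)%N -> (u n <= e%:E)%E) ->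
  u @ \oo --> 0%E.
Proof.
move=> u0 H; apply/fine_cvgP; split.
  have [N NP] := H 1 ltr01; exists N => // n /= Nn.
  by rewrite ge0_fin_numE// (le_lt_trans (NP _ Nn))// ltry.
apply/cvgr0Pnorm_le => e e0; have [N NP] := H e e0.
exists N => // n /= Nn; have := NP _ Nn => une.
have uf : u n \is a fin_num by rewrite ge0_fin_numE// (le_lt_trans une)// ltry.
by rewrite ger0_norm ?fine_ge0// -lee_fin fineK.
Qed.

End ereal_sequences.

(** * Euclidean geometry and the volume of balls *)

(** The quadratic polynomial t |-> sum (a_i - t b_i)^2 is nonnegative. *)
Lemma sum_cauchy_schwarz {R : realType} {n} (a b : 'I_n -> R) :
  \sum_i (a i * b i) <=
  Num.sqrt (\sum_i (a i ^+ 2)) * Num.sqrt (\sum_i (b i ^+ 2)).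
Proof.
set A := \sum_i (a i ^+ 2); set B := \sum_i (b i ^+ 2); set C := \sum_i _.
have A0 : 0 <= A by apply: sumr_ge0 => i _; exact: sqr_ge0.
have B0 : 0 <= B by apply: sumr_ge0 => i _; exact: sqr_ge0.
have H t : 0 <= A - (2 * t) * C + t ^+ 2 * B.
  have -> : A - (2 * t) * C + t ^+ 2 * B = \sum_i (a i - t * b i) ^+ 2.
    rewrite /A /B /C !mulr_sumr -sumrN -!big_split/=.
    by apply: eq_bigr => i _; ring.
  by apply: sumr_ge0 => i _; exact: sqr_ge0.
rewrite -sqrtrM//; case: (leP C 0) => [C0|C0].
  by rewrite (le_trans C0)// sqrtr_ge0.
have B1 : 0 < B.
  rewrite lt_neqAle B0 andbT eq_sym; apply/eqP => B1.
  (* were B = 0, the polynomial would be affine, and negative at this t *)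
  have := H ((A + 1) / (2 * C)); rewrite B1 mulr0 addr0.
  have -> : 2 * ((A + 1) / (2 * C)) * C = A + 1 by field; rewrite gt_eqF.
  lra.
rewrite -[leLHS](ger0_norm (ltW C0)) -sqrtr_sqr ler_wsqrtr//.
(* the minimum of the polynomial *)
have := H (C / B).
have -> : A - 2 * (C / B) * C + (C / B) ^+ 2 * B = A - C ^+ 2 / B.
  by field; rewrite gt_eqF.
by rewrite subr_ge0 ler_pdivrMr.
Qed.

Section euclidean_geometry.
Context {R : realType} {d : nat}.
Implicit Types x y z : vec R d.

Definition vdist x y : R := enorm (vsub x y).

Definition vzero : vec R d := [tuple (0 : R) | i < d].

Definition cball x (r : R) : set (vec R d) := [set y | vdist x y <= r].

Lemma enorm_ge0 x : 0 <= enorm x.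
Proof. exact: sqrtr_ge0. Qed.

Lemma vdist_ge0 x y : 0 <= vdist x y.
Proof. exact: enorm_ge0. Qed.

Lemma vdistE x y :
  vdist x y = Num.sqrt (\sum_(i < d) ((tnth x i : R) - tnth y i) ^+ 2).
Proof. by congr Num.sqrt; apply: eq_bigr => i _; rewrite tnth_mktuple. Qed.

Lemma vdistC x y : vdist x y = vdist y x.
Proof.
rewrite !vdistE; congr Num.sqrt; apply: eq_bigr => i _.
by rewrite -sqrrN opprB.
Qed.

Lemma enorm_vdist x : enorm x = vdist x vzero.
Proof.
rewrite vdistE; congr Num.sqrt; apply: eq_bigr => i _.
by rewrite tnth_mktuple subr0.
Qed.

Lemma vdist_triangle y x z : vdist x z <= vdist x y + vdist y z.
Proof.
rewrite -[leRHS]ger0_norm ?addr_ge0 ?vdist_ge0// -sqrtr_sqr vdistE ler_wsqrtr//.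
rewrite sqrrD !vdistE !sqr_sqrtr; last 2 first.
- by apply: sumr_ge0 => i _; exact: sqr_ge0.
- by apply: sumr_ge0 => i _; exact: sqr_ge0.
have /(ler_wpM2l (ler0n R 2)) := sum_cauchy_schwarz
  (fun i => (tnth x i : R) - tnth y i) (fun i => (tnth y i : R) - tnth z i).
set Q := Num.sqrt _ * _ => HQ.
rewrite -mulr_natl -/Q.
apply: (@le_trans _ _ ((\sum_(i < d) ((tnth x i : R) - tnth y i) ^+ 2) +
   2 * (\sum_(i < d) ((tnth x i : R) - tnth y i) * ((tnth y i : R) - tnth z i)) +
   (\sum_(i < d) ((tnth y i : R) - tnth z i) ^+ 2))); last by rewrite lerD2r lerD2l.
rewrite mulr_sumr -!big_split/= le_eqVlt; apply/orP; left; apply/eqP.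
by apply: eq_bigr => i _; ring.
Qed.

Lemma enorm_le_dist x y : enorm x <= vdist x y + enorm y.
Proof. by rewrite !enorm_vdist; exact: vdist_triangle. Qed.

Lemma measurable_coord i : measurable_fun setT (fun x : vec R d => (tnth x i : R)).
Proof. exact: measurable_tnth. Qed.

Lemma measurable_vdist dU (U : measurableType dU) (f g : U -> vec R d) :
  measurable_fun setT f -> measurable_fun setT g ->
  measurable_fun setT (fun u => vdist (f u) (g u)).
Proof.
move=> mf mg; under eq_fun do rewrite vdistE.
apply: measurableT_comp; first exact: (continuous_measurable_fun (@sqrt_continuous R)).
apply: measurable_sum => i; apply: measurable_funX; apply: measurable_funB.
  exact: (measurableT_comp (measurable_coord i) mf).
exact: (measurableT_comp (measurable_coord i) mg).
Qed.

Lemma measurable_enorm : measurable_fun setT (fun x : vec R d => enorm x).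
Proof.
under eq_fun do rewrite enorm_vdist.
by apply: measurable_vdist => //; exact: measurable_cst.
Qed.

Lemma measurable_le_dist (r : R) :
  measurable [set p : vec R d * vec R d | vdist p.1 p.2 <= r].
Proof.
have m : measurable_fun setT (fun p : vec R d * vec R d => vdist p.1 p.2).
  by apply: measurable_vdist.
have := m measurableT _ (@measurable_itv R `]-oo, r]).
rewrite setTI (_ : _ @^-1` _ = [set p | vdist p.1 p.2 <= r])//.
Qed.

Lemma xsection_le_dist (r : R) x :
  xsection [set p : vec R d * vec R d | vdist p.1 p.2 <= r] x = cball x r.
Proof. by apply/seteqP; split => y; rewrite /xsection/= inE. Qed.

Lemma measurable_cball x r : measurable (cball x r).
Proof.
rewrite -xsection_le_dist; apply: measurable_xsection.
exact: measurable_le_dist.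
Qed.

End euclidean_geometry.

Section affine_change.
Context {R : realType}.

Definition affine1 (c b : R) (a : measurableTypeR R) : measurableTypeR R :=
  (c * (a : R) + b : R).

Lemma measurable_affine1 c b : measurable_fun setT (affine1 c b).
Proof. by apply: measurable_funD => //; apply: measurable_funM. Qed.

Lemma lebesgue_affine1 (c b : R) (A : set (measurableTypeR R)) :
  0 < c -> measurable A ->
  lebesgue_measure A = (c%:E * lebesgue_measure (affine1 c b @^-1` A))%E.
Proof.
move=> c0 mA; pose cn := NngNum (ltW c0).
have -> : (c%:E * lebesgue_measure (affine1 c b @^-1` A))%E =
  mscale cn (image_measure lebesgue_measure (measurable_affine1 c b)) A by [].
apply: lebesgue_measure_unique => // _ [[u v] _ <-] /=.
rewrite /mscale/= /pushforward.
have -> : affine1 c b @^-1` `]u, v]%classic =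
          `](u - b) / c, (v - b) / c]%classic.
  apply/seteqP; split => a; rewrite /= !in_itv/= /affine1;
  by rewrite ltr_pdivrMr// ler_pdivlMr// ltrBlDr lerBrDr [a * c]mulrC.
rewrite !lebesgue_measure_itv/= !lte_fin ltr_pM2r ?invr_gt0//.
rewrite ltrD2r; case: ifPn => _; last by rewrite mule0.
rewrite -!EFinB -EFinM; congr EFin; field; exact: lt0r_neq0.
Qed.

Definition vaffine n (c : R) (b : vec R n) (x : vec R n) : vec R n :=
  [tuple (c * (tnth x i : R) + tnth b i : R) | i < n].

Lemma measurable_vaffine n c (b : vec R n) : measurable_fun setT (vaffine n c b).
Proof.
apply/measurable_fun_tnthP => i.
have -> : (tnth (T:=measurableTypeR R))^~ i \o vaffine n c b =
   affine1 c (tnth b i) \o (fun x => tnth x i).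
  by apply/funext => x /=; rewrite tnth_mktuple.
apply: measurableT_comp; first exact: measurable_affine1.
exact: measurable_tnth.
Qed.

Lemma vaffine_cons n c (b : vec R n.+1) (p : measurableTypeR R * vec R n) :
  vaffine n.+1 c b (vcons p) =
  vcons (affine1 c (thead b) p.1, vaffine n c (vsplit b).2 p.2).
Proof.
apply: eq_from_tnth => i; rewrite tnth_mktuple.
case: (unliftP ord0 i) => [j ->|->]; last by rewrite !tnth0.
rewrite !tnthS/= tnth_mktuple/=.
by rewrite [in LHS](tuple_eta b) tnthS.
Qed.

(** Both sides are the same product measure: by uniqueness it suffices to
    compare them on rectangles, where induction on the dimension applies. *)
Lemma lebesgue_vaffine n c (b : vec R n) (A : set (vec R n)) :
  0 < c -> measurable A ->
  lebesgue_vec R n A = ((c ^+ n)%:E * lebesgue_vec R n (vaffine n c b @^-1` A))%E.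
Proof.
move=> c0; elim: n b A => [|n IH] b A mA.
  rewrite expr0 mul1e; congr (lebesgue_vec R 0 _); apply/seteqP.
  by split => x /=; rewrite (tuple0 x) (tuple0 (vaffine _ _ _ _)).
pose cn := NngNum (ltW (exprn_gt0 n.+1 c0)).
pose psi (p : measurableTypeR R * vec R n) : measurableTypeR R * vec R n :=
  (affine1 c (thead b) p.1, vaffine n c (vsplit b).2 p.2).
have mpsi : measurable_fun setT psi.
  apply/measurable_fun_pairP; split => /=.
    exact: (measurableT_comp (measurable_affine1 _ _) measurable_fst).
  exact: (measurableT_comp (measurable_vaffine _ _ _) measurable_snd).
pose m0 := image_measure (lebesgue_measure \x lebesgue_vec R n)%E mpsi.
have E : forall X, measurable X -> (lebesgue_measure \x lebesgue_vec R n)%E X =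
    mscale cn m0 X.
  apply: product_measure_unique => B C mB mC.
  change ((c ^+ n.+1)%:E * (lebesgue_measure \x lebesgue_vec R n)
    (psi @^-1` (B `*` C)) = lebesgue_measure B * lebesgue_vec R n C)%E.
  have -> : psi @^-1` (B `*` C) = (affine1 c (thead b) @^-1` B) `*`
     (vaffine n c (vsplit b).2 @^-1` C) by [].
  rewrite product_measure1E; last 2 first.
    by rewrite -[X in measurable X]setTI; exact: measurable_affine1.
    by rewrite -[X in measurable X]setTI; exact: measurable_vaffine.
  rewrite (lebesgue_affine1 c (thead b) B)// (IH (vsplit b).2 C)//.
  by rewrite exprS EFinM -!muleA; congr (_ * _)%E; rewrite muleCA.
have mA' : measurable (@vcons R n @^-1` A).
  by rewrite -[X in measurable X]setTI; exact: measurable_vcons.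
rewrite /= {1}/lebesgue_cons /pushforward E//.
change ((c ^+ n.+1)%:E * (lebesgue_measure \x lebesgue_vec R n)
    (psi @^-1` (@vcons R n @^-1` A)) = (c ^+ n.+1)%:E *
  (lebesgue_measure \x lebesgue_vec R n)
    (@vcons R n @^-1` (vaffine n.+1 c b @^-1` A)))%E.
congr (_ * (_ \x _) _)%E.
by apply/seteqP; split => p /=; rewrite vaffine_cons.
Qed.

End affine_change.

Section ball_volume.
Context {R : realType} {d : nat}.
Implicit Types x : vec R d.

Lemma vaffine_cball x (r : R) : 0 < r ->
  vaffine d r x @^-1` (cball x r) = [set y | enorm y <= 1].
Proof.
move=> r0.
have E y : vdist x (vaffine d r x y) = r * enorm y.
  rewrite vdistE /enorm.
  have -> : \sum_(i < d) ((tnth x i : R) - tnth (vaffine d r x y) i) ^+ 2 =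
            r ^+ 2 * \sum_(i < d) (tnth y i : R) ^+ 2.
    by rewrite mulr_sumr; apply: eq_bigr => i _; rewrite tnth_mktuple; ring.
  by rewrite sqrtrM ?sqr_ge0// sqrtr_sqr gtr0_norm.
by apply/seteqP; split => y; rewrite /cball/= E -{2}[r]mulr1 ler_pM2l.
Qed.

Let unit_ball : set (vec R d) := [set y | enorm y <= 1].

Let munit : measurable unit_ball.
Proof.
rewrite (_ : unit_ball = cball vzero 1); first exact: measurable_cball.
by apply/seteqP; split => y; rewrite /unit_ball/cball/= enorm_vdist vdistC.
Qed.

Lemma unit_ball_lty : (lebesgue_vec R d unit_ball < +oo)%E.
Proof.
pose A (i : 'I_d) : set (measurableTypeR R) := `[(-1 : R), 1]%classic.
have mA i : measurable (A i) by exact: measurable_itv.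
have /le_lt_trans : (lebesgue_vec R d unit_ball <=
    lebesgue_vec R d [set x | forall i, A i (tnth x i)])%E.
  apply: le_measure; rewrite ?inE//.
    exact: measurable_box.
  move=> y /= y1 i; rewrite /A/= in_itv/= -ler_norml.
  apply: (le_trans _ y1); rewrite /enorm -sqrtr_sqr ler_wsqrtr//.
  by rewrite (bigD1 i)//= lerDl sumr_ge0// => j _; exact: sqr_ge0.
apply; rewrite lebesgue_vec_box//.
have -> : (\prod_(i < d) lebesgue_measure (A i) = \prod_(i < d) (2%:E : \bar R))%E.
  apply: eq_bigr => i _; rewrite lebesgue_measure_itv/= lte_fin.
  by rewrite ifT -?EFinB; [congr EFin; ring|lra].
by rewrite prodEFin ltry.
Qed.

(** The unit ball contains the cube of half-side 1/(d+1), as d (d+1)^-2 <= 1. *)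
Lemma unit_ball_gt0 : (0 < lebesgue_vec R d unit_ball)%E.
Proof.
pose e : R := d.+1%:R^-1.
have e0 : 0 < e by rewrite invr_gt0.
pose A (i : 'I_d) : set (measurableTypeR R) := `[(- e : R), e]%classic.
have mA i : measurable (A i) by exact: measurable_itv.
have /(lt_le_trans _) : (lebesgue_vec R d [set x | forall i, A i (tnth x i)] <=
    lebesgue_vec R d unit_ball)%E.
  apply: le_measure; rewrite ?inE//.
    exact: measurable_box.
  move=> y /= Hy; rewrite /unit_ball/= /enorm -[leRHS]sqrtr1 ler_wsqrtr//.
  apply: (@le_trans _ _ (\sum_(i < d) e)).
    apply: ler_sum => i _; have := Hy i; rewrite /A/= in_itv/= -ler_norml => H.
    rewrite -real_normK ?num_real// (@le_trans _ _ (e ^+ 2))//.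
      by rewrite lerXn2r// nnegrE// ltW.
    by rewrite expr2 ler_piMr ?(ltW e0)// /e invf_le1// ler1n.
  rewrite sumr_const card_ord -mulr_natl /e ler_pdivrMr// mul1r ler_nat.
  exact: leqnSn.
apply; rewrite lebesgue_vec_box//.
have -> : (\prod_(i < d) lebesgue_measure (A i) =
    \prod_(i < d) ((e + e)%:E : \bar R))%E.
  apply: eq_bigr => i _; rewrite lebesgue_measure_itv/= lte_fin.
  by rewrite ifT -?EFinB ?opprK//; lra.
by rewrite prodEFin lte_fin prodr_gt0// => i _; rewrite addr_gt0.
Qed.

Local Notation v := (unit_ball_volume R d).

Lemma unit_ball_volumeE : lebesgue_vec R d unit_ball = v%:E.
Proof. by rewrite /unit_ball_volume fineK// ge0_fin_numE// unit_ball_lty. Qed.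

Lemma unit_ball_volume_gt0 : 0 < v.
Proof. by rewrite -lte_fin -unit_ball_volumeE unit_ball_gt0. Qed.

Lemma lebesgue_cball x (r : R) : 0 < r ->
  lebesgue_vec R d (cball x r) = (v * r ^+ d)%:E.
Proof.
move=> r0; rewrite (lebesgue_vaffine _ r x)//; last exact: measurable_cball.
by rewrite vaffine_cball// unit_ball_volumeE -EFinM mulrC.
Qed.

End ball_volume.

(** * Integrable functions are continuous in the mean *)

Section smoothing.
Context {R : realType} {d : nat}.
Local Notation V := (vec R d).
Local Notation lam := (lebesgue_vec R d).
Local Notation v := (unit_ball_volume R d).
Implicit Types (r e : R) (f g : V -> R) (h k : V * V -> R).

Definition near_pairs (r : R) : set (V * V) := [set p | vdist p.1 p.2 <= r].

Definition near_integral (r : R) (h : V * V -> R) : \bar R :=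
  (\int[lam \x lam]_p (h p * \1_(near_pairs r) p)%:E)%E.

Lemma measurable_near_integrand r h : measurable_fun setT h ->
  measurable_fun setT (fun p => (h p * \1_(near_pairs r) p)%:E).
Proof.
move=> mh; apply/measurable_EFinP/measurable_funM => //.
by apply: measurable_indic; exact: measurable_le_dist.
Qed.

Lemma near_integrand_ge0 r h : (forall p, 0 <= h p) ->
  forall p, (0 <= (h p * \1_(near_pairs r) p)%:E)%E.
Proof. by move=> h0 p; rewrite lee_fin mulr_ge0. Qed.

Lemma near_integral_le r h k : measurable_fun setT h -> measurable_fun setT k ->
  (forall p, 0 <= h p) -> (forall p, h p <= k p) ->
  (near_integral r h <= near_integral r k)%E.
Proof.
move=> mh mk h0 hk; apply: ge0_le_integral => //.
- by move=> p _; exact: near_integrand_ge0.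
- exact: measurable_near_integrand.
- exact: measurable_near_integrand.
- by move=> p _; rewrite lee_fin ler_wpM2r.
Qed.

Lemma near_integralD r h k : measurable_fun setT h -> measurable_fun setT k ->
  (forall p, 0 <= h p) -> (forall p, 0 <= k p) ->
  (near_integral r (fun p => h p + k p)%R = near_integral r h + near_integral r k)%E.
Proof.
move=> mh mk h0 k0; rewrite /near_integral -ge0_integralD//.
- by apply: eq_integral => p _; rewrite mulrDl EFinD.
- by move=> p _; exact: near_integrand_ge0.
- exact: measurable_near_integrand.
- by move=> p _; exact: near_integrand_ge0.
- exact: measurable_near_integrand.
Qed.

Lemma near_integralZ r h (c : R) : measurable_fun setT h -> (forall p, 0 <= h p) ->
  0 <= c -> (near_integral r (fun p => c * h p)%R = c%:E * near_integral r h)%E.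
Proof.
move=> mh h0 c0; rewrite /near_integral -ge0_integralZl//.
- by apply: eq_integral => p _; rewrite -mulrA EFinM.
- exact: measurable_near_integrand.
- by move=> p _; exact: near_integrand_ge0.
Qed.

Lemma measurable_fun_swap h : measurable_fun setT h ->
  measurable_fun setT (fun p => h (p.2, p.1)).
Proof.
move=> mh; apply: measurableT_comp => //.
by apply/measurable_fun_pairP; split; [exact: measurable_snd|exact: measurable_fst].
Qed.

Lemma near_integral_swap r h : measurable_fun setT h -> (forall p, 0 <= h p) ->
  near_integral r (fun p => h (p.2, p.1)) = near_integral r h.
Proof.
move=> mh h0.
have mh' := measurable_fun_swap h mh.
rewrite /near_integral fubini_tonelli1; last 2 first.
- exact: (measurable_near_integrand r (fun p => h (p.2, p.1))).
- by move=> p; rewrite lee_fin mulr_ge0.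
rewrite fubini_tonelli2; last 2 first.
- exact: measurable_near_integrand.
- by move=> p; rewrite lee_fin mulr_ge0.
apply: eq_integral => x _; rewrite /fubini_F /fubini_G/=.
apply: eq_integral => y _ /=.
rewrite !indicE (_ : ((y, x) \in near_pairs r) = ((x, y) \in near_pairs r))//.
by apply/idP/idP; rewrite !inE /near_pairs/= vdistC.
Qed.

Lemma near_integral_fst r g : 0 < r -> measurable_fun setT g -> (forall x, 0 <= g x) ->
  near_integral r (fun p => g p.1) = ((v * r ^+ d)%:E * \int[lam]_x (g x)%:E)%E.
Proof.
move=> r0 mg g0.
rewrite /near_integral fubini_tonelli1; last 2 first.
- apply: measurable_near_integrand.
  exact: (measurableT_comp mg measurable_fst).
- by move=> p; rewrite lee_fin mulr_ge0.
rewrite -ge0_integralZl//; last 3 first.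
- exact/measurable_EFinP.
- by move=> x _; rewrite lee_fin.
- by rewrite lee_fin mulr_ge0 ?exprn_ge0 ?(ltW r0)// ltW// unit_ball_volume_gt0.
apply: eq_integral => x _; rewrite /fubini_F/=.
under eq_integral do rewrite EFinM.
rewrite ge0_integralZl//; last 2 first.
- apply/measurable_EFinP.
  apply: (measurableT_comp (measurable_indic _)); last exact: pair1_measurable.
  exact: measurable_le_dist.
- by rewrite lee_fin.
rewrite muleC; congr (_ * _)%E.
transitivity (\int[lam]_y (\1_(cball x r) y)%:E)%E.
  apply: eq_integral => y _; rewrite -xsection_le_dist !indicE.
  by rewrite mem_xsection.
rewrite integral_indic//; last exact: measurable_cball.
by rewrite setIT; exact: lebesgue_cball.
Qed.

Definition osc f (p : V * V) : R := `|f p.1 - f p.2|.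

Lemma osc_ge0 f p : 0 <= osc f p. Proof. exact: normr_ge0. Qed.

Lemma measurable_osc f : measurable_fun setT f -> measurable_fun setT (osc f).
Proof.
move=> mf; apply: measurableT_comp => //; apply: measurable_funB.
  exact: (measurableT_comp mf measurable_fst).
exact: (measurableT_comp mf measurable_snd).
Qed.

(** The average over x of the mean oscillation of f in the ball of radius r
    around x tends to 0.  This L1 form of the Lebesgue differentiation theorem
    is stable under L1 approximation. *)
Definition mean_continuous f := forall e, 0 < e ->
  exists2 rho, 0 < rho & forall r, 0 < r -> r <= rho ->
    (near_integral r (osc f) <= (e * (v * r ^+ d))%:E)%E.

Lemma vr_gt0 r : 0 < r -> 0 < v * r ^+ d.
Proof. by move=> r0; rewrite mulr_gt0 ?exprn_gt0// unit_ball_volume_gt0. Qed.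

Lemma mean_continuous_le2 f g (k : V -> R) : measurable_fun setT f -> measurable_fun setT g ->
  measurable_fun setT k -> mean_continuous f -> mean_continuous g ->
  (forall p, osc k p <= osc f p + osc g p) -> mean_continuous k.
Proof.
move=> mf mg mk cf cg kfg e e0; have e2 : 0 < e / 2 by rewrite divr_gt0.
have [a a0 fa] := cf _ e2; have [b b0 gb] := cg _ e2.
exists (Num.min a b) => [|r r0]; first by rewrite lt_min a0.
rewrite le_min => /andP[ra rb].
apply: (@le_trans _ _ (near_integral r (fun p => osc f p + osc g p))).
  by apply: near_integral_le => //; [exact: measurable_osc|
    apply: measurable_funD; exact: measurable_osc|exact: osc_ge0].
rewrite near_integralD; [|exact: measurable_osc|exact: measurable_osc|
  exact: osc_ge0|exact: osc_ge0].
rewrite [e]splitr mulrDl EFinD; apply: leeD; first exact: fa.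
exact: gb.
Qed.

Lemma mean_continuousD f g : measurable_fun setT f -> measurable_fun setT g ->
  mean_continuous f -> mean_continuous g -> mean_continuous (fun x => f x + g x).
Proof.
move=> mf mg cf cg; apply: (mean_continuous_le2 f g) => //.
  exact: measurable_funD.
move=> p; rewrite /osc (_ : _ - _ = f p.1 - f p.2 + (g p.1 - g p.2)); last by ring.
exact: ler_normD.
Qed.

Lemma mean_continuous_cst (c : R) : mean_continuous (fun=> c).
Proof.
move=> e e0; exists 1 => // r r0 _; rewrite /near_integral.
under eq_integral do rewrite /osc subrr normr0 mul0r.
by rewrite integral0 lee_fin ltW// mulr_gt0// vr_gt0.
Qed.

Lemma mean_continuousZ (c : R) f : measurable_fun setT f -> mean_continuous f ->
  mean_continuous (fun x => c * f x).
Proof.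
move=> mf cf; have [->|c0] := eqVneq c 0.
  by under eq_fun do rewrite mul0r; exact: mean_continuous_cst.
move=> e e0; have ec : 0 < e / `|c| by rewrite divr_gt0// normr_gt0.
have [a a0 fa] := cf _ ec; exists a => // r r0 ra.
rewrite (_ : osc _ = (fun p => `|c| * osc f p)); last first.
  by apply/funext => p; rewrite /osc -mulrBr normrM.
rewrite near_integralZ//; [|exact: measurable_osc|exact: osc_ge0].
have -> : e * (v * r ^+ d) = `|c| * (e / `|c| * (v * r ^+ d)).
  by field; rewrite normr_eq0.
by rewrite EFinM lee_wpmul2l ?lee_fin//; exact: fa.
Qed.

(** Both |f x| and |f y| integrate to the volume of the ball times the L1 norm
    of f, by symmetry of the pairs of close points. *)
Lemma near_integral_osc_le r f : 0 < r -> measurable_fun setT f ->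
  (near_integral r (osc f) <= (2 * (v * r ^+ d))%:E * \int[lam]_x `|f x|%:E)%E.
Proof.
move=> r0 mf.
have mf1 : measurable_fun setT (fun x => `|f x|) by exact: measurableT_comp.
apply: (@le_trans _ _ (near_integral r (fun p => `|f p.1| + `|f p.2|))).
  apply: near_integral_le.
  - exact: measurable_osc.
  - by apply: measurable_funD; apply: (measurableT_comp mf1).
  - exact: osc_ge0.
  - by move=> p; exact: ler_normB.
rewrite near_integralD//; [|exact: (measurableT_comp mf1)|
  exact: (measurableT_comp mf1)].
rewrite -(near_integral_swap r (fun p => `|f p.2|))//=; last first.
  exact: (measurableT_comp mf1).
rewrite (near_integral_fst r (fun x => `|f x|))//.
by rewrite mulr_natl mulr2n EFinD ge0_muleDl// lee_fin ltW// vr_gt0.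
Qed.

(** The oscillation is subadditive, and that of f - g is controlled by the L1
    norm of f - g at every scale simultaneously. *)
Lemma mean_continuous_approx f : measurable_fun setT f ->
  (forall e, 0 < e -> exists g, [/\ measurable_fun setT g, mean_continuous g &
     (\int[lam]_x `|f x - g x|%:E <= e%:E)%E]) ->
  mean_continuous f.
Proof.
move=> mf H e e0; have e4 : 0 < e / 4 by rewrite divr_gt0.
have e2 : 0 < e / 2 by rewrite divr_gt0.
have [g [mg cg fg]] := H _ e4; have [a a0 ga] := cg _ e2.
exists a => // r r0 ra.
have mfg : measurable_fun setT (fun x => f x - g x) by exact: measurable_funB.
apply: (@le_trans _ _ (near_integral r (fun p => osc (fun x => f x - g x) p + osc g p))).
  apply: near_integral_le.
  - exact: measurable_osc.
  - by apply: measurable_funD; exact: measurable_osc.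
  - exact: osc_ge0.
  - move=> p; rewrite /osc.
    rewrite (_ : f p.1 - f p.2 = f p.1 - g p.1 - (f p.2 - g p.2) + (g p.1 - g p.2)).
      exact: ler_normD.
    by ring.
rewrite near_integralD; [|exact: measurable_osc|exact: measurable_osc|
  exact: osc_ge0|exact: osc_ge0].
have -> : e * (v * r ^+ d) = (2 * (v * r ^+ d)) * (e / 4) + e / 2 * (v * r ^+ d).
  by field.
rewrite EFinD; apply: leeD; last exact: ga.
apply: (le_trans (near_integral_osc_le _ _ r0 mfg)).
by rewrite [leRHS]EFinM lee_wpmul2l// lee_fin mulr_ge0// ltW// vr_gt0.
Qed.

End smoothing.

Section mean_continuity_of_sets.
Context {R : realType} {d : nat}.
Local Notation V := (vec R d).
Local Notation lam := (lebesgue_vec R d).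
Local Notation v := (unit_ball_volume R d).
Implicit Types (r : R) (A : set V).

(** Openness for the Euclidean distance, kept independent of any topology on
    the type of vectors. *)
Definition vopen A := forall x, A x -> exists2 r, 0 < r & cball x r `<=` A.

Let exits A r : set (V * V) := near_pairs r `&` (setT `*` ~` A).

Let measurable_exits A r : measurable A -> measurable (exits A r).
Proof.
move=> mA; apply: measurableI; first exact: measurable_le_dist.
by apply: measurableX => //; exact: measurableC.
Qed.

Let xsection_exits A r x : xsection (exits A r) x = cball x r `\` A.
Proof.
by apply/seteqP; split=> y; rewrite /xsection /exits /near_pairs/= inE/= => -[]//=; tauto.
Qed.

Let osc_indic A (p : V * V) : osc \1_A p <=
  \1_A p.1 * \1_(~` A) p.2 + \1_A p.2 * \1_(~` A) p.1 :> R.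
Proof.
rewrite /osc !indicE !in_setC.
by case: (p.1 \in A); case: (p.2 \in A); rewrite /= ?subrr ?normr0 ?subr0 ?sub0r ?normrN ?normr1 ?mulr0 ?mul1r ?mul0r ?addr0 ?add0r.
Qed.

Lemma cball_subset (x : V) r s : r <= s -> cball x r `<=` cball x s.
Proof. by move=> rs y; rewrite /cball/= => /le_trans; exact. Qed.

(** Only the points x of A whose r-ball leaves A with positive volume
    contribute; these sets decrease to the empty set as r tends to 0 because
    every point of A is interior, and A has finite volume. *)
Lemma mean_continuous_open A : measurable A -> vopen A -> (lam A < +oo)%E ->
  mean_continuous (\1_A : V -> R).
Proof.
move=> mA oA Aoo e e0.
have mindic (B : set V) : measurable B -> measurable_fun setT (\1_B : V -> R).
  by move=> mB; exact: measurable_indic.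
pose h (p : V * V) : R := \1_A p.1 * \1_(~` A) p.2.
have mh : measurable_fun setT h.
  apply: measurable_funM.
    exact: (measurableT_comp (mindic _ mA) measurable_fst).
  exact: (measurableT_comp (mindic _ (measurableC mA)) measurable_snd).
have h0 p : 0 <= h p by rewrite mulr_ge0.
pose C (n : nat) := A `&` [set x | lam (cball x n.+1%:R^-1 `\` A) != 0%E].
have mC n : measurable (C n).
  apply: measurableI => //.
  have m := measurable_fun_xsection lam (measurable_exits A n.+1%:R^-1 mA).
  have := emeasurable_neq measurableT m 0%E; rewrite setTI.
  congr (measurable _); apply/funext => x /=.
  by rewrite xsection_exits.
have ndC : nonincreasing_seq C.
  move=> m n mn; apply/subsetPset => x [Ax Cx]; split => //=.
  apply: contra_neq Cx => /= Cx; apply/eqP; rewrite eq_le measure_ge0 andbT -Cx.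
  apply: le_measure; rewrite ?inE; first by apply: measurableD => //; exact: measurable_cball.
    by apply: measurableD => //; exact: measurable_cball.
  apply: setSD; apply: cball_subset.
  by rewrite lef_pV2 ?posrE// ler_nat.
have C0 : \bigcap_n C n = set0.
  apply/seteqP; split => // x Cx.
  have [r r0 rA] := oA _ (Cx 0%N I).1.
  have [n _ /(_ n (leqnn n)) nr] : \forall n \near \oo, n.+1%:R^-1 < r.
    exact: near_infty_natSinv_lt (PosNum r0).
  have [_ /eqP[]] := Cx n I.
  rewrite (_ : _ `\` _ = set0) ?measure0//.
  by apply/seteqP; split => // y [] /(cball_subset x _ _ (ltW nr)) /rA.
have lC : lam (C n) @[n --> \oo] --> 0%E.
  rewrite -[X in _ --> X](@measure0 _ _ _ lam) -C0.
  apply: nonincreasing_cvg_mu => //; last by rewrite C0.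
  by apply: le_lt_trans Aoo; apply: le_measure; rewrite ?inE//; exact: subIsetl.
have e2 : 0 < e / 2 by rewrite divr_gt0.
have e2E : (0 < (e / 2)%:E)%E by rewrite lte_fin.
have [n /(_ n (leqnn n)) nC] := cvge_eventually_lt _ _ _ lC e2E.
exists n.+1%:R^-1 => // r r0 rn.
have E : (near_integral r h <= (e / 2 * (v * r ^+ d))%:E)%E.
  rewrite /near_integral fubini_tonelli1; last 2 first.
  - exact: measurable_near_integrand.
  - by move=> p; rewrite lee_fin mulr_ge0.
  apply: (@le_trans _ _ (\int[lam]_x ((v * r ^+ d)%:E * (\1_(C n) x)%:E))%E); last first.
    rewrite ge0_integralZl//; last 2 first.
    - by apply/measurable_EFinP; apply: mindic; exact: mC.
    - by rewrite lee_fin ltW// vr_gt0.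
    rewrite integral_indic// setIT [e / 2 * _]mulrC [leRHS]EFinM lee_wpmul2l//; last exact: ltW.
    by rewrite lee_fin ltW// vr_gt0.
  apply: ge0_le_integral => //.
  - move=> x _; apply: integral_ge0 => y _; by rewrite lee_fin mulr_ge0.
  - apply: measurable_fun_fubini_tonelli_F.
      exact: measurable_near_integrand.
    by move=> p; rewrite lee_fin mulr_ge0.
  - apply: emeasurable_funM; first exact: measurable_cst.
    by apply/measurable_EFinP; apply: mindic; exact: mC.
  move=> x _; rewrite /fubini_F.
  have -> : (\int[lam]_y (h (x, y) * \1_(near_pairs r) (x, y))%:E =
      (\1_A x)%:E * lam (cball x r `\` A))%E.
    transitivity (\int[lam]_y ((\1_A x)%:E * (\1_(cball x r `\` A) y)%:E))%E.
      apply: eq_integral => y _; rewrite -EFinM /h/= -mulrA; congr (_ * _)%:E.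
      rewrite -xsection_exits !indicE mem_xsection /exits in_setI in_setC.
      rewrite (_ : ((x, y) \in setT `*` _) = (y \notin A)).
        by case: (_ \in near_pairs _); case: (y \notin A); rewrite /= ?mulr1 ?mulr0 ?mul0r.
      by rewrite in_setX in_setT/= in_setC.
    rewrite ge0_integralZl//; last first.
      by apply/measurable_EFinP; apply: mindic; apply: measurableD => //; exact: measurable_cball.
    rewrite integral_indic// ?setIT//.
    by apply: measurableD => //; exact: measurable_cball.
  rewrite !indicE; case: (boolP (x \in A)) => [xA|_]; last first.
    by rewrite mul0e mule_ge0// lee_fin// ltW// vr_gt0.
  rewrite mul1e.
  have [xC|xC] := boolP (x \in C n).
    rewrite mule1 -(lebesgue_cball x)// le_measure ?inE//.
    - by apply: measurableD => //; exact: measurable_cball.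
    - exact: measurable_cball.
  rewrite mule0.
  have /eqP <- : lam (cball x n.+1%:R^-1 `\` A) == 0%E.
    apply: contraNT xC => xC; rewrite inE; split => //.
    by rewrite inE in xA.
  apply: le_measure; rewrite ?inE.
  - by apply: measurableD => //; exact: measurable_cball.
  - by apply: measurableD => //; exact: measurable_cball.
  - by apply: setSD; exact: cball_subset.
apply: (@le_trans _ _ (near_integral r (fun p => h p + h (p.2, p.1)))).
  apply: near_integral_le.
  - by apply: measurable_osc; exact: mindic.
  - by apply: measurable_funD => //; exact: measurable_fun_swap.
  - exact: osc_ge0.
  - by move=> p; exact: osc_indic.
rewrite near_integralD//; last exact: measurable_fun_swap.
rewrite near_integral_swap//.
have -> : e * (v * r ^+ d) = e / 2 * (v * r ^+ d) + e / 2 * (v * r ^+ d) by field.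
by rewrite EFinD leeD.
Qed.

End mean_continuity_of_sets.

Section mean_continuity.
Context {R : realType} {d : nat}.
Local Notation V := (vec R d).
Local Notation lam := (lebesgue_vec R d).
Implicit Types (f : V -> R) (A B : set V).

Definition centered_ball (N : nat) : set V := [set x | enorm x < N%:R].

Lemma measurable_centered_ball N : measurable (centered_ball N).
Proof.
have := @measurable_enorm R d measurableT _ (@measurable_itv R `]-oo, N%:R[).
by rewrite setTI.
Qed.

Lemma vopen_centered_ball N : vopen (centered_ball N).
Proof.
move=> x; rewrite /centered_ball/= => xN; exists ((N%:R - enorm x) / 2).
  by rewrite divr_gt0// subr_gt0.
move=> y; rewrite /cball/= vdistC => yx.
have := enorm_le_dist y x; lra.
Qed.

Lemma centered_ball_lty N : (lam (centered_ball N) < +oo)%E.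
Proof.
apply: (@le_lt_trans _ _ (lam (cball vzero N.+1%:R))).
  apply: le_measure; rewrite ?inE.
  - exact: measurable_centered_ball.
  - exact: measurable_cball.
  - move=> x; rewrite /centered_ball /cball/= vdistC -enorm_vdist => xN.
    by rewrite (le_trans (ltW xN))// ler_nat.
by rewrite lebesgue_cball// ltry.
Qed.

Lemma bigcup_centered_ball : \bigcup_N centered_ball N = setT.
Proof.
apply/seteqP; split => // x _; exists (Num.truncn (enorm x)).+1 => //.
by rewrite /centered_ball/= truncnS_gt.
Qed.

Lemma centered_ball_nondecreasing : nondecreasing_seq centered_ball.
Proof.
move=> m n mn; apply/subsetPset => x; rewrite /centered_ball/= => /lt_le_trans.
by apply; rewrite ler_nat.
Qed.

(* The sets whose bounded parts have a mean continuous indicator form a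
   sigma-algebra that contains the open sets, hence all measurable sets.
   Cutting by balls keeps the volumes finite, as Lebesgue measure is not. *)
Let D : set (set V) := [set A | measurable A /\
  forall N, mean_continuous (\1_(A `&` centered_ball N) : V -> R)].

Let mindic (B : set V) : measurable B -> measurable_fun setT (\1_B : V -> R).
Proof. by move=> mB; exact: measurable_indic. Qed.

Let mball (B : set V) N : measurable B -> measurable (B `&` centered_ball N).
Proof. by move=> mB; apply: measurableI => //; exact: measurable_centered_ball. Qed.

Let DU A B : D A -> D B -> D (A `|` B).
Proof.
move=> [mA cA] [mB cB]; split => [|N]; first exact: measurableU.
apply: (@mean_continuous_le2 _ _ _ _ _ _ _ _ (cA N) (cB N)).
- by apply: mindic; exact: mball.
- by apply: mindic; exact: mball.
- by apply: mindic; apply: mball; exact: measurableU.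
move=> p; rewrite /osc !indicE !in_setI !in_setU.
by case: (p.1 \in A); case: (p.2 \in A); case: (p.1 \in B); case: (p.2 \in B);
  case: (p.1 \in _); case: (p.2 \in _);
  rewrite /= ?subrr ?normr0 ?subr0 ?sub0r ?normrN ?normr1 ?addr0 ?add0r// lerDl.
Qed.

Let Dopen A : measurable A -> vopen A -> D A.
Proof.
move=> mA oA; split => // N; apply: mean_continuous_open.
- exact: mball.
- move=> x [/oA[r r0 rA] /vopen_centered_ball [s s0 sN]].
  exists (Num.min r s); first by rewrite lt_min r0.
  by move=> y; rewrite /cball/= le_min => /andP[yr ys]; split; [exact: rA|exact: sN].
- apply: (le_lt_trans _ (centered_ball_lty N)); apply: le_measure; rewrite ?inE.
  + exact: mball.
  + exact: measurable_centered_ball.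
  + exact: subIsetr.
Qed.

Let D0 : D set0.
Proof. by apply: Dopen => // x. Qed.

Let DC A : D A -> D (setT `\` A).
Proof.
move=> [mA cA]; split => [|N]; first exact: measurableD.
rewrite (_ : \1__ = (fun x => \1_(centered_ball N) x +
    (-1) * \1_(A `&` centered_ball N) x) :> (V -> R)); last first.
  apply/funext => x; rewrite setDE !indicE !in_setI in_setC in_setT/=.
  by case: (x \in A); case: (x \in _); rewrite /= ?mulr1 ?mulr0 ?subrr ?addr0.
apply: mean_continuousD.
- by apply: mindic; exact: measurable_centered_ball.
- by apply: measurable_funM => //; apply: mindic; exact: mball.
- apply: mean_continuous_open; [exact: measurable_centered_ball|
    exact: vopen_centered_ball|exact: centered_ball_lty].
- by apply: mean_continuousZ; [apply: mindic; exact: mball|exact: cA].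
Qed.

Let Dbigcup (F : nat -> set V) : (forall i, D (F i)) -> D (\bigcup_i F i).
Proof.
move=> DF; have mF i : measurable (F i) by have [] := DF i.
split => [|N]; first exact: bigcup_measurable.
have mU : measurable (\bigcup_i F i) by exact: bigcup_measurable.
pose G n := \big[setU/set0]_(i < n) F i.
have DG n : D (G n).
  by rewrite /G; elim/big_ind : _ => // *; exact: DU.
have mG n : measurable (G n) by have [] := DG n.
apply: mean_continuous_approx => [|e e0]; first by apply: mindic; exact: mball.
pose C n := (\bigcup_i F i `\` G n) `&` centered_ball N.
have mC n : measurable (C n) by apply: mball; exact: measurableD.
have lC : lam (C n) @[n --> \oo] --> 0%E.
  have C0 : \bigcap_n C n = set0.
    apply/seteqP; split => // x Cx; have [[[i _ Fi] _] _] := Cx 0%N I.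
    have [[_ +] _] := Cx i.+1 I; apply.
    by rewrite /G; apply: (@bigsetU_sup _ i i.+1 F (ltnSn _)).
  rewrite -[X in _ --> X](@measure0 _ _ _ lam) -C0.
  apply: nonincreasing_cvg_mu => //; last 2 first.
  - by rewrite C0.
  - move=> m n mn; apply/subsetPset; apply: setSI; apply: setDS.
    by apply: subset_bigsetU.
  apply: (le_lt_trans _ (centered_ball_lty N)); apply: le_measure; rewrite ?inE//.
  - exact: measurable_centered_ball.
  - exact: subIsetr.
have e0E : (0 < e%:E)%E by rewrite lte_fin.
have [n /(_ n (leqnn n)) nC] := cvge_eventually_lt _ _ _ lC e0E.
exists (\1_(G n `&` centered_ball N)); split.
- by apply: mindic; exact: mball.
- by have [] := DG n.
have GF : G n `<=` \bigcup_i F i.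
  by rewrite /G => x; rewrite -bigcup_mkord => -[i _ Fi]; exists i.
apply: le_trans (ltW nC); rewrite le_eqVlt; apply/orP; left; apply/eqP.
rewrite -[in RHS](setIT (C n)) -integral_indic//.
apply: eq_integral => x _; rewrite !indicE /C setDE !in_setI in_setC; congr EFin.
have [xG|xG] := boolP (x \in G n); last first.
  by case: (x \in _); case: (x \in _); rewrite ?subr0 ?normr1 ?normr0.
have -> : x \in \bigcup_i F i by rewrite inE; apply: GF; rewrite inE in xG.
by case: (x \in _); rewrite /= subrr normr0.
Qed.

(* half-spaces are open and generate the product sigma-algebra *)
Let measurable_sub_D A : measurable A -> D A.
Proof.
pose O : set (set V) := [set A | measurable A /\ vopen A].
have OD : <<s O >> `<=` D.
  apply: smallest_sub => [|B [mB oB]]; last exact: Dopen.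
  split; [exact: D0|exact: DC|exact: Dbigcup].
suff H : measurable_fun setT (idfun : g_sigma_algebraType O -> V).
  by move=> mA; apply: OD; rewrite -[A]setTI; exact: H.
apply/measurable_fun_tnthP => i.
apply: (measurability _ (RGenOInfty.measurableE R)) => _ [_ [a ->] <-].
rewrite setTI; apply: sub_sigma_algebra; split => /=.
  by rewrite -[X in measurable X]setTI; apply: measurable_coord.
move=> x; rewrite /= in_itv/= andbT => ax.
exists (((tnth x i : R) - a) / 2); first by rewrite divr_gt0// subr_gt0.
move=> y; rewrite /cball/= in_itv/= andbT vdistE => xy.
have : `|(tnth x i : R) - tnth y i| <= ((tnth x i : R) - a) / 2.
  apply: le_trans xy; rewrite -sqrtr_sqr ler_wsqrtr// (bigD1 i)//= lerDl.
  by rewrite sumr_ge0// => j _; exact: sqr_ge0.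
by rewrite ler_norml => /andP[_]; lra.
Qed.

Let mean_continuous_sum (I : eqType) (s : seq I) (F : I -> V -> R) :
  (forall i, measurable_fun setT (F i)) -> (forall i, mean_continuous (F i)) ->
  mean_continuous (fun x => \sum_(i <- s) F i x).
Proof.
move=> mF cF; elim: s => [|i s IH].
  by under eq_fun do rewrite big_nil; exact: mean_continuous_cst.
under eq_fun do rewrite big_cons; apply: mean_continuousD => //.
exact: measurable_sum.
Qed.

Import HBSimple.

Let mean_continuous_simple (g : {sfun V >-> R}) N :
  mean_continuous (fun x => g x * \1_(centered_ball N) x).
Proof.
rewrite (_ : (fun x => _) = (fun x => \sum_(y <- finmap.enum_fset (fset_set (range g)))
   y * \1_(g @^-1` [set y] `&` centered_ball N) x)); last first.
  apply/funext => x; rewrite {1}fimfunE fsbig_finite//= mulr_suml.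
  apply: eq_bigr => y _; rewrite -mulrA; congr (_ * _).
  by rewrite !indicE in_setI -mulnb natrM.
apply: mean_continuous_sum => y.
  by apply: measurable_funM => //; apply: mindic; exact: mball.
apply: mean_continuousZ; first by apply: mindic; exact: mball.
by have [] := measurable_sub_D (g @^-1` [set y]).
Qed.

(** Approximation in L1: cut f to a large ball, then replace it by a simple
    function. *)
Lemma mean_continuous_integrable f : measurable_fun setT f ->
  (forall x, 0 <= f x) -> lam.-integrable setT (EFin \o f) -> mean_continuous f.
Proof.
move=> mf f0 fi; apply: mean_continuous_approx => // e e0.
have e2 : 0 < e / 2 by rewrite divr_gt0.
have mfE : measurable_fun setT (EFin \o f) by exact/measurable_EFinP.
have foo : (\int[lam]_x (f x)%:E < +oo)%E.
  have /integrableP[_] := fi; apply: le_lt_trans.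
  by rewrite le_eqVlt; apply/orP; left; apply/eqP; apply: eq_integral => x _;
    rewrite /= ger0_norm.
have [N HN] : exists N, (\int[lam]_(x in ~` centered_ball N) (f x)%:E <= (e / 2)%:E)%E.
  have cvgI : (\int[lam]_(x in centered_ball N) (f x)%:E)%E @[N --> \oo] -->
      (\int[lam]_x (f x)%:E)%E.
    rewrite -bigcup_centered_ball; apply: ge0_nondecreasing_set_cvg_integral.
    - exact: centered_ball_nondecreasing.
    - exact: measurable_centered_ball.
    - by move=> i; exact: measurable_funTS.
    - by move=> i x _; rewrite lee_fin.
  set I := (\int[lam]_x (f x)%:E)%E in foo cvgI.
  have If : I \is a fin_num.
    by rewrite ge0_fin_numE//; apply: integral_ge0 => x _; rewrite lee_fin.
  have IE : (I - (e / 2)%:E < I)%E by rewrite lteBlDr// lteDl// lte_fin.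
  have [N /(_ N (leqnn N)) NI] := cvge_eventually_gt _ _ _ cvgI IE.
  exists N; have mB := measurable_centered_ball N.
  have : (I = \int[lam]_(x in centered_ball N) (f x)%:E +
      \int[lam]_(x in ~` centered_ball N) (f x)%:E)%E.
    rewrite -ge0_integral_setU ?setUv//; last 3 first.
    - exact: measurableC.
    - by move=> x _; rewrite lee_fin.
    - by rewrite disj_set2E setICr.
  move=> I2; move: NI; rewrite lteBlDr// {1}I2 lteD2lE => [/ltW//|].
  rewrite ge0_fin_numE; last by apply: integral_ge0 => x _; rewrite lee_fin.
  apply: le_lt_trans foo; apply: ge0_subset_integral => //.
  by move=> x _; rewrite lee_fin.
have [g_ [gi _ gf]] := approximation_sfun_integrable measurableT fi.
have e2E : (0 < (e / 2)%:E)%E by rewrite lte_fin.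
have [n /(_ n (leqnn n)) ng] := cvge_eventually_lt _ _ _ gf e2E.
exists (fun x => g_ n x * \1_(centered_ball N) x); split.
- by apply: measurable_funM => //; apply: mindic; exact: measurable_centered_ball.
- exact: mean_continuous_simple.
have mB := measurable_centered_ball N.
rewrite [e]splitr EFinD; apply: le_trans (leeD HN (ltW ng)).
rewrite [X in (_ <= X + _)%E]integral_mkcond -ge0_integralD//; last 3 first.
- by move=> x _; rewrite patchE; case: ifP => // _; rewrite lee_fin.
- apply/(measurable_restrictT _ _).1 => //; first exact: measurableC.
  exact: measurable_funTS.
- by apply/measurable_EFinP/measurableT_comp => //; exact: measurable_funB.
apply: ge0_le_integral => //.
- apply/measurable_EFinP/measurableT_comp => //; apply: measurable_funB => //.
  by apply: measurable_funM => //; exact: mindic.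
- apply: emeasurable_funD.
    apply/(measurable_restrictT _ _).1 => //; first exact: measurableC.
    exact: measurable_funTS.
  by apply/measurable_EFinP/measurableT_comp => //; exact: measurable_funB.
move=> x _; rewrite patchE in_setC indicE; case: (x \in centered_ball N) => /=.
  by rewrite mulr1 add0e.
by rewrite mulr0 subr0 -EFinD lee_fin ger0_norm// lerDl.
Qed.

End mean_continuity.

(** * Probabilities of balls *)

Section ball_mass.
Context {R : realType} {d : nat}.
Local Notation V := (vec R d).
Local Notation lam := (lebesgue_vec R d).
Local Notation v := (unit_ball_volume R d).
Variable mu : probability V R.
Implicit Types (r s e : R) (x z : V) (A : set V).

Definition ball_mass r x : R := fine (mu (cball x r)).

Lemma ball_massE r x : mu (cball x r) = (ball_mass r x)%:E.
Proof. by rewrite /ball_mass fineK// fin_num_measure//; exact: measurable_cball. Qed.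

Lemma ball_mass_ge0 r x : 0 <= ball_mass r x.
Proof. by rewrite fine_ge0. Qed.

Lemma ball_mass_le1 r x : ball_mass r x <= 1.
Proof.
rewrite -lee_fin -ball_massE probability_le1//; exact: measurable_cball.
Qed.

Lemma ball_mass_le r s x : r <= s -> ball_mass r x <= ball_mass s x.
Proof.
move=> rs; rewrite -lee_fin -!ball_massE le_measure ?inE//.
- exact: measurable_cball.
- exact: measurable_cball.
- exact: cball_subset.
Qed.

Lemma measurable_ball_mass r : measurable_fun setT (ball_mass r).
Proof.
apply/measurable_EFinP.
rewrite (_ : EFin \o _ = mu \o xsection (near_pairs r)).
  by apply: measurable_fun_xsection; exact: measurable_le_dist.
by apply/funext => x /=; rewrite -ball_massE xsection_le_dist.
Qed.

Lemma measurable_sparse r rho e :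
  measurable [set x : V | enorm x <= rho /\ ball_mass r x < e].
Proof.
apply: measurableI.
  have := @measurable_enorm R d measurableT _ (@measurable_itv R `]-oo, rho]).
  by rewrite setTI.
have := measurable_ball_mass r measurableT _ (@measurable_itv R `]-oo, e[).
by rewrite setTI.
Qed.

(** Each point x of A belongs to the balls whose centre is within r of x, and
    these centres fill the volume of one ball (Fubini). *)
Lemma integral_ball_mass_setI r A : 0 < r -> measurable A ->
  (\int[lam]_z mu (A `&` cball z r) = mu A * (v * r ^+ d)%:E)%E.
Proof.
move=> r0 mA.
pose g (p : V * V) : \bar R := (\1_A p.2 * \1_(near_pairs r) p)%:E.
have mg : measurable_fun setT g.
  apply/measurable_EFinP/measurable_funM.
    exact: (measurableT_comp (measurable_indic mA) measurable_snd).
  by apply: measurable_indic; exact: measurable_le_dist.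
have g0 p : (0 <= g p)%E by rewrite lee_fin mulr_ge0.
transitivity (\int[lam]_z \int[mu]_x g (z, x))%E.
  apply: eq_integral => z _.
  transitivity (\int[mu]_x (\1_(A `&` cball z r) x)%:E)%E.
    by rewrite integral_indic ?setIT//; apply: measurableI => //; exact: measurable_cball.
  apply: eq_integral => x _; rewrite /g/= !indicE in_setI -mulnb natrM.
  by rewrite -xsection_le_dist mem_xsection.
rewrite (fubini_tonelli _ mg g0).
transitivity (\int[mu]_x ((v * r ^+ d)%:E * (\1_A x)%:E))%E; last first.
  rewrite ge0_integralZl//.
  - by rewrite integral_indic// setIT muleC.
  - by apply/measurable_EFinP/measurable_indic.
  - by rewrite lee_fin ltW// vr_gt0.
apply: eq_integral => x _.
transitivity ((\1_A x)%:E * \int[lam]_z (\1_(cball x r) z)%:E)%E; last first.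
  rewrite integral_indic//; last exact: measurable_cball.
  by rewrite setIT muleC; congr (_ * _)%E; exact: lebesgue_cball.
rewrite -ge0_integralZl//; last first.
  by apply/measurable_EFinP/measurable_indic; exact: measurable_cball.
apply: eq_integral => z _; rewrite -EFinM /g/= !indicE.
rewrite (_ : ((z, x) \in near_pairs r) = (z \in cball x r))//.
by apply/idP/idP; rewrite !inE /near_pairs /cball/= vdistC.
Qed.

Lemma integral_ball_mass r : 0 < r ->
  (\int[lam]_z (ball_mass r z)%:E = (v * r ^+ d)%:E)%E.
Proof.
move=> r0; rewrite -[RHS]mul1e -(@probability_setT _ _ _ mu).
rewrite -(integral_ball_mass_setI r setT r0)//.
by apply: eq_integral => z _; rewrite setTI ball_massE.
Qed.

(** Let S be the set on the left.  A ball of radius r/2 that meets S is included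
    in the ball of radius r around a point of S, so it has mass less than e.
    Averaging this over all centres, which range over a ball of radius
    rho + r, bounds mu S. *)
Lemma sparse_mass r rho e : 0 < r -> 0 <= rho -> 0 <= e ->
  (mu [set x : V | (enorm x <= rho)%R /\ (ball_mass r x < e)%R] <=
    (e * (2 * (rho + r) / r) ^+ d)%:E)%E.
Proof.
move=> r0 rho0 e0; set S := [set x | _].
have rho_r : 0 < rho + r by rewrite ltr_wpDl.
have mS : measurable S by exact: measurable_sparse.
have r2 : 0 < r / 2 by rewrite divr_gt0.
have := integral_ball_mass_setI (r / 2) S r2 mS.
have : (\int[lam]_z mu (S `&` cball z (r / 2)) <=
    \int[lam]_z (e%:E * (\1_(cball vzero (rho + r)) z)%:E))%E.
  apply: ge0_le_integral => //.
  - rewrite (_ : (fun z => _) = mu \o xsection (near_pairs (r / 2) `&` (setT `*` S))).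
      apply: measurable_fun_xsection; apply: measurableI; first exact: measurable_le_dist.
      exact: measurableX.
    apply/funext => z/=; congr (mu _); apply/seteqP; split => x.
      by move=> [? ?]; rewrite /xsection/= inE.
    by rewrite /xsection/= inE => -[? [_ ?]].
  - apply: emeasurable_funM; first exact: measurable_cst.
    by apply/measurable_EFinP/measurable_indic; exact: measurable_cball.
  move=> z _.
  have [->|/set0P[x [[xrho xe] zx]]] := eqVneq (S `&` cball z (r / 2)) set0.
    by rewrite measure0 mule_ge0// lee_fin.
  rewrite indicE mem_set; last first.
    rewrite /cball/= vdistC -enorm_vdist (le_trans (enorm_le_dist z x))//.
    by rewrite addrC lerD// (le_trans zx)// ler_pdivrMr// ler_pMr// ler1n.
  rewrite mule1 (@le_trans _ _ (mu (cball x r)))//; last first.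
    by rewrite ball_massE lee_fin ltW.
  apply: le_measure; rewrite ?inE.
  - by apply: measurableI => //; exact: measurable_cball.
  - exact: measurable_cball.
  - move=> y [_]; rewrite /cball/= => zy.
    rewrite (le_trans (vdist_triangle z x y))// [r]splitr lerD//.
    by rewrite vdistC.
move=> + E; rewrite E ge0_integralZl//; last first.
  by apply/measurable_EFinP/measurable_indic; exact: measurable_cball.
rewrite integral_indic//; last exact: measurable_cball.
rewrite setIT [X in (_ <= _ * X)%E -> _](_ : _ = (v * (rho + r) ^+ d)%:E); last first.
  exact: lebesgue_cball.
have -> : mu S = (fine (mu S))%:E by rewrite fineK// fin_num_measure.
rewrite -!EFinM !lee_fin => H.
have v0 := @unit_ball_volume_gt0 R d.
rewrite -(ler_pM2r (vr_gt0 (d := d) _ r2)) (le_trans H)//.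
rewrite le_eqVlt; apply/orP; left; apply/eqP.
have -> : (2 * (rho + r) / r) ^+ d = (rho + r) ^+ d / (r / 2) ^+ d.
  by rewrite -expr_div_n; congr (_ ^+ _); field; rewrite gt_eqF.
by field; rewrite expf_neq0// gt_eqF.
Qed.

End ball_mass.

(** * Void probabilities and their limit *)

Section real_bounds.
Context {R : realType}.
Implicit Types b c u w : R.

Lemma bernoulli_le1 b m : 0 <= b -> b <= 1 -> 1 <= (1 - b) ^+ m + m%:R * b.
Proof.
move=> b0 b1; elim: m => [|m IH]; first by rewrite expr0 mul0r addr0.
rewrite exprS -natr1.
have q0 : 0 <= (1 - b) ^+ m by rewrite exprn_ge0// subr_ge0.
have q1 : (1 - b) ^+ m <= 1 by rewrite exprn_ile1// ?subr_ge0// gerBl.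
have : b * (1 - b) ^+ m <= b by rewrite ler_piMr.
lra.
Qed.

Lemma one_sub_le_expRN b : 1 - b <= expR (- b).
Proof. by have := expR_ge1Dx (- b). Qed.

Lemma exprn_one_sub_le b m : 0 <= b -> b <= 1 -> (1 - b) ^+ m <= expR (- (m%:R * b)).
Proof.
move=> b0 b1; rewrite -mulrN expRM_natl.
by rewrite lerXn2r// ?nnegrE ?subr_ge0 ?expR_ge0//; exact: one_sub_le_expRN.
Qed.

(** A telescoping induction on m: one factor exp(-b) exceeds 1 - b by at most
    b (1 - exp(-b)), so that the error never accumulates beyond b. *)
Lemma expRN_sub_exprn_one_sub b m : 0 <= b -> b <= 1 ->
  expR (- (m%:R * b)) - (1 - b) ^+ m <= b.
Proof.
move=> b0 b1; rewrite -mulrN expRM_natl.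
set y := expR (- b).
have y1 : y <= 1 by rewrite /y -expR0 ler_expR oppr_le0.
have y0 : 0 <= y by exact: expR_ge0.
have yx : y - (1 - b) <= b * (1 - y).
  have : (1 + b) * y <= 1.
    have := expR_ge1Dx b => /(ler_wpM2r y0).
    by rewrite /y -expRD subrr expR0.
  lra.
have q0 n : 0 <= (1 - b) ^+ n by rewrite exprn_ge0// subr_ge0.
have q1 n : (1 - b) ^+ n <= 1 by rewrite exprn_ile1// ?subr_ge0// gerBl.
elim: m => [|m IH]; first by rewrite !expr0 subrr.
rewrite !exprS.
have -> : y * y ^+ m - (1 - b) * (1 - b) ^+ m =
  y * (y ^+ m - (1 - b) ^+ m) + (1 - b) ^+ m * (y - (1 - b)) by ring.
have h1 : y * (y ^+ m - (1 - b) ^+ m) <= y * b by exact: ler_wpM2l.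
have h2 : (1 - b) ^+ m * (y - (1 - b)) <= b * (1 - y).
  apply: (le_trans (ler_wpM2l (q0 m) yx)).
  by rewrite ler_piMl// mulr_ge0// subr_ge0.
lra.
Qed.

Lemma expRN_lipschitz u w : 0 <= u -> 0 <= w ->
  `|expR (- u) - expR (- w)| <= Num.min 1 `|u - w|.
Proof.
wlog uw : u w / u <= w => [H u0 w0|u0 w0].
  have [uw|/ltW wu] := leP u w; first exact: H.
  by rewrite distrC [X in Num.min _ X]distrC; exact: H.
have eu0 := expR_ge0 (- u); have ew0 := expR_ge0 (- w).
have eu1 : expR (- u) <= 1 by rewrite -expR0 ler_expR oppr_le0.
have ewu : expR (- w) <= expR (- u) by rewrite ler_expR lerN2.
rewrite ger0_norm ?subr_ge0// le_min; apply/andP; split; first lra.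
rewrite distrC ger0_norm ?subr_ge0//.
have -> : expR (- w) = expR (- u) * expR (- (w - u)).
  by rewrite -expRD; congr expR; ring.
have := one_sub_le_expRN (w - u) => /(ler_wpM2l eu0) => h.
have : expR (- u) * (w - u) <= w - u by rewrite ler_piMl// subr_ge0.
lra.
Qed.

(** Here c is the normalising sample size, which may differ by one from the
    exponent m: two sample points are later considered at once. *)
Lemma exprn_one_sub_approx b m c w : 0 <= b -> b <= 1 -> 0 <= c -> 0 <= w ->
  `|c - m%:R| <= 1 ->
  `|(1 - b) ^+ m - expR (- w)| <= 2 * b + Num.min 1 `|c * b - w|.
Proof.
move=> b0 b1 c0 w0 cm.
have -> : (1 - b) ^+ m - expR (- w) =
  - (expR (- (m%:R * b)) - (1 - b) ^+ m) +
  (expR (- (m%:R * b)) - expR (- (c * b))) + (expR (- (c * b)) - expR (- w)).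
  by ring.
apply: (le_trans (ler_normD _ _)); apply: lerD; last first.
  by apply: expRN_lipschitz => //; rewrite mulr_ge0.
rewrite (_ : 2 * b = b + b); last by ring.
apply: (le_trans (ler_normD _ _)); apply: lerD.
  rewrite normrN ger0_norm; first exact: expRN_sub_exprn_one_sub.
  by rewrite subr_ge0; exact: exprn_one_sub_le.
apply: (le_trans (expRN_lipschitz _ _ _ _)); rewrite ?mulr_ge0//.
rewrite ge_min; apply/orP; right.
by rewrite -mulrBl normrM (ger0_norm b0) distrC ler_piMl.
Qed.

End real_bounds.

Section void_probability.
Context {R : realType} {d : nat}.
Local Notation V := (vec R d).
Local Notation lam := (lebesgue_vec R d).
Local Notation v := (unit_ball_volume R d).
Variable mu : probability V R.
Variable f : V -> R.
Hypothesis mf : measurable_fun setT f.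
Hypothesis f0 : forall x, 0 <= f x.
Hypothesis dens : forall A, measurable A -> mu A = (\int[lam]_(x in A) (f x)%:E)%E.
Implicit Types (r e K c t : R) (x y : V) (A : set V).
Local Notation b := (ball_mass mu).

(** The probability that m independent points of law mu stay out of the ball of
    radius r around another one. *)
Definition void_prob (m : nat) r : \bar R := (\int[mu]_x ((1 - b r x) ^+ m)%:E)%E.

Lemma measurable_void m r : measurable_fun setT (fun x => (1 - b r x) ^+ m).
Proof.
by apply: measurable_funX; apply: measurable_funB => //; exact: measurable_ball_mass.
Qed.

Lemma void_ge0 m r x : 0 <= (1 - b r x) ^+ m.
Proof. by rewrite exprn_ge0// subr_ge0 ball_mass_le1. Qed.

Lemma void_le1 m r x : (1 - b r x) ^+ m <= 1.
Proof. by rewrite exprn_ile1// ?subr_ge0 ?ball_mass_le1// gerBl ball_mass_ge0. Qed.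

Lemma void_prob_ge0 m r : (0 <= void_prob m r)%E.
Proof. by apply: integral_ge0 => x _; rewrite lee_fin void_ge0. Qed.

Lemma void_prob_le1 m r : (void_prob m r <= 1)%E.
Proof.
rewrite -(integral_prob_cst mu 1); apply: ge0_le_integral => //.
- by move=> x _; rewrite lee_fin void_ge0.
- by apply/measurable_EFinP; exact: measurable_void.
- by move=> x _; rewrite lee_fin void_le1.
Qed.

Lemma void_prob_fin m r : void_prob m r \is a fin_num.
Proof.
by rewrite ge0_fin_numE ?void_prob_ge0// (le_lt_trans (void_prob_le1 _ _))// ltry.
Qed.

Definition upper_level K : set V := [set x | K < f x].

Lemma measurable_upper_level K : measurable (upper_level K).
Proof.
exact: measurable_gt_level.
Qed.

(** Turns a bound for Lebesgue measure into a bound for mu, whose density is at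
    most K off the upper level set; there, only the bound by 1 is used. *)
Lemma integral_min_level K (h : V -> R) (C : \bar R) : 0 <= K ->
  measurable_fun setT h -> (forall x, 0 <= h x) ->
  (\int[lam]_x (h x)%:E <= C)%E ->
  (\int[mu]_x (Num.min 1 (h x))%:E <= mu (upper_level K) + K%:E * C)%E.
Proof.
move=> K0 mh h0 hC.
have mL := measurable_upper_level K.
pose g x : R := \1_(upper_level K) x + \1_(~` upper_level K) x * h x.
have mg2 : measurable_fun setT (fun x => \1_(~` upper_level K) x * h x).
  by apply: measurable_funM => //; apply: measurable_indic; exact: measurableC.
apply: (@le_trans _ _ (\int[mu]_x (g x)%:E)%E).
  apply: ge0_le_integral => //.
  - by move=> x _; rewrite lee_fin le_min ler01 h0.
  - by apply/measurable_EFinP; apply: measurable_minr.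
  - by apply/measurable_EFinP/measurable_funD => //; exact: measurable_indic.
  move=> x _; rewrite lee_fin /g !indicE in_setC.
  by case: (x \in _); rewrite /= ?mul0r ?addr0 ?mul1r ?add0r ge_min lexx ?orbT.
under eq_integral do rewrite EFinD.
rewrite ge0_integralD//; last 3 first.
- by apply/measurable_EFinP/measurable_indic.
- by move=> x _; rewrite lee_fin mulr_ge0.
- exact/measurable_EFinP.
rewrite integral_indic// setIT; apply: leeD => //.
rewrite (integral_density _ _ _ mf f0 dens)//; last 2 first.
- exact/measurable_EFinP.
- by move=> x; rewrite lee_fin mulr_ge0.
apply: (@le_trans _ _ (\int[lam]_x (K%:E * (h x)%:E))%E).
  apply: ge0_le_integral => //.
  - by move=> x _; rewrite mule_ge0// lee_fin// mulr_ge0.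
  - by apply: emeasurable_funM; exact/measurable_EFinP.
  - by apply: emeasurable_funM; [exact: measurable_cst|exact/measurable_EFinP].
  move=> x _; rewrite -!EFinM lee_fin indicE in_setC.
  case: (boolP (x \in _)) => /= [_|]; first by rewrite !mul0r mulr_ge0.
  rewrite notin_setE /upper_level/= => /negP; rewrite -leNgt => fK.
  by rewrite mul1r mulrC ler_wpM2r.
rewrite ge0_integralZl//; last 2 first.
- exact/measurable_EFinP.
- by move=> x _; rewrite lee_fin.
by apply: lee_wpmul2l.
Qed.

Lemma integral_min_ball_mass K c r : 0 <= K -> 0 <= c -> 0 < r ->
  (\int[mu]_x (Num.min 1 (c * b r x))%:E <=
    mu (upper_level K) + (K * (c * (v * r ^+ d)))%:E)%E.
Proof.
move=> K0 c0 r0; rewrite EFinM; apply: integral_min_level => //.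
- by apply: measurable_funM => //; exact: measurable_ball_mass.
- by move=> x; rewrite mulr_ge0// ball_mass_ge0.
under eq_integral do rewrite EFinM.
rewrite ge0_integralZl//; last 2 first.
- by apply/measurable_EFinP; exact: measurable_ball_mass.
- by move=> x _; rewrite lee_fin ball_mass_ge0.
by rewrite integral_ball_mass.
Qed.

(** 1 - (1 - b)^m <= min(1, m b), and the Lebesgue integral of b is the volume
    of the ball. *)
Lemma void_prob_ge K m r : 0 <= K -> 0 < r ->
  (1 <= void_prob m r + (mu (upper_level K) + (K * (m%:R * (v * r ^+ d)))%:E))%E.
Proof.
move=> K0 r0.
have := integral_min_ball_mass K m%:R r K0 (ler0n _ _) r0.
move/(leeD2l (void_prob m r)); apply: le_trans.
rewrite -(integral_prob_cst mu 1) -ge0_integralD//; last 4 first.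
- by move=> x _; rewrite lee_fin void_ge0.
- by apply/measurable_EFinP; exact: measurable_void.
- by move=> x _; rewrite lee_fin le_min ler01 mulr_ge0// ball_mass_ge0.
- apply/measurable_EFinP; apply: measurable_minr => //.
  by apply: measurable_funM => //; exact: measurable_ball_mass.
apply: ge0_le_integral => //.
- apply: emeasurable_funD.
    by apply/measurable_EFinP; exact: measurable_void.
  apply/measurable_EFinP; apply: measurable_minr => //.
  by apply: measurable_funM => //; exact: measurable_ball_mass.
move=> x _; rewrite -EFinD lee_fin.
have := bernoulli_le1 _ m (ball_mass_ge0 mu r x) (ball_mass_le1 mu r x).
by have [_|_] := leP 1 (m%:R * b r x); rewrite ?lerDr ?void_ge0.
Qed.

Lemma upper_level_small e : 0 < e ->
  exists2 K, 0 < K & (mu (upper_level K) <= e%:E)%E.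
Proof.
move=> e0; have mL := measurable_upper_level.
have L0 : \bigcap_n upper_level n%:R = set0.
  apply/seteqP; split => // x /(_ (Num.truncn (f x)).+1 I).
  by rewrite /upper_level/= => /(lt_trans (truncnS_gt _)); rewrite ltxx.
have cL : mu (upper_level n%:R) @[n --> \oo] --> 0%E.
  rewrite -[X in _ --> X](@measure0 _ _ _ mu) -L0.
  apply: nonincreasing_cvg_mu => //; last 2 first.
  - by rewrite L0.
  - move=> m n mn; apply/subsetPset => x; apply: le_lt_trans.
    by rewrite ler_nat.
  by rewrite (le_lt_trans (probability_le1 _ _)) ?ltry.
have e0E : (0 < e%:E)%E by rewrite lte_fin.
have [n /(_ n.+1 (leqnSn n)) nL] := cvge_eventually_lt _ _ _ cL e0E.
by exists n.+1%:R => //; exact: ltW.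
Qed.

Hypothesis hd : (0 < d)%N.

Lemma small_radius C e : 0 <= C -> 0 < e ->
  exists2 rho, 0 < rho & forall r, 0 < r -> r <= rho -> C * (v * r ^+ d) <= e.
Proof.
move=> C0 e0; have v0 := @unit_ball_volume_gt0 R d.
have D0 : 0 < C * v + 1 by rewrite ltr_wpDl// mulr_ge0// ltW.
exists (Num.min 1 (e / (C * v + 1))) => [|r r0]; first by rewrite lt_min ltr01 divr_gt0.
rewrite le_min => /andP[r1 re].
have rd : r ^+ d <= r.
  by rewrite -{2}[r]expr1 ler_wiXn2l// ltW.
rewrite mulrA (@le_trans _ _ ((C * v + 1) * r))//; last first.
  by rewrite mulrC -ler_pdivlMr.
have Cv0 : 0 <= C * v by rewrite mulr_ge0// ltW.
have rd0 : 0 <= r ^+ d by rewrite exprn_ge0// ltW.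
by apply: ler_pM => //; rewrite lerDl.
Qed.

Lemma integral_ball_mass_small e : 0 < e -> exists2 rho, 0 < rho &
  forall r, 0 < r -> r <= rho -> (\int[mu]_x (b r x)%:E <= e%:E)%E.
Proof.
move=> e0; have e2 : 0 < e / 2 by rewrite divr_gt0.
have [K K0 KL] := upper_level_small _ e2.
have [rho rho0 H] := small_radius _ _ (ltW K0) e2.
exists rho => // r r0 rr.
rewrite [e]splitr EFinD; apply: le_trans (leeD KL (_ : ((K * (v * r ^+ d))%:E <= _)%E)); last first.
  by rewrite lee_fin H.
have := integral_min_ball_mass K 1 r (ltW K0) ler01 r0; rewrite mul1r.
apply: le_trans; rewrite le_eqVlt; apply/orP; left; apply/eqP.
by apply: eq_integral => x _; rewrite mul1r min_r// ball_mass_le1.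
Qed.

Let fint : lam.-integrable setT (EFin \o f).
Proof.
apply/integrableP; split; first exact/measurable_EFinP.
rewrite (_ : (\int[lam]_x _)%E = mu setT).
  by rewrite (le_lt_trans (probability_le1 _ _)) ?ltry.
by rewrite dens//; apply: eq_integral => x _; rewrite /= ger0_norm.
Qed.

Let le_dist_ereal (x y : R) (J : \bar R) : (0 <= J)%E ->
  (x%:E <= y%:E + J)%E -> (y%:E <= x%:E + J)%E -> (`|x - y|%:E <= J)%E.
Proof.
case: J => [j| |//]; last by move=> _ _ _; rewrite leey.
rewrite -!EFinD !lee_fin => j0 xy yx; rewrite ler_norml; lra.
Qed.

(** b_r(x) - v r^d f(x) is the integral of f y - f x over the ball, whence the
    oscillation. *)
Lemma integral_ball_mass_sub r : 0 < r ->
  (\int[lam]_x (`|b r x - (v * r ^+ d) * f x|)%:E <= near_integral r (osc f))%E.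
Proof.
move=> r0; have mo := measurable_osc f mf.
have mN := measurable_near_integrand r (osc f) mo.
have N0 p : (0 <= (osc f p * \1_(near_pairs r) p)%:E)%E by rewrite lee_fin mulr_ge0// osc_ge0.
rewrite /near_integral fubini_tonelli1//.
apply: ge0_le_integral => //.
- apply/measurable_EFinP/measurableT_comp => //; apply: measurable_funB.
    exact: measurable_ball_mass.
  exact: measurable_funM.
- by apply: measurable_fun_fubini_tonelli_F.
move=> x _; rewrite /fubini_F.
have mB := measurable_cball x r.
have mi : measurable_fun setT (\1_(cball x r) : V -> R) by exact: measurable_indic.
have -> : (\int[lam]_y (osc f (x, y) * \1_(near_pairs r) (x, y))%:E =
    \int[lam]_(y in cball x r) `|f x - f y|%:E)%E.
  rewrite [RHS]integral_mkcond; apply: eq_integral => y _.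
  rewrite patchE /osc/= indicE -mem_xsection xsection_le_dist.
  by case: (y \in _); rewrite ?mulr1 ?mulr0.
have mfB : measurable_fun (cball x r) (fun y => (f y)%:E).
  by apply/measurable_funTS/measurable_EFinP.
have moB : measurable_fun (cball x r) (fun y => `|f x - f y|%:E).
  by apply/measurable_funTS/measurable_EFinP/measurableT_comp => //; exact: measurable_funB.
have bE : (b r x)%:E = (\int[lam]_(y in cball x r) (f y)%:E)%E.
  by rewrite -ball_massE dens.
have fE : ((v * r ^+ d) * f x)%:E = (\int[lam]_(y in cball x r) (f x)%:E)%E.
  rewrite integral_cst// mulrC EFinM; congr (_ * _)%E.
  by apply/esym; exact: lebesgue_cball.
apply: le_dist_ereal; first by apply: integral_ge0 => y _; rewrite lee_fin.
- rewrite bE fE -ge0_integralD//; last by move=> y _; rewrite lee_fin.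
  apply: ge0_le_integral => //.
  + by move=> y _; rewrite lee_fin.
  + exact: emeasurable_funD.
  move=> y _; rewrite -EFinD lee_fin.
  by have := ler_norm (f y - f x); rewrite distrC; lra.
- rewrite bE fE -ge0_integralD//; last by move=> y _; rewrite lee_fin.
  apply: ge0_le_integral => //.
  by move=> y _; rewrite lee_fin.
  + exact: emeasurable_funD.
  move=> y _; rewrite -EFinD lee_fin.
  by have := ler_norm (f x - f y); lra.
Qed.

Definition void_lim t : \bar R := (\int[mu]_x (expR (- (t * f x)))%:E)%E.

Lemma measurable_void_lim t : measurable_fun setT (fun x => expR (- (t * f x))).
Proof.
apply: (measurableT_comp (@measurable_expR R)).
by apply: measurable_funN; exact: measurable_funM.
Qed.

(** With w = t f(x), the integrand (1 - b)^m is within 2 b + min(1, |c b - w|) of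
    exp(-w).  The first term has a small mu-integral, and the second one a small
    Lebesgue integral by continuity in the mean, hence a small mu-integral. *)
Lemma void_prob_approx t e : 0 <= t -> 0 < e -> exists2 rho, 0 < rho &
  forall r m c, 0 < r -> r <= rho -> 0 <= c -> `|c - m%:R| <= 1 ->
    c * (v * r ^+ d) = t ->
  (void_prob m r <= void_lim t + e%:E)%E /\ (void_lim t <= void_prob m r + e%:E)%E.
Proof.
move=> t0 e0; have e8 : 0 < e / 8 by rewrite divr_gt0.
have e2 : 0 < e / 2 by rewrite divr_gt0.
have [K K0 KL] := upper_level_small _ e8.
have [r1 r10 H1] := integral_ball_mass_small _ e8.
(* so that K t a <= e / 8 *)
pose a := e / 8 / (K * t + 1).
have Kt0 : 0 <= K * t by rewrite mulr_ge0// ltW.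
have a0 : 0 < a by rewrite /a divr_gt0// ltr_wpDl.
have [r2 r20 H2] := mean_continuous_integrable f mf f0 fint a a0.
exists (Num.min r1 r2) => [|r m c r0]; first by rewrite lt_min r10.
rewrite le_min => /andP[rr1 rr2] c0 cm ct.
pose h x : R := `|c * b r x - t * f x|.
have mh : measurable_fun setT h.
  apply: measurableT_comp => //; apply: measurable_funB; apply: measurable_funM => //.
  exact: measurable_ball_mass.
pose g x : R := 2 * b r x + Num.min 1 (h x).
have mg : measurable_fun setT g.
  apply: measurable_funD; last exact: measurable_minr.
  by apply: measurable_funM => //; exact: measurable_ball_mass.
have g0 x : 0 <= g x.
  by rewrite addr_ge0 ?mulr_ge0 ?ball_mass_ge0// le_min ler01 normr_ge0.
have ge : (\int[mu]_x (g x)%:E <= e%:E)%E.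
  under eq_integral do rewrite /g EFinD (EFinM 2).
  rewrite ge0_integralD//; last 4 first.
  - by move=> x _; rewrite -EFinM lee_fin mulr_ge0// ball_mass_ge0.
  - apply: emeasurable_funM; first exact: measurable_cst.
    by apply/measurable_EFinP; exact: measurable_ball_mass.
  - by move=> x _; rewrite lee_fin le_min ler01 normr_ge0.
  - by apply/measurable_EFinP; exact: measurable_minr.
  have -> : e = 2 * (e / 8) + (e / 8 + (e / 8 * 5)) by field.
  rewrite [leRHS]EFinD; apply: leeD.
    rewrite ge0_integralZl//; last 2 first.
    - by apply/measurable_EFinP; exact: measurable_ball_mass.
    - by move=> x _; rewrite lee_fin ball_mass_ge0.
    by rewrite (EFinM 2); apply: lee_wpmul2l => //; exact: H1.
  have hC : (\int[lam]_x (h x)%:E <= (t * a)%:E)%E.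
    apply: (@le_trans _ _ (c%:E * (a * (v * r ^+ d))%:E)%E); last first.
      by rewrite -EFinM lee_fin mulrCA ct mulrC.
    apply: (@le_trans _ _ (c%:E * \int[lam]_x (`|b r x - (v * r ^+ d) * f x|)%:E)%E).
      rewrite -ge0_integralZl//; last first.
        apply/measurable_EFinP/measurableT_comp => //; apply: measurable_funB.
          exact: measurable_ball_mass.
        exact: measurable_funM.
      rewrite le_eqVlt; apply/orP; left; apply/eqP; apply: eq_integral => x _.
      rewrite -EFinM /h; congr EFin.
      by rewrite -{2}(ger0_norm c0) -normrM mulrBr mulrA ct.
    apply: lee_wpmul2l; first by rewrite lee_fin.
    exact: (le_trans (integral_ball_mass_sub _ r0) (H2 _ r0 rr2)).
  apply: (le_trans (integral_min_level _ _ _ (ltW K0) mh (fun x => normr_ge0 _) hC)).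
  rewrite EFinD; apply: leeD => //.
  rewrite -EFinM lee_fin /a.
  have -> : K * (t * (e / 8 / (K * t + 1))) = e / 8 * (K * t / (K * t + 1)) by ring.
  apply: ler_wpM2l; first exact: ltW.
  rewrite ler_pdivrMr ?ltr_wpDl//; lra.
have approx x : `|(1 - b r x) ^+ m - expR (- (t * f x))| <= g x.
  apply: exprn_one_sub_approx => //.
  - exact: ball_mass_ge0.
  - exact: ball_mass_le1.
  - exact: mulr_ge0.
have mv := measurable_void m r; have ml := measurable_void_lim t.
have mvE : measurable_fun setT (fun x => ((1 - b r x) ^+ m)%:E).
  exact/measurable_EFinP.
have mlE : measurable_fun setT (fun x => (expR (- (t * f x)))%:E).
  exact/measurable_EFinP.
have mgE : measurable_fun setT (fun x => (g x)%:E) by exact/measurable_EFinP.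
have v0 x : (0 <= ((1 - b r x) ^+ m)%:E)%E by rewrite lee_fin void_ge0.
have l0 x : (0 <= (expR (- (t * f x)))%:E)%E by rewrite lee_fin expR_ge0.
have g0E x : (0 <= (g x)%:E)%E by rewrite lee_fin.
split; apply: (le_trans _ (leeD2l _ ge)); rewrite -ge0_integralD//;
  apply: ge0_le_integral => //; try exact: emeasurable_funD.
  move=> x _; rewrite -EFinD lee_fin.
  by have := ler_norm ((1 - b r x) ^+ m - expR (- (t * f x))); have := approx x; lra.
move=> x _; rewrite -EFinD lee_fin.
have := ler_norm (expR (- (t * f x)) - (1 - b r x) ^+ m); have := approx x.
by rewrite distrC; lra.
Qed.

End void_probability.

(** * Tail bounds that are uniform in the sample size *)

Section tail_sums.
Context {dT} {T : measurableType dT} {R : realType}.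
Variable mu : {measure set T -> \bar R}.
Variable z : T -> R.
Hypothesis mz : measurable_fun setT z.

Let mlevel (a : R) : measurable [set x | a < z x].
Proof.
exact: measurable_gt_level.
Qed.

Let tailE : (\sum_(0 <= k <oo) mu [set x | k%:R < z x]%R =
  \int[mu]_x \sum_(0 <= k <oo) ((k%:R < z x)%R%:R : R)%:E)%E.
Proof.
rewrite integral_nneseries//; last first.
  move=> n; apply/measurable_EFinP.
  rewrite (_ : (fun x => _) = \1_[set x | n%:R < z x]); first exact: measurable_indic.
  by apply/funext => x; rewrite indicE mem_setE.
apply: eq_eseriesr => k _.
rewrite (_ : (fun x => _) = (fun x => (\1_[set x | k%:R < z x] x)%:E)); last first.
  by apply/funext => x; rewrite indicE mem_setE.
by rewrite integral_indic// setIT.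
Qed.

Let mcount : measurable_fun setT (fun x => \sum_(0 <= k <oo) ((k%:R < z x)%R%:R : R)%:E)%E.
Proof.
apply: ge0_emeasurable_sum => [k x _ _|k _]; first by rewrite lee_fin.
apply/measurable_EFinP.
rewrite (_ : (fun x => _) = \1_[set x | k%:R < z x]); first exact: measurable_indic.
by apply/funext => x; rewrite indicE mem_setE.
Qed.

Lemma integral_le_tail_sum :
  (\int[mu]_x (Num.max 0 (z x))%:E <= \sum_(0 <= k <oo) mu [set x | k%:R < z x]%R)%E.
Proof.
rewrite tailE; apply: ge0_le_integral => //.
- by move=> x _; rewrite lee_fin le_max lexx.
- by apply/measurable_EFinP; exact: measurable_maxr.
move=> x _; have [z0|z0] := leP (z x) 0; last exact: count_series_ge.
by apply: nneseries_ge0 => k _ _; rewrite lee_fin.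
Qed.

Lemma tail_sum_le :
  (\sum_(0 <= k <oo) mu [set x | k%:R < z x]%R <=
   \int[mu]_x (Num.max 0 (z x + 1))%:E)%E.
Proof.
rewrite tailE; apply: ge0_le_integral => //.
- by move=> x _; apply: nneseries_ge0 => k _ _; rewrite lee_fin.
- by apply/measurable_EFinP; apply: measurable_maxr => //; exact: measurable_funD.
- by move=> x _; exact: count_series_le.
Qed.

End tail_sums.

Lemma geometric_expRN_sum {R : realType} (a C : R) : 0 < a -> 0 <= C ->
  (\sum_(0 <= k <oo) (C * expR (- (a * k%:R)))%:E < +oo)%E.
Proof.
move=> a0 C0; pose q := expR (- a).
have q1 : q < 1 by rewrite /q -expR0 ltr_expR oppr_lt0.
have q1' : 0 < 1 - q by rewrite subr_gt0.
apply: (@le_lt_trans _ _ (C / (1 - q))%:E); last exact: ltry.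
apply: lime_le.
  by apply: is_cvg_nneseries => k _ _; rewrite lee_fin mulr_ge0// expR_ge0.
apply: nearW => n; rewrite sumEFin lee_fin big_mkord.
rewrite (eq_bigr (fun k : 'I_n => C * q ^+ k)); last first.
  by move=> k _; rewrite /q -expRM_natl mulrN [_%:R * a]mulrC.
rewrite -mulr_sumr ler_wpM2l//.
have E : (1 - q) * \sum_(i < n) q ^+ i = 1 - q ^+ n.
  by rewrite -[1 - q]opprB mulNr -subrX1 opprB.
rewrite -(ler_pM2l q1') E divff ?gt_eqF//.
by rewrite gerBl exprn_ge0// expR_ge0.
Qed.

Section volume_radius.
Context {R : realType} (d : nat).
Local Notation v := (unit_ball_volume R d).
Hypothesis hd : (0 < d)%N.
Implicit Types (s : R) (m : nat).

(** The radius of a ball of volume expR s / m. *)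
Definition vol_radius m s : R := expR ((s - ln m%:R - ln v) / d%:R).

Lemma vol_radius_gt0 m s : 0 < vol_radius m s.
Proof. exact: expR_gt0. Qed.

Let d_neq0 : d%:R != 0 :> R.
Proof. by rewrite pnatr_eq0 -lt0n. Qed.

Lemma vol_radiusE m s : (0 < m)%N -> m%:R * (v * vol_radius m s ^+ d) = expR s.
Proof.
move=> m0; have v0 := @unit_ball_volume_gt0 R d.
rewrite /vol_radius -expRM_natl (_ : d%:R * _ = s - ln m%:R - ln v); last by field.
rewrite !expRD !expRN !lnK ?posrE ?ltr0n//.
by field; rewrite !gt_eqF// ltr0n.
Qed.

Lemma vol_radius_small s (rho : R) : 0 < rho ->
  exists N, forall m, (N <= m)%N -> vol_radius m s <= rho.
Proof.
move=> rho0; pose B := expR (s - ln v - d%:R * ln rho).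
exists (Num.truncn B).+1 => {}m mB.
rewrite -[leRHS]lnK ?posrE// ler_expR ler_pdivrMr ?ltr0n//.
have m0 : 0 < m%:R :> R by rewrite ltr0n (leq_trans _ mB).
have Bm : B <= m%:R by rewrite (le_trans (ltW (truncnS_gt B)))// ler_nat.
have : ln B <= ln m%:R by rewrite ler_ln// ?posrE// expR_gt0.
rewrite /B expRK; set a := ln rho; set c := ln _; set u := ln _.
lra.
Qed.

End volume_radius.

Section tail_bounds.
Context {R : realType} {d : nat}.
Local Notation V := (vec R d).
Local Notation v := (unit_ball_volume R d).
Hypothesis hd : (0 < d)%N.
Variable mu : probability V R.
Implicit Types (r e c : R) (x : V) (A : set V) (m k : nat).
Local Notation b := (ball_mass mu).
Local Notation rad := (vol_radius d).

Definition outside r : set V := [set x | r < enorm x].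

Lemma measurable_outside r : measurable (outside r).
Proof. exact: (measurable_gt_level _ _ measurable_enorm). Qed.

(** The common form of the two bounds below: a small constant, off two
    exceptional sets. *)
Lemma integral_le_cst_indic2 (h : V -> R) (c : R) A (B : set V) :
  measurable_fun setT h -> (forall x, 0 <= h x) -> 0 <= c ->
  measurable A -> measurable B ->
  (forall x, h x <= c + \1_A x + \1_B x) ->
  (\int[mu]_x (h x)%:E <= c%:E + mu A + mu B)%E.
Proof.
move=> mh h0 c0 mA mB H.
have mi (C : set V) : measurable C -> measurable_fun setT (fun x => (\1_C x : R)%:E).
  by move=> mC; apply/measurable_EFinP/measurable_indic.
apply: (@le_trans _ _ (\int[mu]_x (c%:E + (\1_A x)%:E + (\1_B x)%:E))%E).
  apply: ge0_le_integral => //.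
  - by move=> x _; rewrite lee_fin.
  - exact/measurable_EFinP.
  - by do 2?[apply: emeasurable_funD]; [exact: measurable_cst|exact: mi|exact: mi].
  - by move=> x _; rewrite -!EFinD lee_fin.
rewrite ge0_integralD//; last 3 first.
- by move=> x _; rewrite -EFinD lee_fin addr_ge0.
- by apply: emeasurable_funD; [exact: measurable_cst|exact: mi].
- exact: mi.
rewrite ge0_integralD//; last first.
  exact: mi.
by rewrite integral_prob_cst !integral_indic// !setIT.
Qed.

(** A point of the ball of radius rho where b >= e/m has a void ball with
    probability at most exp(-e); the other points of this ball carry little
    mass. *)
Lemma void_prob_many m r e rho : 0 < r -> 0 <= rho -> 0 < e -> (0 < m)%N ->
  (void_prob mu m r <= (expR (- e))%:E + mu (outside rho) +
     (e / m%:R * (2 * (rho + r) / r) ^+ d)%:E)%E.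
Proof.
move=> r0 rho0 e0 m0; have m0R : 0 < m%:R :> R by rewrite ltr0n.
have em0 : 0 <= e / m%:R by rewrite divr_ge0// ltW.
apply: le_trans (leeD2l _ (sparse_mass mu r rho (e / m%:R) r0 rho0 em0)).
apply: integral_le_cst_indic2.
- exact: measurable_void.
- by move=> x; exact: void_ge0.
- exact: expR_ge0.
- exact: measurable_outside.
- exact: measurable_sparse.
move=> x; rewrite !indicE.
have [xrho|xrho] := leP (enorm x) rho; last first.
  rewrite [x \in outside _]mem_set//=.
  by apply: (le_trans (void_le1 _ _ _ _)); rewrite addrAC lerDr addr_ge0// expR_ge0.
have [xe|xe] := ltP (b r x) (e / m%:R).
  rewrite [x \in [set _ | _]]mem_set//=.
  by apply: (le_trans (void_le1 _ _ _ _)); rewrite lerDr addr_ge0// expR_ge0.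
apply: (@le_trans _ _ (expR (- e))); last by rewrite -addrA lerDl addr_ge0.
apply: (le_trans (exprn_one_sub_le _ _ (ball_mass_ge0 _ _ _) (ball_mass_le1 _ _ _))).
by rewrite ler_expR lerN2 -ler_pdivrMl// mulrC.
Qed.

(** If x is within r/2 of the origin, then its r-ball contains the ball of
    radius r/2 around the origin, and a single other point is enough. *)
Lemma void_prob_large m r : (0 < m)%N ->
  (void_prob mu m r <= mu (outside (r / 2)) + mu (outside (r / 2)))%E.
Proof.
move=> m0; set A := outside (r / 2); have mA := measurable_outside (r / 2).
have AE : mu A = (fine (mu A))%:E by rewrite fineK// fin_num_measure.
rewrite {1}AE -[leRHS]adde0 -(measure0 mu).
apply: integral_le_cst_indic2 => //.
- exact: measurable_void.
- by move=> x; exact: void_ge0.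
- by rewrite fine_ge0.
move=> x; rewrite [\1_set0 _]indicE in_set0 addr0 indicE.
have [xr|xr] := ltP (r / 2) (enorm x).
  rewrite mem_set//=; apply: (le_trans (void_le1 _ _ _ _)).
  by rewrite lerDr fine_ge0.
rewrite memNset/= ?addr0; last by rewrite /A/outside/= => /(le_lt_trans xr); rewrite ltxx.
apply: (@le_trans _ _ (1 - b r x)).
  rewrite -[leRHS]expr1; apply: ler_wiXn2l => //.
    by rewrite subr_ge0 ball_mass_le1.
  by rewrite gerBl ball_mass_ge0.
rewrite lerBlDr addrC -lee_fin EFinD -ball_massE -AE.
rewrite -(@probability_setT _ _ _ mu).
have mB := measurable_cball x r.
apply: (@le_trans _ _ (mu (cball x r `|` A))); last exact: measureU2.
apply: le_measure; rewrite ?inE//; first exact: measurableU.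
move=> y _; have [xy|xy] := leP (vdist x y) r; [by left|right].
rewrite /A/outside/=.
have := vdist_triangle vzero x y; rewrite [vdist vzero y]vdistC -!enorm_vdist.
lra.
Qed.

(** The factor (2 (rho + r)/r)^d of [void_prob_many] for rho = 1 and for the
    radius r of the ball of volume 1, so that r^-d = v. *)
Definition radius_const : R := v * (2 * (1 + expR (- (ln v / d%:R)))) ^+ d.

(** The terms are those of [void_prob_many] for e = e^(k/4) and rho = e^(k/8d),
    which serves when m >= e^(k/2), and those of [void_prob_large], which serves
    when m < e^(k/2): then the ball of volume e^k/m has volume at least
    e^(k/2). *)
Definition upper_tail k : \bar R :=
  ((expR (- (k%:R / 4)))%:E + (radius_const * expR (- (k%:R / 8)))%:E +
   mu (outside (expR (k%:R / (8 * d%:R)))) +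
   (mu (outside (expR ((k%:R / 2 - ln v) / d%:R) / 2)) +
    mu (outside (expR ((k%:R / 2 - ln v) / d%:R) / 2))))%E.

Lemma radius_const_ge0 : 0 <= radius_const.
Proof.
have v0 := @unit_ball_volume_gt0 R d; rewrite mulr_ge0 ?exprn_ge0//; first exact: ltW.
Qed.

Let d_gt0 : 0 < d%:R :> R. Proof. by rewrite ltr0n. Qed.

Lemma void_prob_le_upper_tail m k : (0 < m)%N ->
  (void_prob mu m (rad m k%:R) <= upper_tail k)%E.
Proof.
move=> m0; have m0R : 0 < m%:R :> R by rewrite ltr0n.
have v0 := @unit_ball_volume_gt0 R d.
have [mk|mk] := ltP m%:R (expR (k%:R / 2 : R)).
  apply: (le_trans (void_prob_large m _ m0)).
  rewrite /upper_tail -[leLHS]add0e; apply: leeD.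
    apply: adde_ge0 => //; apply: adde_ge0; rewrite lee_fin ?expR_ge0//.
    by rewrite mulr_ge0 ?expR_ge0 ?radius_const_ge0.
  have H : outside (rad m k%:R / 2) `<=` outside (expR ((k%:R / 2 - ln v) / d%:R) / 2).
    move=> x; apply: le_lt_trans; rewrite ler_pM2r ?invr_gt0// ler_expR.
    rewrite ler_pM2r ?invr_gt0// lerD2r.
    have : ln m%:R <= k%:R / 2 :> R.
      by rewrite -[leRHS]expRK ler_ln ?posrE ?expR_gt0// ltW.
    lra.
  by apply: leeD; apply: le_measure; rewrite ?inE//; exact: measurable_outside.
(* r1 is the radius of the ball of volume 1.  Radii above r1 are cut to r1:
   then m balls still have total volume at least e^(k/2), and the region
   covered by the balls stays comparable to the ball of radius rho. *)
pose r1 : R := expR (- (ln v / d%:R)).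
have r10 : 0 < r1 by exact: expR_gt0.
have r1E : v * r1 ^+ d = 1.
  rewrite /r1 -expRM_natl mulrN mulrCA divff ?mulr1 ?gt_eqF//.
  by rewrite expRN lnK ?posrE// divff// gt_eqF.
pose r : R := rad m k%:R; pose r' := Num.min r r1.
have r0 : 0 < r by exact: vol_radius_gt0.
have r'0 : 0 < r' by rewrite lt_min r0.
have r'r : r' <= r by rewrite ge_min lexx.
have r'r1 : r' <= r1 by rewrite ge_min lexx orbT.
have vol : expR (k%:R / 2) <= m%:R * (v * r' ^+ d).
  rewrite /r'; have [_|_] := leP r r1; last by rewrite r1E mulr1.
  by rewrite vol_radiusE// ler_expR ler_pdivrMr// ler_peMr// ler1n.
apply: (@le_trans _ _ (void_prob mu m r')).
  apply: ge0_le_integral => //.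
  - by move=> x _; rewrite lee_fin void_ge0.
  - by apply/measurable_EFinP; exact: measurable_void.
  - by apply/measurable_EFinP; exact: measurable_void.
  - move=> x _; rewrite lee_fin lerXn2r ?nnegrE ?subr_ge0 ?ball_mass_le1//.
    by rewrite lerD2l lerN2 ball_mass_le.
pose rho : R := expR (k%:R / (8 * d%:R)).
have rho1 : 1 <= rho by rewrite -expR0 ler_expR divr_ge0// mulr_ge0.
have rho0 : 0 <= rho by exact: expR_ge0.
have rhod : rho ^+ d = expR (k%:R / 8).
  by rewrite /rho -expRM_natl; congr expR; field; rewrite gt_eqF.
apply: (le_trans (void_prob_many m r' (expR (k%:R / 4)) rho r'0 rho0 (expR_gt0 _) m0)).
rewrite /upper_tail -[leLHS]adde0; apply: leeD; last by rewrite adde_ge0.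
rewrite -/rho addeAC; apply: leeD => //; apply: leeD.
  rewrite lee_fin ler_expR lerN2 (le_trans _ (expR_ge1Dx _))// lerDr//.
rewrite lee_fin.
have E : (2 * (rho + r') / r') ^+ d = (2 * (rho + r')) ^+ d / r' ^+ d.
  by rewrite expr_div_n.
have rd0 : 0 < r' ^+ d by rewrite exprn_gt0.
have step1 : (2 * (rho + r')) ^+ d <= rho ^+ d * (2 * (1 + r1)) ^+ d.
  rewrite -exprMn lerXn2r ?nnegrE ?mulr_ge0 ?addr_ge0 ?(ltW r10) ?(ltW r'0)//.
  rewrite mulrCA ler_wpM2l// mulrDr mulr1 lerD2l (le_trans r'r1)//.
  by rewrite ler_peMl// ltW.
have step2 : expR (k%:R / 4) / m%:R / r' ^+ d <= v * expR (- (k%:R / 4)).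
  rewrite ler_pdivrMr// ler_pdivrMr//.
  have -> : v * expR (- (k%:R / 4)) * r' ^+ d * m%:R =
    expR (- (k%:R / 4)) * (m%:R * (v * r' ^+ d)) by ring.
  apply: le_trans (ler_wpM2l (expR_ge0 _) vol).
  rewrite -expRD ler_expR; lra.
rewrite E [leLHS](_ : _ = expR (k%:R / 4) / m%:R / r' ^+ d * (2 * (rho + r')) ^+ d); last by ring.
apply: (@le_trans _ _ (v * expR (- (k%:R / 4)) * (rho ^+ d * (2 * (1 + r1)) ^+ d))).
  apply: ler_pM => //.
  - by rewrite !divr_ge0 ?expR_ge0// ltW.
  - by rewrite exprn_ge0// mulr_ge0// addr_ge0// ltW.
rewrite rhod /radius_const -/r1 le_eqVlt; apply/orP; left; apply/eqP.
have -> : expR (- (k%:R / 8 : R)) = expR (- (k%:R / 4)) * expR (k%:R / 8).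
  by rewrite -expRD; congr expR; field.
ring.
Qed.

End tail_bounds.

Section tail_summability.
Context {R : realType} {d : nat}.
Local Notation V := (vec R d).
Local Notation v := (unit_ball_volume R d).
Hypothesis hd : (0 < d)%N.
Variable mu : probability V R.
Implicit Types (c : R) (x : V) (m k : nat).
Local Notation rad := (vol_radius d).
Local Notation log_moment := (\int[mu]_x (Num.max (ln (enorm x)) 0)%:E)%E.

Let d_gt0 : 0 < d%:R :> R. Proof. by rewrite ltr0n. Qed.

Let mlog : measurable_fun setT (fun x : V => ln (enorm x)).
Proof. exact: measurableT_comp (@measurable_ln R) measurable_enorm. Qed.

Let mlogp : measurable_fun setT (fun x : V => (Num.max (ln (enorm x)) 0)%:E).
Proof. by apply/measurable_EFinP; apply: measurable_maxr. Qed.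

(** Layer-cake formula for an affine function of ln (norm x). *)
Lemma log_tail_sum (a c : R) (F : nat -> set V) : 0 <= a ->
  (forall k, measurable (F k)) ->
  (forall k x, F k x -> k%:R < a * ln (enorm x) + c) ->
  (log_moment < +oo)%E -> (\sum_(0 <= k <oo) mu (F k) < +oo)%E.
Proof.
move=> a0 mF HF Hlog.
have mz : measurable_fun setT (fun x : V => a * ln (enorm x) + c).
  by apply: measurable_funD => //; exact: measurable_funM.
have := tail_sum_le mu _ mz.
have H1 : (\int[mu]_x (Num.max 0 (a * ln (enorm x) + c + 1)%R)%:E <=
    \int[mu]_x (a%:E * (Num.max (ln (enorm x)) 0)%:E + `|c + 1|%:E))%E.
  apply: ge0_le_integral => //.
  - by move=> x _; rewrite lee_fin le_max lexx.
  - by apply/measurable_EFinP; apply: measurable_maxr => //; exact: measurable_funD.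
  - by apply: emeasurable_funD => //; apply: emeasurable_funM.
  move=> x _; rewrite -EFinM -EFinD lee_fin.
  have h1 : ln (enorm x) <= Num.max (ln (enorm x)) 0 by rewrite le_max lexx.
  have h2 : 0 <= Num.max (ln (enorm x)) 0 by rewrite le_max lexx orbT.
  have h3 := ler_norm (c + 1); have h4 := normr_ge0 (c + 1).
  have h5 := ler_wpM2l a0 h1; have h6 := mulr_ge0 a0 h2.
  rewrite ge_max; apply/andP; split; lra.
have H2 : (\int[mu]_x (a%:E * (Num.max (ln (enorm x)) 0)%:E + `|c + 1|%:E) < +oo)%E.
  rewrite ge0_integralD//; last 2 first.
  - by move=> x _; rewrite -EFinM lee_fin mulr_ge0// le_max lexx orbT.
  - by apply: emeasurable_funM.
  rewrite integral_prob_cst ge0_integralZl//; last first.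
    by move=> x _; rewrite lee_fin le_max lexx orbT.
  by rewrite lte_add_pinfty ?ltry// lte_mul_pinfty// lee_fin.
move=> H3; apply: le_lt_trans (le_lt_trans H3 (le_lt_trans H1 H2)).
apply: lee_nneseries => // k _; apply: le_measure; rewrite ?inE//.
- exact: measurable_gt_level.
- exact: HF.
Qed.

Lemma upper_tail_ge0 k : (0 <= upper_tail mu k)%E.
Proof.
by apply: le_trans (void_prob_le_upper_tail hd mu 1 k isT); exact: void_prob_ge0.
Qed.

Lemma upper_tail_sum : (log_moment < +oo)%E ->
  (\sum_(0 <= k <oo) upper_tail mu k < +oo)%E.
Proof.
move=> Hlog; pose F1 k : set V := outside (expR (k%:R / (8 * d%:R))).
pose F2 k : set V := outside (expR ((k%:R / 2 - ln v) / d%:R) / 2).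
have S1 : (\sum_(0 <= k <oo) mu (F1 k) < +oo)%E.
  apply: (log_tail_sum (8 * d%:R) 0 F1) => //.
    by move=> k; exact: measurable_outside.
  move=> k x; rewrite /F1/outside/= => xk.
  have x0 : 0 < enorm x by apply: lt_trans xk; exact: expR_gt0.
  rewrite addr0 mulrC -ltr_pdivrMr ?mulr_gt0//.
  by rewrite -ltr_expR lnK.
have S2 : (\sum_(0 <= k <oo) mu (F2 k) < +oo)%E.
  apply: (log_tail_sum (2 * d%:R) (2 * (d%:R * ln 2 + ln v)) F2) => //.
    by move=> k; exact: measurable_outside.
  move=> k x; rewrite /F2/outside/= => xk.
  have x0 : 0 < enorm x by apply: lt_trans xk; rewrite divr_gt0// expR_gt0.
  have : (k%:R / 2 - ln v) / d%:R < ln (enorm x) + ln 2.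
    by rewrite -ltr_expR expRD !lnK ?posrE// -ltr_pdivrMr.
  by rewrite ltr_pdivrMr//; lra.
pose C := @radius_const R d; have C0 : 0 <= C by exact: radius_const_ge0.
have S3 := @geometric_expRN_sum R (1 / 4) 1 ltac:(lra) ltac:(lra).
have S4 := @geometric_expRN_sum R (1 / 8) C ltac:(lra) C0.
have g0 (a c : R) k : 0 <= c -> (0 <= (c * expR (- (a * k%:R)))%:E)%E.
  by move=> c0; rewrite lee_fin mulr_ge0// expR_ge0.
rewrite (eq_eseriesr (g := fun k => ((1 * expR (- (1 / 4 * k%:R)))%:E +
  (C * expR (- (1 / 8 * k%:R)))%:E + mu (F1 k) + (mu (F2 k) + mu (F2 k)))%E)); last first.
  have E (a : R) (j : nat) : 1 / a * j%:R = j%:R / a by rewrite mul1r mulrC.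
  by move=> k _; rewrite /upper_tail mul1r (E 4) (E 8).
rewrite nneseriesD; last 2 first.
- by move=> k _ _; rewrite !adde_ge0// g0.
- by move=> k _ _; rewrite adde_ge0.
rewrite nneseriesD; last 2 first.
- by move=> k _ _; rewrite adde_ge0// g0.
- by [].
rewrite nneseriesD; last 2 first.
- by move=> k _ _; rewrite g0.
- by move=> k _ _; rewrite g0.
rewrite nneseriesD//.
by rewrite !lte_add_pinfty.
Qed.

(** Choose M such that the ball of radius M has mass beta > 0.  A point x at
    distance more than M + r from the origin has b_r(x) <= 1 - beta, so
    [void_prob mu m r] is at least beta^m times the mass at distance more than
    M + r. *)
Lemma log_moment_lty m : (0 < m)%N ->
  (\sum_(0 <= k <oo) void_prob mu m (rad m k%:R) < +oo)%E -> (log_moment < +oo)%E.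
Proof.
move=> m0 Hsum.
have [M M1 Mpos] : exists2 M : R, 1 <= M & (0 < mu (~` outside M))%E.
  have oT : \bigcap_n outside (n.+1%:R : R) = set0 :> set V.
    apply/seteqP; split => // x /(_ (Num.truncn (enorm x)) I).
    by rewrite /outside/= => /(lt_trans (truncnS_gt _)); rewrite ltxx.
  have : mu (outside (n.+1%:R : R)) @[n --> \oo] --> 0%E.
    rewrite -[X in _ --> X](@measure0 _ _ _ mu) -oT.
    apply: nonincreasing_cvg_mu.
    - by rewrite (le_lt_trans (probability_le1 _ _)) ?ltry//; exact: measurable_outside.
    - by move=> n; exact: measurable_outside.
    - by rewrite oT.
    - by move=> i j ij; apply/subsetPset => x; apply: le_lt_trans; rewrite ler_nat.
  move=> cO; have [N /(_ N (leqnn N)) NP] := cvge_eventually_lt _ _ _ cO lte01.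
  exists N.+1%:R; first by rewrite ler1n.
  rewrite probability_setC; last exact: measurable_outside.
  by rewrite sube_gt0.
have mO := @measurable_outside R d.
pose beta := fine (mu (~` outside M)).
have bE : mu (~` outside M) = beta%:E.
  by rewrite /beta fineK// fin_num_measure//; exact: measurableC.
have b0 : 0 < beta by rewrite -lte_fin -bE.
have bm0 : 0 < beta ^+ m by rewrite exprn_gt0.
have low r : 0 < r -> ((beta ^+ m)%:E * mu (outside (M + r)) <= void_prob mu m r)%E.
  move=> r0.
  have -> : ((beta ^+ m)%:E * mu (outside (M + r)) =
      \int[mu]_x ((beta ^+ m)%:E * (\1_(outside (M + r)) x)%:E))%E.
    rewrite ge0_integralZl//; last 2 first.
    - by apply/measurable_EFinP/measurable_indic.
    - by rewrite lee_fin ltW.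
    by rewrite integral_indic// setIT.
  apply: ge0_le_integral => //.
  - by move=> x _; rewrite -EFinM lee_fin mulr_ge0// ltW.
  - by apply: emeasurable_funM => //; exact/measurable_EFinP/measurable_indic.
  - by apply/measurable_EFinP; exact: measurable_void.
  move=> x _; rewrite -EFinM lee_fin indicE.
  have [xr|xr] := boolP (x \in _); last by rewrite mulr0 void_ge0.
  rewrite mulr1 lerXn2r ?nnegrE ?subr_ge0 ?ball_mass_le1 ?(ltW b0)//.
  rewrite lerBrDr -lee_fin EFinD -ball_massE -bE -measureU//.
  - apply: probability_le1; apply: measurableU; first exact: measurableC.
    exact: measurable_cball.
  - exact: measurableC.
  - exact: measurable_cball.
  - apply/seteqP; split => // y []; rewrite /outside /cball/= => /negP.
    rewrite -leNgt => yM xy; move: xr; rewrite inE /outside/=.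
    have := enorm_le_dist x y; lra.
have S : (\sum_(0 <= k <oo) mu (outside (M + rad m k%:R)) < +oo)%E.
  have : ((beta ^+ m)%:E * \sum_(0 <= k <oo) mu (outside (M + rad m k%:R)) < +oo)%E.
    rewrite -nneseriesZl//; apply: le_lt_trans Hsum.
    apply: lee_nneseries => [k _ _|k _]; first by rewrite mule_ge0// lee_fin ltW.
    by apply: low; exact: vol_radius_gt0.
  apply: contraTT; rewrite -!leNgt !leye_eq => /eqP ->.
  by rewrite gt0_muley// lte_fin.
(* M + rad m k <= (M + rad m 0) e^(k/d), since M >= 0 *)
pose B := ln (M + rad m 0).
have B0 : 0 <= B.
  by rewrite ln_ge0// (le_trans M1)// lerDl ltW// vol_radius_gt0.
have mz : measurable_fun setT (fun x : V => d%:R * (ln (enorm x) - B)).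
  by apply: measurable_funM => //; exact: measurable_funB.
have := integral_le_tail_sum mu _ mz.
have {S}S : (\sum_(0 <= k <oo) mu [set x | k%:R < d%:R * (ln (enorm x) - B)]%R < +oo)%E.
  apply: le_lt_trans S; apply: lee_nneseries => // k _.
  apply: le_measure; rewrite ?inE//.
    exact: measurable_gt_level.
  move=> x; rewrite /outside/= mulrC -ltr_pdivrMr// => kx.
  have kd : 0 <= k%:R / d%:R :> R by rewrite divr_ge0.
  have x0 : 0 < ln (enorm x) by lra.
  have x1 : 0 < enorm x.
    by rewrite lt_neqAle enorm_ge0 andbT eq_sym; apply/eqP => x1; move: x0; rewrite x1 ln0 ?ltxx.
  have : expR (B + k%:R / d%:R) < enorm x by rewrite -[ltRHS]lnK// ltr_expR; lra.
  apply: le_lt_trans; rewrite expRD lnK; last first.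
    by rewrite posrE ltr_wpDl ?vol_radius_gt0// (le_trans ler01).
  rewrite mulrDl lerD//.
    by rewrite ler_peMr ?(le_trans ler01)// -expR0 ler_expR.
  by rewrite /vol_radius -expRD ler_expR sub0r -mulrDl; lra.
move=> /le_lt_trans /(_ S) I.
apply: (@le_lt_trans _ _ (\int[mu]_x (d%:R^-1%:E * (Num.max 0 (d%:R * (ln (enorm x) - B))%R)%:E + B%:E))%E).
  apply: ge0_le_integral => //.
  - by move=> x _; rewrite lee_fin le_max lexx orbT.
  - apply: emeasurable_funD => //; apply: emeasurable_funM => //.
    by apply/measurable_EFinP; exact: measurable_maxr.
  move=> x _; rewrite -EFinM -EFinD lee_fin.
  set u := ln (enorm x).
  have h1 : d%:R * (u - B) <= Num.max 0 (d%:R * (u - B)) by rewrite le_max lexx orbT.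
  have h2 : 0 <= Num.max 0 (d%:R * (u - B)) by rewrite le_max lexx.
  have di : 0 <= d%:R^-1 :> R by rewrite invr_ge0.
  have h3 := ler_wpM2l di h1; have h4 := mulr_ge0 di h2.
  rewrite mulrA mulVf ?mul1r ?gt_eqF// in h3.
  rewrite ge_max; apply/andP; split; lra.
rewrite ge0_integralD//; last 2 first.
- by move=> x _; rewrite -EFinM lee_fin mulr_ge0// ?invr_ge0// le_max lexx.
- by apply: emeasurable_funM => //; apply/measurable_EFinP; exact: measurable_maxr.
rewrite integral_prob_cst ge0_integralZl//; last 2 first.
- by apply/measurable_EFinP; exact: measurable_maxr.
- by move=> x _; rewrite lee_fin le_max lexx.
by rewrite lte_add_pinfty ?ltry// lte_mul_pinfty// lee_fin invr_ge0.
Qed.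

End tail_summability.

Section density_signed.
Context {dT} {T : measurableType dT} {R : realType}.
Variables (nu mu : {measure set T -> \bar R}) (f : T -> R).
Hypothesis mf : measurable_fun setT f.
Hypothesis f0 : forall x, 0 <= f x.
Hypothesis dens : forall A, measurable A -> nu A = (\int[mu]_(x in A) (f x)%:E)%E.
Local Open Scope ereal_scope.

Lemma integrable_density (g : T -> R) : measurable_fun setT g ->
  mu.-integrable setT (fun x => (f x * g x)%:E) ->
  nu.-integrable setT (fun x => (g x)%:E).
Proof.
move=> mg /integrableP[_ fin]; apply/integrableP; split; first exact/measurable_EFinP.
rewrite (integral_density _ _ _ mf f0 dens)//; last first.
  by apply: measurableT_comp => //; exact/measurable_EFinP.
apply: le_lt_trans fin; rewrite le_eqVlt; apply/orP; left; apply/eqP.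
by apply: eq_integral => x _; rewrite -EFinM /= normrM (ger0_norm (f0 x)) mulrC.
Qed.

Lemma integral_density_signed (g : T -> R) : measurable_fun setT g ->
  \int[nu]_x (g x)%:E = \int[mu]_x (f x * g x)%:E.
Proof.
move=> mg; have mgE : measurable_fun setT (EFin \o g) by exact/measurable_EFinP.
rewrite integralE [RHS]integralE.
rewrite (integral_density _ _ _ mf f0 dens _ (measurable_funepos mgE))//.
rewrite (integral_density _ _ _ mf f0 dens _ (measurable_funeneg mgE))//.
congr (_ - _); apply: eq_integral => x _; rewrite ?funeposE ?funenegE /=.
- by rewrite -!EFin_max -EFinM mulrC maxr_pMr// mulr0.
- by rewrite -!EFin_max -EFinM mulrC maxr_pMr// mulr0 mulrN.
Qed.

End density_signed.

Section entropy_tail.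
Context {R : realType} {d : nat}.
Local Notation V := (vec R d).
Local Notation lam := (lebesgue_vec R d).
Hypothesis hd : (0 < d)%N.
Variable mu : probability V R.
Variable f : V -> R.
Hypothesis mf : measurable_fun setT f.
Hypothesis f0 : forall x, 0 <= f x.
Hypothesis dens : forall A, measurable A -> mu A = (\int[lam]_(x in A) (f x)%:E)%E.
Hypothesis hH : has_finite_entropy f.
Implicit Types (x : V) (m k : nat).
Local Notation rad := (vol_radius d).

Let mlnf : measurable_fun setT (fun x => ln (f x)).
Proof. exact: measurableT_comp (@measurable_ln R) mf. Qed.

Lemma integrable_ln_density : mu.-integrable setT (fun x => (ln (f x))%:E).
Proof. exact: (integrable_density _ _ _ mf f0 dens _ mlnf hH). Qed.

Lemma integral_ln_density : \int[mu]_x ln (f x) = - entropy f.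
Proof.
rewrite /entropy opprK /Rintegral.
by rewrite (integral_density_signed _ _ _ mf f0 dens _ mlnf).
Qed.

(** The bound of [void_prob_ge] for m v r^d = e^-k and K = e^(k/2). *)
Definition lower_tail k : \bar R :=
  (mu (upper_level f (expR (k%:R / 2))) + (expR (- (k%:R / 2)))%:E)%E.

Lemma lower_tail_ge0 k : (0 <= lower_tail k)%E.
Proof. by rewrite adde_ge0// lee_fin expR_ge0. Qed.

Lemma void_prob_ge_lower_tail m k : (0 < m)%N ->
  (1 <= void_prob mu m (rad m (- k%:R)) + lower_tail k)%E.
Proof.
move=> m0.
have := void_prob_ge mu f mf f0 dens (expR (k%:R / 2)) m (rad m (- k%:R))
  (expR_ge0 _) (vol_radius_gt0 _ _ _).
rewrite vol_radiusE// -expRD /lower_tail.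
by rewrite (_ : k%:R / 2 - k%:R = - (k%:R / 2) :> R)//; field.
Qed.

(** The layer-cake formula for 2 ln f, whose mu-integrability is the finiteness
    of the entropy. *)
Lemma lower_tail_sum : (\sum_(0 <= k <oo) lower_tail k < +oo)%E.
Proof.
rewrite nneseriesD//.
rewrite lte_add_pinfty//; last first.
  have := @geometric_expRN_sum R (1 / 2) 1 ltac:(lra) ltac:(lra).
  apply: le_lt_trans; rewrite le_eqVlt; apply/orP; left; apply/eqP.
  by apply: eq_eseriesr => k _; rewrite !mul1r mulrC.
have m2 : measurable_fun setT (fun x => 2 * ln (f x)) by exact: measurable_funM.
apply: (@le_lt_trans _ _ (\sum_(0 <= k <oo) mu [set x | k%:R < 2 * ln (f x)]%R)%E).
  apply: lee_nneseries => // k _; apply: le_measure; rewrite ?inE.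
  - exact: measurable_upper_level.
  - exact: measurable_gt_level.
  move=> x; rewrite /upper_level/= => fx.
  have x0 : 0 < f x by apply: lt_trans fx; exact: expR_gt0.
  have : k%:R / 2 < ln (f x) by rewrite -ltr_expR lnK.
  lra.
apply: (le_lt_trans (tail_sum_le mu _ m2)).
have /integrableP[_ fin] := integrable_ln_density.
apply: (@le_lt_trans _ _ (\int[mu]_x (2%:E * `|(ln (f x))%:E| + 1))%E).
  apply: ge0_le_integral => //.
  - by move=> x _; rewrite lee_fin le_max lexx.
  - by apply/measurable_EFinP; apply: measurable_maxr => //; exact: measurable_funD.
  - apply: emeasurable_funD => //; apply: emeasurable_funM => //.
    by apply: measurableT_comp => //; exact/measurable_EFinP.
  move=> x _; rewrite -EFinM -EFinD lee_fin ge_max.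
  have := ler_norm (ln (f x)); have := normr_ge0 (ln (f x)) => h1 h2.
  by apply/andP; split; lra.
have ma : measurable_fun setT (fun x => `|(ln (f x))%:E|%E).
  by apply: measurableT_comp => //; exact/measurable_EFinP.
rewrite ge0_integralD//; last exact: emeasurable_funM.
by rewrite integral_prob_cst ge0_integralZl// lte_add_pinfty ?ltry// lte_mul_pinfty.
Qed.

End entropy_tail.

(** * Independence of parts of the sample *)

Section independence_generators.
Context {dT dU} {T : measurableType dT} {U : measurableType dU} {R : realType}.
Variables (P : probability T R) (E : set T) (Y : T -> U) (G : set (set U)).
Hypotheses (mE : measurable E) (mY : measurable_fun setT Y).
Hypotheses (mG : @measurable _ U = <<s G >>) (GI : setI_closed G) (GT : G setT).

(** Both sides are finite measures in B that agree on a generating family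
    stable under intersection. *)
Lemma indep_generated :
  (forall B, G B -> P (E `&` Y @^-1` B) = P E * P (Y @^-1` B))%E ->
  forall B, measurable B -> P (E `&` Y @^-1` B) = (P E * P (Y @^-1` B))%E.
Proof.
move=> H B mB.
have PE : P E = (fine (P E))%:E by rewrite fineK// fin_num_measure.
have c0 : 0 <= fine (P E) by rewrite fine_ge0.
pose m1 := image_measure (mrestr P mE) mY.
pose m2 := mscale (NngNum c0) (image_measure P mY).
have H2 : m1 B = m2 B.
  apply: (measure_unique G (fun=> setT)) => //.
  - by apply/seteqP; split => // x _; exists 0%N.
  - move=> C GC.
    change (P (Y @^-1` C `&` E) = ((fine (P E))%:E * P (Y @^-1` C))%E).
    by rewrite setIC H// -PE.
  - move=> _; change (P (Y @^-1` [set: U] `&` E) < +oo)%E.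
    by rewrite preimage_setT setTI (le_lt_trans (probability_le1 _ _))// ltry.
rewrite PE setIC; exact: H2.
Qed.

End independence_generators.

Section tuple_boxes.
Context {dU} {U : measurableType dU} (n : nat).

Definition boxes : set (set (n.-tuple U)) :=
  [set C | exists2 B : 'I_n -> set U, (forall i, measurable (B i)) &
     C = [set y | forall i, B i (tnth y i)]].

Lemma measurable_boxes : @measurable _ (n.-tuple U) = <<s boxes >>.
Proof.
apply/seteqP; split; last first.
  apply: smallest_sub; first exact: sigma_algebra_measurable.
  by move=> _ [B mB ->]; exact: measurable_box.
move=> A mA.
suff H : measurable_fun setT (idfun : g_sigma_algebraType boxes -> n.-tuple U).
  by have := H measurableT A mA; rewrite setTI.
apply/measurable_fun_tnthP => i _ B mB; rewrite setTI.
apply: sub_sigma_algebra; exists (fun j => if j == i then B else setT).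
  by move=> j; case: ifP.
apply/seteqP; split => y /=; first by move=> yB j; case: eqP => // ->.
by move=> /(_ i); rewrite eqxx.
Qed.

Lemma boxes_setI : setI_closed boxes.
Proof.
move=> _ _ [B mB ->] [C mC ->]; exists (fun i => B i `&` C i).
  by move=> i; exact: measurableI.
apply/seteqP; split => y /=; first by move=> [yB yC] i.
by move=> H; split => i; have [] := H i.
Qed.

Lemma boxes_setT : boxes setT.
Proof. by exists (fun=> setT) => //; apply/seteqP; split. Qed.

End tuple_boxes.

(** Distributions are only defined for bundled measurable functions. *)
Definition mfun_of {d1 d2} {T : measurableType d1} {U : measurableType d2}
    {g : T -> U} (mg : measurable_fun setT g) : {mfun T >-> U} :=
  HB.pack g (isMeasurableFun.Build _ _ _ _ g mg).

Section indep_pair_law.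
Context {dT d1 d2} {T : measurableType dT} {U1 : measurableType d1}
  {U2 : measurableType d2} {R : realType}.
Variables (P : probability T R) (X : {mfun T >-> U1}) (Y : {mfun T >-> U2}).
Hypothesis indep : forall A B, measurable A -> measurable B ->
  P (X @^-1` A `&` Y @^-1` B) = (P (X @^-1` A) * P (Y @^-1` B))%E.

Let mXY : measurable_fun setT (fun w => (X w, Y w)).
Proof. by apply/measurable_fun_pairP; split. Qed.

Lemma indep_pair_law D : measurable D ->
  P [set w | D (X w, Y w)] = (distribution P X \x distribution P Y)%E D.
Proof.
move=> mD; apply/esym.
apply: (@product_measure_unique _ _ _ _ _ (distribution P X) (distribution P Y)
  (image_measure P mXY)) => //.
Qed.

(** Fubini's theorem for independent variables: conditioning on X amounts to
    freezing its value. *)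
Lemma indep_pair_sections D : measurable D ->
  P [set w | D (X w, Y w)] =
  (\int[distribution P X]_x P [set w | D (x, Y w)])%E.
Proof.
move=> mD; rewrite indep_pair_law//; apply: eq_integral => x _ /=.
rewrite /distribution /pushforward; congr (P _).
by apply/seteqP; split => w; rewrite /xsection/= inE.
Qed.

End indep_pair_law.

Section sample.
Context {R : realType} {d : nat} {dT} {T : measurableType dT} (P : probability T R).
Local Notation V := (vec R d).
Variable X : nat -> {RV P >-> V}.
Hypothesis hindep : mutually_independent X.
Variable mu : probability V R.
Hypothesis law : forall i A, measurable A -> P (X i @^-1` A) = mu A.
Implicit Types (s : seq nat) (i j : nat).

Lemma law_distribution i A : measurable A -> distribution P (X i) A = mu A.
Proof. exact: law. Qed.

Lemma prob_seq s (A : nat -> set V) : uniq s -> (forall i, measurable (A i)) ->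
  P [set w | forall i, i \in s -> A i (X i w)] = (\prod_(i <- s) mu (A i))%E.
Proof.
move=> us mA; pose J := (seq_fset tt s).
have JE i : (i \in J) = (i \in s) by rewrite seq_fsetE.
have := hindep J A mA.
rewrite (_ : \bigcap_(i in [set` J]) _ = [set w | forall i, i \in s -> A i (X i w)]).
  move=> ->; have Js : perm_eq J s.
    by rewrite -[X in perm_eq _ X](undup_id us); exact: seq_fset_perm.
  by rewrite (perm_big _ Js)/=; apply: eq_bigr => i _; exact: law.
apply/seteqP; split => w /= H i; first by rewrite -JE => /H.
by move=> iJ; apply: H; rewrite -JE.
Qed.

Lemma measurable_seq s (A : nat -> set V) : (forall i, measurable (A i)) ->
  measurable [set w | forall i, i \in s -> A i (X i w)].
Proof.
move=> mA; rewrite (_ : [set _ | _] = \bigcap_(i in [set` s]) (X i @^-1` A i)).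
  apply: fin_bigcap_measurable; first exact: finite_seq.
  by move=> i _; rewrite -[X in measurable X]setTI; exact: measurable_funP.
by apply/seteqP; split => w /= H i /H.
Qed.

Definition sub_sample s (w : T) : (size s).-tuple V :=
  [tuple (X (nth 0%N s k) w : V) | k < size s].

Lemma measurable_sub_sample s : measurable_fun setT (sub_sample s).
Proof.
apply/measurable_fun_tnthP => k.
rewrite (_ : _ \o _ = X (nth 0%N s k)); first exact: measurable_funP.
by apply/funext => w /=; rewrite tnth_mktuple.
Qed.

Definition sub_sample_mfun s := mfun_of (measurable_sub_sample s).

(* s has no repetition, so that constraints on the entries of the tuple are
   constraints on the variables themselves *)
Let box_event s (B : 'I_(size s) -> set V) : uniq s ->
  (forall k, measurable (B k)) -> exists A : nat -> set V,
  (forall i, measurable (A i)) /\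
  sub_sample s @^-1` [set y | forall k, B k (tnth y k)] =
  [set w | forall i, i \in s -> A i (X i w)].
Proof.
move=> us mB.
exists (fun i => if insub (index i s) is Some k then B k else setT); split.
  by move=> i; case: insubP.
apply/seteqP; split => w /= H.
  move=> i iS; rewrite insubT ?index_mem// => iS'.
  by have := H (Sub (index i s) iS'); rewrite tnth_mktuple/= nth_index.
move=> k; rewrite tnth_mktuple.
have := H (nth 0%N s k) (mem_nth _ (ltn_ord k)).
by rewrite index_uniq// insubT// => p; rewrite (_ : Sub _ _ = k)//; exact/val_inj.
Qed.

(** Independence from the whole tuple follows from independence from boxes,
    which is what mutual independence provides. *)
Lemma sub_sample_indep s (E : set T) : uniq s -> measurable E ->
  (forall A, (forall i, measurable (A i)) ->
    P (E `&` [set w | forall i, i \in s -> A i (X i w)]) =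
    (P E * P [set w | forall i, i \in s -> A i (X i w)])%E) ->
  forall B, measurable B ->
    P (E `&` sub_sample s @^-1` B) = (P E * P (sub_sample s @^-1` B))%E.
Proof.
move=> us mE H; apply: (indep_generated P E (sub_sample s) (boxes (size s))) => //.
- exact: measurable_sub_sample.
- exact: measurable_boxes.
- exact: boxes_setI.
- exact: boxes_setT.
by move=> _ [B mB ->]; have [A [mA ->]] := box_event s B us mB; exact: H.
Qed.

Lemma indep_one s i : uniq (i :: s) ->
  forall A B, measurable A -> measurable B ->
  P (X i @^-1` A `&` sub_sample_mfun s @^-1` B) =
  (P (X i @^-1` A) * P (sub_sample_mfun s @^-1` B))%E.
Proof.
move=> /=/andP[iS us] A B mA mB; apply: sub_sample_indep => //.
  by rewrite -[X in measurable X]setTI; exact: measurable_funP.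
move=> C mC.
pose D k := if k == i then A else C k.
have := prob_seq (i :: s) D; rewrite /= iS us => /(_ isT) H.
have mD k : measurable (D k) by rewrite /D; case: ifP.
have {}H := H mD.
rewrite (_ : _ `&` _ = [set w | forall k, k \in i :: s -> D k (X k w)]).
  rewrite H big_cons /D eqxx law//; congr (_ * _)%E.
  rewrite prob_seq//; apply: eq_big_seq => k ks.
  by rewrite ifN//; apply: contraNneq iS => <-.
apply/seteqP; split => w /=.
  move=> [Aw Cw] k; rewrite inE /D; case: eqP => [->//|_ /=]; exact: Cw.
move=> Hw; split; first by have := Hw i; rewrite inE eqxx /D eqxx; exact.
move=> k ks; have := Hw k; rewrite inE ks orbT /D ifN; first by exact.
by apply: contraNneq iS => <-.
Qed.

Let mpair i j : measurable_fun setT (fun w => (X i w, X j w)).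
Proof. by apply/measurable_fun_pairP; split; exact: measurable_funP. Qed.

Definition pair_mfun i j := mfun_of (mpair i j).

Lemma indep_pair i j : i != j ->
  forall A B, measurable A -> measurable B ->
  P (X i @^-1` A `&` X j @^-1` B) = (P (X i @^-1` A) * P (X j @^-1` B))%E.
Proof.
move=> ij A B mA mB; pose D k := if k == i then A else B.
have mD k : measurable (D k) by rewrite /D; case: ifP.
have := prob_seq [:: i; j] D; rewrite /= inE ij => /(_ isT mD).
rewrite !big_cons big_nil mule1 /D eqxx eq_sym (negbTE ij) !law// => <-.
congr (P _); apply/seteqP; split => w /=.
  move=> [Aw Bw] k; rewrite !inE => /orP[/eqP ->|/eqP ->]; first by rewrite eqxx.
  by rewrite eq_sym (negbTE ij).
move=> H; split; first by have := H i; rewrite !inE !eqxx; exact.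
by have := H j; rewrite !inE eqxx orbT eq_sym (negbTE ij); exact.
Qed.

Lemma law_pair i j D : i != j -> measurable D ->
  distribution P (pair_mfun i j) D = (mu \x mu)%E D.
Proof.
move=> ij mD.
rewrite -[LHS]/(P [set w | D (X i w, X j w)]) (indep_pair_law _ _ _ (indep_pair i j ij))//.
apply: (@product_measure_unique _ _ _ _ _ (distribution P (X i)) (distribution P (X j))
  (mu \x mu)%E) => //.
move=> A B mA mB.
change ((mu \x mu)%E (A `*` B) = (distribution P (X i) A * distribution P (X j) B)%E).
by rewrite product_measure1E// !law_distribution.
Qed.

Lemma indep_two s i j : uniq [:: i, j & s] ->
  forall A B, measurable A -> measurable B ->
  P (pair_mfun i j @^-1` A `&` sub_sample_mfun s @^-1` B) =
  (P (pair_mfun i j @^-1` A) * P (sub_sample_mfun s @^-1` B))%E.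
Proof.
move=> u A B mA mB; have := u; rewrite /= inE negb_or => /andP[/andP[ij iS] /andP[jS us]].
pose G : set (set (V * V)) := [set A1 `*` A2 | A1 in measurable & A2 in measurable].
pose E := sub_sample s @^-1` B.
have mE : measurable E.
  by rewrite -[X in measurable X]setTI; exact: measurable_sub_sample.
have H : forall C, measurable C -> P (E `&` pair_mfun i j @^-1` C) =
    (P E * P (pair_mfun i j @^-1` C))%E.
  apply: (indep_generated P E (pair_mfun i j) G) => //.
  - exact: measurable_prod_measurableType.
  - move=> _ _ [A1 mA1 [A2 mA2 <-]] [B1 mB1 [B2 mB2 <-]].
    exists (A1 `&` B1); first exact: measurableI.
    by exists (A2 `&` B2); [exact: measurableI|rewrite setXI].
  - by exists setT => //; exists setT => //; rewrite setXTT.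
  move=> _ [A1 mA1 [A2 mA2 <-]]; rewrite setIC muleC.
  apply: (sub_sample_indep s (pair_mfun i j @^-1` (A1 `*` A2))) => //.
    rewrite -[X in measurable X]setTI; apply: measurable_funP => //.
    exact: measurableX.
  move=> C mC.
  pose D k := if k == i then A1 else if k == j then A2 else C k.
  have mD k : measurable (D k) by rewrite /D; case: ifP => _ //; case: ifP.
  have := prob_seq [:: i, j & s] D u mD.
  rewrite !big_cons /D eqxx eq_sym (negbTE ij) !eqxx => HD.
  transitivity (P [set w | forall k, k \in [:: i, j & s] -> D k (X k w)]).
    congr (P _); apply/seteqP; split => w /=.
      move=> [[A1w A2w] Cw] k; rewrite !inE /D.
      by case: eqP => [->//|_]; case: eqP => [->//|_ /=]; exact: Cw.
    move=> Hw; split; first split.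
    - by have := Hw i; rewrite !inE eqxx /D eqxx; exact.
    - by have := Hw j; rewrite !inE eqxx orbT /D eqxx eq_sym (negbTE ij); exact.
    - move=> k ks; have := Hw k; rewrite !inE ks !orbT /D ifN ?ifN; first by exact.
        by apply: contraNneq jS => <-.
      by apply: contraNneq iS => <-.
  rewrite /D HD muleA; congr (_ * _)%E.
    rewrite -[RHS]/(P (X i @^-1` A1 `&` X j @^-1` A2)).
    by rewrite (indep_pair i j ij)// !law.
  rewrite prob_seq//; apply: eq_big_seq => k ks.
  rewrite ifN ?ifN//; first by apply: contraNneq jS => <-.
  by apply: contraNneq iS => <-.
by rewrite setIC muleC; exact: H.
Qed.

End sample.

Section sample_void.
Context {R : realType} {d : nat} {dT} {T : measurableType dT} (P : probability T R).
Local Notation V := (vec R d).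
Variable X : nat -> {RV P >-> V}.
Hypothesis hindep : mutually_independent X.
Variable mu : probability V R.
Hypothesis law : forall i A, measurable A -> P (X i @^-1` A) = mu A.
Implicit Types (s : seq nat) (r : R) (i j : nat).
Local Notation b := (ball_mass mu).

Definition void_event i s r : set T :=
  [set w | forall j, j \in s -> r < vdist (X i w) (X j w)].

Let measurable_gt_dist dU (U : measurableType dU) (g h : U -> V) r :
  measurable_fun setT g -> measurable_fun setT h ->
  measurable [set u | r < vdist (g u) (h u)].
Proof.
move=> mg mh; exact: (measurable_gt_level _ _ (measurable_vdist _ _ _ _ mg mh)).
Qed.

Lemma measurable_void_event i s r : measurable (void_event i s r).
Proof.
rewrite (_ : void_event i s r = \bigcap_(j in [set` s])
    [set w | r < vdist (X i w) (X j w)]).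
  apply: fin_bigcap_measurable; first exact: finite_seq.
  by move=> j _; apply: measurable_gt_dist; exact: measurable_funP.
by apply/seteqP; split => w /= H j /H.
Qed.

Let eq_law (i : nat) (h : V -> \bar R) :
  (\int[distribution P (X i)]_x h x = \int[mu]_x h x)%E.
Proof. by apply: eq_measure_integral => A mA _; exact: law. Qed.

Let measurable_void_tuple dU (U : measurableType dU) n r (g : U -> V) (h : U -> n.-tuple V) :
  measurable_fun setT g -> measurable_fun setT h ->
  measurable [set u | forall k : 'I_n, r < vdist (g u) (tnth (h u) k)].
Proof.
move=> mg mh; rewrite (_ : [set u | _] = \bigcap_(k in [set: 'I_n])
    [set u | r < vdist (g u) (tnth (h u) k)]).
  apply: fin_bigcap_measurable => // k _; apply: measurable_gt_dist => //.
  exact: (measurableT_comp (measurable_tnth k) mh).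
by apply/seteqP; split => u /= H k; [move=> _; exact: H|exact: H].
Qed.

Let sub_sampleP s w (Q : V -> Prop) :
  (forall k : 'I_(size s), Q (tnth (sub_sample P X s w) k)) <->
  (forall j, j \in s -> Q (X j w)).
Proof.
split => [H j js|H k]; last by rewrite tnth_mktuple; apply: H; exact: mem_nth.
have js' : (index j s < size s)%N by rewrite index_mem.
by have := H (Ordinal js'); rewrite tnth_mktuple/= nth_index.
Qed.

Lemma prob_all_outside s x r : uniq s ->
  P [set w | forall j, j \in s -> r < vdist x (X j w)] =
  ((1 - b r x) ^+ size s)%:E.
Proof.
move=> us; have mB := measurable_cball x r.
have := prob_seq P X hindep mu law s (fun=> ~` cball x r) us (fun=> measurableC mB).
rewrite (_ : [set w | _] = [set w | forall j, j \in s -> r < vdist x (X j w)]).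
  move=> ->; rewrite (eq_bigr (fun=> (1 - b r x)%:E)); last first.
    by move=> j _; rewrite probability_setC// EFinB -ball_massE.
  by rewrite prodEFin big_const_seq count_predT iter_mulr_1.
apply/seteqP; split => w /= H j js.
  by have := H j js; rewrite /cball/= => /negP; rewrite -ltNge.
by rewrite /cball/=; apply/negP; rewrite -ltNge; exact: H.
Qed.

Lemma prob_void_event i s r : uniq (i :: s) ->
  P (void_event i s r) = void_prob mu (size s) r.
Proof.
move=> u; have us : uniq s by case/andP: u.
pose D : set (V * (size s).-tuple V) :=
  [set p | forall k, r < vdist p.1 (tnth p.2 k)].
have mD : measurable D.
  by apply: measurable_void_tuple; [exact: measurable_fst|exact: measurable_snd].
have := indep_pair_sections P (X i) (sub_sample_mfun P X s)
  (indep_one P X hindep mu law s i u) D mD.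
rewrite (_ : [set w | _] = void_event i s r); last first.
  by apply/seteqP; split => w; [
    exact: (sub_sampleP s w (fun y => r < vdist (X i w) y)).1|
    exact: (sub_sampleP s w (fun y => r < vdist (X i w) y)).2].
move=> ->; rewrite eq_law; apply: eq_integral => x _.
rewrite -prob_all_outside//; congr (P _).
by apply/seteqP; split => w; [
  exact: (sub_sampleP s w (fun y => r < vdist x y)).1|
  exact: (sub_sampleP s w (fun y => r < vdist x y)).2].
Qed.

Lemma prob_close i j r : i != j ->
  P [set w | vdist (X i w) (X j w) <= r] = (\int[mu]_x (b r x)%:E)%E.
Proof.
move=> ij.
have := indep_pair_sections P (X i) (X j) (indep_pair P X hindep mu law i j ij)
  (near_pairs r) (measurable_le_dist r).
rewrite (_ : [set w | _] = [set w | vdist (X i w) (X j w) <= r])// => ->.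
rewrite eq_law; apply: eq_integral => x _; rewrite -ball_massE -(law j)//.
exact: measurable_cball.
Qed.

(** Either X i and X j are within 2r, which has the first probability, or their
    r-balls are disjoint.  In the second case, given X i = x and X j = y, the
    probability that all other points avoid both balls is
    (1 - b(x) - b(y))^size s <= (1 - b(x))^size s (1 - b(y))^size s, and x, y
    are independent. *)
Lemma prob_two_void_events i j s r : uniq [:: i, j & s] ->
  (P (void_event i s r `&` void_event j s r) <=
   (\int[mu]_x (b (2 * r) x)%:E) + void_prob mu (size s) r * void_prob mu (size s) r)%E.
Proof.
move=> u; have := u; rewrite /= inE negb_or => /andP[/andP[ij iS] /andP[jS us]].
rewrite -(prob_close i j (2 * r) ij).
pose D : set ((V * V) * (size s).-tuple V) :=
  [set p | 2 * r < vdist p.1.1 p.1.2] `&`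
  ([set p | forall k, r < vdist p.1.1 (tnth p.2 k)] `&`
   [set p | forall k, r < vdist p.1.2 (tnth p.2 k)]).
have m11 : measurable_fun setT (fun p : (V * V) * (size s).-tuple V => p.1.1).
  exact: (measurableT_comp measurable_fst measurable_fst).
have m12 : measurable_fun setT (fun p : (V * V) * (size s).-tuple V => p.1.2).
  exact: (measurableT_comp measurable_snd measurable_fst).
have m2 : measurable_fun setT (fun p : (V * V) * (size s).-tuple V => p.2).
  exact: measurable_snd.
have mD : measurable D.
  apply: measurableI; first exact: measurable_gt_dist.
  by apply: measurableI; exact: measurable_void_tuple.
have mC : measurable [set w | vdist (X i w) (X j w) <= 2 * r].
  rewrite (_ : [set w | _] = ~` [set w | 2 * r < vdist (X i w) (X j w)]).
    by apply: measurableC; apply: measurable_gt_dist; exact: measurable_funP.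
  by apply/seteqP; split => w /=; rewrite leNgt => /negP.
pose E := [set w | D ((X i w, X j w), sub_sample P X s w)].
have mE : measurable E.
  have m : measurable_fun setT (fun w => ((X i w, X j w), sub_sample P X s w)).
    apply/measurable_fun_pairP; split; last exact: measurable_sub_sample.
    by apply/measurable_fun_pairP; split; exact: measurable_funP.
  by have := m measurableT _ mD; rewrite setTI.
apply: (@le_trans _ _ (P ([set w | vdist (X i w) (X j w) <= 2 * r] `|` E))).
  apply: le_measure; rewrite ?inE.
  - by apply: measurableI; exact: measurable_void_event.
  - exact: measurableU.
  - move=> w [wi wj]; have [c|c] := leP (vdist (X i w) (X j w)) (2 * r); [by left|right].
    split => //; split.
      exact: (sub_sampleP s w (fun y => r < vdist (X i w) y)).2.
    exact: (sub_sampleP s w (fun y => r < vdist (X j w) y)).2.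
suff H : (P E <= void_prob mu (size s) r * void_prob mu (size s) r)%E.
  exact: (le_trans (measureU2 _ mC mE) (leeD2l _ H)).
have -> : P E = (\int[distribution P (pair_mfun P X i j)]_z
    P [set w | D (z, sub_sample_mfun P X s w)])%E.
  exact: (indep_pair_sections P (pair_mfun P X i j) (sub_sample_mfun P X s)
    (indep_two P X hindep mu law s i j u) D mD).
rewrite (eq_measure_integral (mu \x mu)%E); last first.
  by move=> A mA _; exact: (law_pair P X hindep mu law i j A ij mA).
pose g x : R := (1 - b r x) ^+ size s.
have mg : measurable_fun setT g by exact: measurable_void.
have mg1 : measurable_fun setT (fun p : V * V => g p.1).
  exact: (measurableT_comp mg measurable_fst).
have mg2 : measurable_fun setT (fun p : V * V => g p.2).
  exact: (measurableT_comp mg measurable_snd).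
have g0 x : 0 <= g x by exact: void_ge0.
apply: (@le_trans _ _ (\int[mu \x mu]_p (g p.1 * g p.2)%:E)%E); last first.
  rewrite fubini_tonelli1; last 2 first.
  - by apply/measurable_EFinP; exact: measurable_funM.
  - by move=> p; rewrite lee_fin mulr_ge0.
  rewrite /fubini_F/= le_eqVlt; apply/orP; left; apply/eqP.
  rewrite -ge0_integralZr//.
  - apply: eq_integral => x _; under eq_integral do rewrite EFinM.
    rewrite ge0_integralZl//.
    + by apply/measurable_EFinP.
    + by move=> y _; rewrite lee_fin.
    + by rewrite lee_fin.
  - by apply/measurable_EFinP.
  - by move=> x _; rewrite lee_fin void_ge0.
  - exact: void_prob_ge0.
apply: ge0_le_integral => //.
- have := measurable_fun_xsection (distribution P (sub_sample_mfun P X s)) mD.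
  congr (measurable_fun _ _); apply/funext => x /=.
  rewrite /distribution /pushforward; congr (P _).
  by apply/seteqP; split => w; rewrite /xsection/= inE.
- by apply/measurable_EFinP; exact: measurable_funM.
move=> [x y] _ /=.
have [xy|xy] := leP (vdist x y) (2 * r).
  rewrite (_ : [set w | _] = set0) ?measure0 ?lee_fin ?mulr_ge0//.
  by apply/seteqP; split => // w [] /=; rewrite ltNge xy.
have mBx := measurable_cball x r; have mBy := measurable_cball y r.
have xy0 : cball x r `&` cball y r = set0.
  apply/seteqP; split => // z []; rewrite /cball/= => xz yz.
  have := vdist_triangle z x y; rewrite [vdist z y]vdistC; lra.
have mU : measurable (~` (cball x r `|` cball y r)).
  by apply: measurableC; exact: measurableU.
apply: (@le_trans _ _ (P [set w | forall k, k \in s ->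
    (~` (cball x r `|` cball y r)) (X k w)])).
  apply: le_measure; rewrite ?inE.
  - have m : measurable_fun setT (fun w => ((x, y), sub_sample P X s w)).
      apply/measurable_fun_pairP; split; first exact: measurable_cst.
      exact: measurable_sub_sample.
    by have := m measurableT _ mD; rewrite setTI.
  - exact: (measurable_seq P X s (fun=> ~` (cball x r `|` cball y r)) (fun=> mU)).
  - move=> w [_ [/(sub_sampleP s w (fun z => r < vdist x z)) Hx
      /(sub_sampleP s w (fun z => r < vdist y z)) Hy]] k ks.
    rewrite /cball/= => -[]; [have := Hx _ ks|have := Hy _ ks] => /=.
      by move=> /lt_le_trans /[apply]; rewrite ltxx.
    by move=> /lt_le_trans /[apply]; rewrite ltxx.
rewrite (prob_seq P X hindep mu law s (fun=> ~` (cball x r `|` cball y r)) us (fun=> mU)).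
rewrite (eq_bigr (fun=> (1 - (b r x + b r y))%:E)); last first.
  move=> j0 _; rewrite probability_setC//; last exact: measurableU.
  rewrite EFinB; congr (_ - _)%E.
  by rewrite EFinD -!ball_massE -measureU.
rewrite prodEFin big_const_seq count_predT iter_mulr_1 lee_fin /g -exprMn.
have [bx0 by0] := (ball_mass_ge0 mu r x, ball_mass_ge0 mu r y).
have [bx1 by1] := (ball_mass_le1 mu r x, ball_mass_le1 mu r y).
have bxy : b r x + b r y <= 1.
  rewrite -lee_fin EFinD -!ball_massE -measureU//.
  by apply: probability_le1; exact: measurableU.
apply: lerXn2r; rewrite ?nnegrE ?subr_ge0 ?mulr_ge0 ?subr_ge0//.
have := mulr_ge0 bx0 by0; lra.
Qed.

End sample_void.

(** * Proportions and means *)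

(** The n+1 diagonal terms are at most 1, and their share is 1/(n+1). *)
Lemma second_moment_le {R : realType} n (p : 'I_n.+1 -> 'I_n.+1 -> R) (c : R) :
  0 <= c -> (forall i, p i i <= 1) -> (forall i j, i != j -> p i j <= c) ->
  n.+1%:R^-1 ^+ 2 * \sum_(i < n.+1) \sum_(j < n.+1) p i j <= n.+1%:R^-1 + c.
Proof.
move=> c0 p1 pc.
have N0 : 0 < n.+1%:R :> R by rewrite ltr0n.
have H : \sum_(i < n.+1) \sum_(j < n.+1) p i j <= n.+1%:R * (1 + n.+1%:R * c).
  apply: (@le_trans _ _ (\sum_(i < n.+1) (1 + \sum_(j < n.+1) c))).
    apply: ler_sum => i _; rewrite (bigD1 i)//=; apply: lerD => //.
    rewrite [leRHS](bigD1 i)//= ler_wpDl//; apply: ler_sum => j ji.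
    by apply: pc; rewrite eq_sym.
  by rewrite !sumr_const card_ord -[c *+ _]mulr_natl -[(_ + _) *+ _]mulr_natl.
apply: le_trans (ler_wpM2l (sqr_ge0 _) H) _.
move: (n.+1%:R : R) N0 => N N0.
by rewrite le_eqVlt; apply/orP; left; apply/eqP; field; rewrite gt_eqF.
Qed.

Section empirical_frequency.
Context {dT} {T : measurableType dT} {R : realType} (P : probability T R).
Variables (n : nat) (A : 'I_n.+1 -> set T).
Hypothesis mA : forall i, measurable (A i).

Definition frequency (w : T) : R := n.+1%:R^-1 * \sum_(i < n.+1) \1_(A i) w.

Lemma frequency_ge0 w : 0 <= frequency w.
Proof. by rewrite mulr_ge0// sumr_ge0. Qed.

Lemma measurable_frequency : measurable_fun setT frequency.
Proof.
apply: measurable_funM => //; apply: measurable_sum => i.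
exact: measurable_indic.
Qed.

Let N0 : 0 < n.+1%:R :> R. Proof. by rewrite ltr0n. Qed.

Lemma integral_frequency :
  (\int[P]_w (frequency w)%:E = (n.+1%:R^-1)%:E * \sum_(i < n.+1) P (A i))%E.
Proof.
under eq_integral do rewrite EFinM -sumEFin.
rewrite ge0_integralZl//; last first.
- by move=> w _; rewrite sumEFin lee_fin sumr_ge0.
- by apply: emeasurable_sum => i; apply/measurable_EFinP; exact: measurable_indic.
congr (_ * _)%E; rewrite ge0_integral_sum//.
- by apply: eq_bigr => i _; rewrite integral_indic// setIT.
- by move=> i; apply/measurable_EFinP; exact: measurable_indic.
Qed.

Lemma integral_frequency_sqr :
  (\int[P]_w (frequency w ^+ 2)%:E =
   (n.+1%:R^-1 ^+ 2)%:E * \sum_(i < n.+1) \sum_(j < n.+1) P (A i `&` A j))%E.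
Proof.
have mI i j : measurable (A i `&` A j) by exact: measurableI.
transitivity (\int[P]_w ((n.+1%:R^-1 ^+ 2)%:E *
    \sum_(i < n.+1) \sum_(j < n.+1) (\1_(A i `&` A j) w)%:E))%E.
  apply: eq_integral => w _; rewrite /frequency exprMn EFinM; congr (_ * _)%E.
  rewrite expr2 mulr_suml -sumEFin; apply: eq_bigr => i _.
  rewrite mulr_sumr -sumEFin; apply: eq_bigr => j _.
  by rewrite !indicE in_setI -mulnb natrM.
rewrite ge0_integralZl//; last 2 first.
- apply: emeasurable_sum => i; apply: emeasurable_sum => j.
  by apply/measurable_EFinP; exact: measurable_indic.
- by move=> w _; apply: sume_ge0 => i _; apply: sume_ge0.
congr (_ * _)%E; rewrite ge0_integral_sum//.
- apply: eq_bigr => i _; rewrite ge0_integral_sum//.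
    by apply: eq_bigr => j _; rewrite integral_indic// setIT.
  by move=> j; apply/measurable_EFinP; exact: measurable_indic.
- move=> i; apply: emeasurable_sum => j.
  by apply/measurable_EFinP; exact: measurable_indic.
- by move=> i w _; apply: sume_ge0.
Qed.

(** From |y| <= e + y^2/e with y = frequency - g, it suffices to bound the
    second moment of y.  Lower bounds on the probabilities and upper bounds on
    those of the pairs suffice, as 2 g E(frequency) is subtracted. *)
Lemma frequency_L1 (g delta e : R) : 0 <= g -> g <= 1 -> 0 <= delta -> 0 < e ->
  (forall i, (g%:E <= P (A i) + delta%:E)%E) ->
  (forall i j, i != j -> (P (A i `&` A j) <= (g ^+ 2 + delta)%:E)%E) ->
  (\int[P]_w `|frequency w - g|%:E <= (e + (n.+1%:R^-1 + 3 * delta) / e)%:E)%E.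
Proof.
move=> g0 g1 d0 e0 H1 H2.
have mF := measurable_frequency.
have mD : measurable_fun setT (fun w => `|frequency w - g|).
  by apply: measurableT_comp => //; exact: measurable_funB.
have pf (C : set T) : measurable C -> P C = (fine (P C))%:E.
  by move=> mC; rewrite fineK// fin_num_measure.
have F1 : (\int[P]_w (frequency w)%:E = (n.+1%:R^-1 * \sum_(i < n.+1) fine (P (A i)))%:E)%E.
  rewrite integral_frequency EFinM -sumEFin; congr (_ * _)%E.
  by apply: eq_bigr => i _; exact: pf.
have F2 : (\int[P]_w (frequency w ^+ 2)%:E = (n.+1%:R^-1 ^+ 2 *
    \sum_(i < n.+1) \sum_(j < n.+1) fine (P (A i `&` A j)))%:E)%E.
  rewrite integral_frequency_sqr [RHS]EFinM -sumEFin; congr (_ * _)%E.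
  apply: eq_bigr => i _; rewrite -sumEFin; apply: eq_bigr => j _.
  by apply: pf; exact: measurableI.
set f1 := (X in _ = X%:E) in F1; set f2 := (X in _ = X%:E) in F2.
have f1g : g - delta <= f1.
  rewrite /f1 -(ler_pM2l N0) mulrA divff ?gt_eqF// mul1r.
  rewrite -[n.+1 in leLHS]card_ord mulr_natl -sumr_const.
  by apply: ler_sum => i _; rewrite lerBlDr -lee_fin EFinD -pf.
have f2g : f2 <= n.+1%:R^-1 + (g ^+ 2 + delta).
  apply: second_moment_le => [|i|i j ij].
  - by rewrite addr_ge0// sqr_ge0.
  - by rewrite -lee_fin -pf ?probability_le1//; exact: measurableI.
  - by rewrite -lee_fin -pf ?H2//; exact: measurableI.
have key : (\int[P]_w `|frequency w - g|%:E + (2 * g / e)%:E * f1%:E <=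
    e%:E + (e^-1)%:E * (f2%:E + (g ^+ 2)%:E))%E.
  have m1 : measurable_fun setT (fun w => (frequency w)%:E) by exact/measurable_EFinP.
  have m2 : measurable_fun setT (fun w => (frequency w ^+ 2)%:E).
    by apply/measurable_EFinP; exact: measurable_funX.
  have ge0 : 0 <= 2 * g / e by rewrite divr_ge0 ?mulr_ge0// ltW.
  have ei0 : 0 <= e^-1 by rewrite invr_ge0 ltW.
  have F0 w : (0 <= (frequency w)%:E)%E by rewrite lee_fin frequency_ge0.
  have F20 w : (0 <= (frequency w ^+ 2)%:E)%E by rewrite lee_fin sqr_ge0.
  have g20 : (0 <= (g ^+ 2)%:E)%E by rewrite lee_fin sqr_ge0.
  have ge0E : (0 <= (2 * g / e)%:E)%E by rewrite lee_fin.
  have ei0E : (0 <= (e^-1)%:E)%E by rewrite lee_fin.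
  have e0E : (0 <= e%:E)%E by rewrite lee_fin ltW.
  have s0 w : (0 <= (frequency w ^+ 2)%:E + (g ^+ 2)%:E)%E by rewrite adde_ge0.
  have es0 w : (0 <= (e^-1)%:E * ((frequency w ^+ 2)%:E + (g ^+ 2)%:E))%E by rewrite mule_ge0.
  have gs0 w : (0 <= (2 * g / e)%:E * (frequency w)%:E)%E by rewrite mule_ge0.
  have D0 w : (0 <= `|frequency w - g|%:E)%E by rewrite lee_fin.
  have DG0 w : (0 <= `|frequency w - g|%:E + (2 * g / e)%:E * (frequency w)%:E)%E.
    by rewrite adde_ge0.
  have ms : measurable_fun setT (fun w => (frequency w ^+ 2)%:E + (g ^+ 2)%:E)%E.
    exact: emeasurable_funD.
  have mes : measurable_fun setT
      (fun w => (e^-1)%:E * ((frequency w ^+ 2)%:E + (g ^+ 2)%:E))%E.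
    exact: emeasurable_funM.
  have mgs : measurable_fun setT (fun w => (2 * g / e)%:E * (frequency w)%:E)%E.
    exact: emeasurable_funM.
  have mDE : measurable_fun setT (fun w => `|frequency w - g|%:E).
    exact/measurable_EFinP.
  rewrite -F1 -F2 -(integral_prob_cst P (g ^+ 2)) -[in leRHS]ge0_integralD//.
  rewrite -[in leLHS]ge0_integralZl// -[in leRHS]ge0_integralZl//.
  rewrite -(integral_prob_cst P e) -[leLHS]ge0_integralD// -[leRHS]ge0_integralD//.
  apply: ge0_le_integral => //.
  - exact: emeasurable_funD.
  - exact: emeasurable_funD.
  move=> w _; rewrite -?EFinM -?EFinD -?EFinM -?EFinD lee_fin.
  set F := frequency w; set y := `|F - g|.
  have y2 : y ^+ 2 = F ^+ 2 - 2 * g * F + g ^+ 2.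
    by rewrite /y real_normK ?num_real//; ring.
  have E : e^-1 * y ^+ 2 = e^-1 * (F ^+ 2 + g ^+ 2) - 2 * g / e * F by rewrite y2; ring.
  have : y <= e + e^-1 * y ^+ 2.
    rewrite -(ler_pM2l e0) mulrDr mulrA divff ?gt_eqF// mul1r.
    by have := sqr_ge0 (y - e); have := sqr_ge0 y; have := sqr_ge0 e; rewrite sqrrB; nra.
  rewrite E; lra.
have {}key : (\int[P]_w `|frequency w - g|%:E + (2 * g / e * f1)%:E <=
    (e + e^-1 * (f2 + g ^+ 2))%:E)%E by exact: key.
have ge0 : 0 <= 2 * g / e by rewrite divr_ge0 ?mulr_ge0// ltW.
have f10 : 0 <= f1.
  by apply: mulr_ge0 => //; apply: sumr_ge0 => i _; exact: fine_ge0.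
have Ifin : (\int[P]_w `|frequency w - g|%:E)%E \is a fin_num.
  rewrite ge0_fin_numE ?integral_ge0//.
  have h : (0 <= (2 * g / e * f1)%:E)%E by rewrite lee_fin mulr_ge0.
  by apply: le_lt_trans (leeDl _ h) (le_lt_trans key _); rewrite ltry.
move: key; rewrite -(fineK Ifin) -EFinD !lee_fin => key.
have h1 : 2 * g / e * (g - delta) <= 2 * g / e * f1.
  exact: ler_wpM2l.
have h2 : e^-1 * (f2 + g ^+ 2) <= e^-1 * (n.+1%:R^-1 + (g ^+ 2 + delta) + g ^+ 2).
  by apply: ler_wpM2l; [rewrite invr_ge0 ltW|rewrite lerD2r].
have E : e^-1 * (n.+1%:R^-1 + (g ^+ 2 + delta) + g ^+ 2) - 2 * g / e * (g - delta) =
  (n.+1%:R^-1 + (1 + 2 * g) * delta) / e by ring.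
have h3 : (n.+1%:R^-1 + (1 + 2 * g) * delta) / e <= (n.+1%:R^-1 + 3 * delta) / e.
  rewrite ler_pM2r ?invr_gt0// lerD2l ler_wpM2r//; lra.
rewrite -E in h3.
rewrite -lerBrDr -addrA in key.
by apply: (le_trans key); rewrite lerD2l; apply: le_trans h3; exact: lerB.
Qed.

End empirical_frequency.

Section levels.
Context {R : realType}.

(** In the second case, which occurs when a point is repeated in the sample, the
    right-hand side is infinite. *)
Lemma levels_approx (N M : nat) (z : R) (c : R -> bool) : (0 < N)%N ->
  (forall s, c s = (s < z)) \/ (forall s, c s = false) ->
  (`|z - (- M%:R + N%:R^-1 * \sum_(k < 2 * M * N) (c (- M%:R + k%:R / N%:R))%:R)|%:E <=
   (N%:R^-1)%:E + \sum_(M <= k <oo) ((c k%:R)%:R + (~~ c (- k%:R))%:R : R)%:E)%E.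
Proof.
move=> N0 [cE|c0].
  apply: (@le_trans _ _ (N%:R^-1 + Num.max 0 (`|z| - M%:R))%:E).
    have := step_approx z N M N0; rewrite distrC lee_fin.
    by under eq_bigr do rewrite -cE.
  rewrite EFinD; apply: leeD2l; apply: le_trans (tail_excess z M) _.
  apply: lee_nneseries => [k _ _|k _]; first by rewrite lee_fin addr_ge0.
  by rewrite !cE -leNgt.
rewrite big1 => [|k _]; last by rewrite c0.
rewrite mulr0 addr0; set y := `|_|; pose n := (Num.truncn y).+1.
apply: (@le_trans _ _ (\sum_(M <= k < n + M) 1%:E)%E).
  rewrite -[X in \sum_(X <= _ < _) _]add0n big_addn addnK big_mkord sumEFin lee_fin.
  by rewrite sumr_const card_ord ltW// truncnS_gt.
apply: (@le_trans _ _ (\sum_(M <= k <oo) ((c k%:R)%:R + (~~ c (- k%:R))%:R : R)%:E)%E).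
  apply: le_trans (nneseries_lim_ge (n + M) _); last first.
    by move=> k _ _; rewrite lee_fin addr_ge0.
  by apply: lee_sum => k _; rewrite !c0 /= add0r.
by rewrite leeDr// lee_fin invr_ge0.
Qed.

Context {dT} {T : measurableType dT}.
Variable P : probability T R.
Variables (Z : T -> R) (A : R -> set T).
Hypothesis mZ : measurable_fun setT Z.
Hypothesis mA : forall s, measurable (A s).
Hypothesis AZ : forall w, (forall s, A s w <-> s < Z w) \/ (forall s, ~ A s w).

(** The integral from -M to M of the indicator of the events A s, minus M,
    discretised with mesh 1/N: this is Z cut to [-M, M] and rounded, when A s is
    the event s < Z. *)
Definition levels (N M : nat) (w : T) : R :=
  - M%:R + N%:R^-1 * \sum_(k < 2 * M * N) \1_(A (- M%:R + k%:R / N%:R)) w.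

Lemma measurable_levels N M : measurable_fun setT (levels N M).
Proof.
apply: measurable_funD => //; apply: measurable_funM => //.
by apply: measurable_sum => k; exact: measurable_indic.
Qed.

Lemma levels_L1 N M : (0 < N)%N ->
  (\int[P]_w `|Z w - levels N M w|%:E <=
   (N%:R^-1)%:E + \sum_(M <= k <oo) (P (A k%:R) + P (~` A (- k%:R))))%E.
Proof.
move=> N0.
have mi (C : set T) : measurable C -> measurable_fun setT (\1_C : T -> R).
  by move=> mC; exact: measurable_indic.
pose g (k : nat) w : \bar R := (\1_(A k%:R) w + \1_(~` A (- k%:R)) w)%:E.
have g0 k w : (0 <= g k w)%E by rewrite lee_fin addr_ge0.
have mg k : measurable_fun setT (g k).
  apply/measurable_EFinP; apply: measurable_funD; apply: mi => //.
  exact: measurableC.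
have tailE (u : nat -> \bar R) : (\sum_(M <= k <oo) u k =
    \sum_(0 <= k <oo) (if (M <= k)%N then u k else 0))%E.
  by rewrite eseries_cond eseries_mkcond.
pose g' (k : nat) w : \bar R := if (M <= k)%N then g k w else 0%E.
have g'0 k w : (0 <= g' k w)%E by rewrite /g'; case: ifP.
have mg' k : measurable_fun setT (g' k).
  rewrite (_ : g' k = if (M <= k)%N then g k else cst 0%E).
    by case: ifP => _ //; exact: mg.
  by apply/funext => w; rewrite /g'; case: ifP.
have mS : measurable_fun setT (fun w => \sum_(M <= k <oo) g k w)%E.
  rewrite (_ : (fun w => _) = (fun w => \sum_(0 <= k <oo) g' k w)%E); last first.
    by apply/funext => w; exact: tailE.
  by apply: ge0_emeasurable_sum => [k w _ _|k _]; [exact: g'0|exact: mg'].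
have S0 w : (0 <= \sum_(M <= k <oo) g k w)%E by apply: nneseries_ge0.
have iN : 0 <= N%:R^-1 :> R by rewrite invr_ge0.
have iNE : (0 <= (N%:R^-1 : R)%:E)%E by rewrite lee_fin.
apply: (@le_trans _ _ (\int[P]_w ((N%:R^-1)%:E + \sum_(M <= k <oo) g k w))%E).
  apply: ge0_le_integral => //.
  - apply/measurable_EFinP/measurableT_comp => //.
    by apply: measurable_funB => //; exact: measurable_levels.
  - exact: emeasurable_funD.
  move=> w _.
  have H : (forall s, `[< A s w >] = (s < Z w)) \/ (forall s, `[< A s w >] = false).
    have [H|H] := AZ w; [left|right] => s.
      by apply/idP/idP => [/asboolP/H|/H/asboolP].
    by apply/asboolP.
  have := levels_approx N M (Z w) (fun s => `[< A s w >]) N0 H.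
  rewrite /levels.
  have iE (C : R -> set T) s : (`[< C s w >])%:R = \1_(C s) w :> R by [].
  move=> /le_trans; apply; rewrite le_eqVlt; apply/orP; left; apply/eqP.
  congr (_ + _)%E; apply: eq_eseriesr => k _; rewrite /g iE; congr (_ + _)%:E.
  by rewrite [RHS]indicE in_setC.
rewrite ge0_integralD// integral_prob_cst; apply: leeD2l.
rewrite (eq_integral (fun w => \sum_(0 <= k <oo) g' k w)%E); last first.
  by move=> w _; exact: tailE.
rewrite integral_nneseries// tailE le_eqVlt; apply/orP; left; apply/eqP.
apply: eq_eseriesr => k _; rewrite /g'; case: ifP => _; last by rewrite integral0.
rewrite /g; under eq_integral do rewrite EFinD.
rewrite ge0_integralD//; last 2 first.
- by apply/measurable_EFinP; exact: mi.
- by apply/measurable_EFinP; apply: mi; exact: measurableC.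
by rewrite !integral_indic ?setIT//; exact: measurableC.
Qed.

Let integral_levels_shift N M :
  (\int[P]_w (levels N M w + M%:R)%:E = (N%:R^-1 * \sum_(k < 2 * M * N)
    fine (P (A (- M%:R + k%:R / N%:R))))%:E)%E.
Proof.
have mi (s : R) : measurable_fun setT (fun w => (\1_(A s) w : R)%:E).
  by apply/measurable_EFinP/measurable_indic.
rewrite (eq_integral (fun w => (N%:R^-1)%:E * \sum_(k < 2 * M * N)
    (\1_(A (- M%:R + k%:R / N%:R)) w : R)%:E)%E); last first.
  by move=> w _; rewrite /levels addrAC addNr add0r EFinM sumEFin.
have mS : measurable_fun setT (fun w => \sum_(k < 2 * M * N)
    (\1_(A (- M%:R + k%:R / N%:R)) w : R)%:E)%E.
  by apply: emeasurable_sum => k; exact: mi.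
have S0 w : (0 <= \sum_(k < 2 * M * N)
    (\1_(A (- M%:R + k%:R / N%:R)) w : R)%:E)%E by exact: sume_ge0.
have iN : (0 <= (N%:R^-1 : R)%:E)%E by rewrite lee_fin invr_ge0.
rewrite ge0_integralZl// EFinM -sumEFin; congr (_ * _)%E.
rewrite ge0_integral_sum//.
by apply: eq_bigr => k _; rewrite integral_indic// setIT fineK// fin_num_measure.
Qed.

Let integrable_levels_shift N M :
  P.-integrable setT (EFin \o (fun w => levels N M w + M%:R)).
Proof.
apply/integrableP; split.
  by apply/measurable_EFinP; apply: measurable_funD => //; exact: measurable_levels.
rewrite (eq_integral (fun w => (levels N M w + M%:R)%:E)).
  by rewrite integral_levels_shift ltry.
move=> w _; rewrite /= ger0_norm// /levels addrAC addNr add0r.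
by rewrite mulr_ge0 ?invr_ge0// sumr_ge0.
Qed.

Let levelsE N M : levels N M = (fun w => levels N M w + M%:R - M%:R).
Proof. by apply/funext => w; rewrite addrK. Qed.

Let integrable_prob_cst (c : R) : P.-integrable setT (EFin \o (fun=> c)).
Proof.
apply/integrableP; split; first exact: measurable_cst.
by rewrite /= (eq_integral (fun=> `|c|%:E))// integral_prob_cst ltry.
Qed.

Lemma integrable_levels N M : P.-integrable setT (EFin \o levels N M).
Proof.
have -> : EFin \o levels N M =
    ((EFin \o (fun w => (levels N M w + M%:R)%R)) \- (EFin \o (fun=> M%:R)))%E.
  by apply/funext => w /=; rewrite -EFinB addrK.
by apply: integrableB => //; exact: integrable_levels_shift.
Qed.

Lemma Rintegral_levels N M : \int[P]_w levels N M w =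
  - M%:R + N%:R^-1 * \sum_(k < 2 * M * N) fine (P (A (- M%:R + k%:R / N%:R))).
Proof.
have i1 := integrable_levels_shift N M; have i2 := integrable_prob_cst M%:R.
rewrite levelsE RintegralB//.
rewrite addrC; congr (_ + _); last by rewrite /Rintegral integral_levels_shift.
by rewrite /Rintegral integral_prob_cst.
Qed.

End levels.

(** * The limit law *)

Section exponential.
Context {R : realType}.

Definition exp1 : probability (measurableTypeR R) R.
Proof. by unshelve refine (exponential_prob (1 : R) : probability _ R). Defined.

Lemma exp1E (A : set (measurableTypeR R)) :
  exp1 A = (\int[lebesgue_measure]_(x in A) (exponential_pdf (1 : R) x)%:E)%E.
Proof. by []. Qed.

Lemma exp1_le (a : R) : 0 <= a -> exp1 `]-oo, a]%classic = (1 - expR (- a))%:E.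
Proof.
move=> a0; have -> : exp1 `]-oo, a]%classic = exp1 `[0, a]%classic.
  rewrite !exp1E integral_mkcond [RHS]integral_mkcond; apply: eq_integral => x _.
  rewrite !patchE; have [x0|x0] := ltP x 0.
    by rewrite lt0_exponential_pdf//; case: ifP; case: ifP.
  by rewrite !mem_setE !in_itv/= x0.
have [->|a1] := eqVneq a 0.
  rewrite set_itv1 exp1E integral_set1.
  by rewrite oppr0 expR0 subrr.
have /(exponential_prob_itv0c (1 : R)) : 0 < a by rewrite lt_neqAle eq_sym a1.
by rewrite mulN1r EFinB.
Qed.

Lemma exp1_gt (a : R) : 0 <= a -> exp1 `]a, +oo[%classic = (expR (- a))%:E.
Proof.
move=> a0; rewrite -setCitvl probability_setC; last exact: measurable_itv.
by rewrite exp1_le// -EFinB opprB addrCA subrr addr0.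
Qed.

Lemma integral_ln_exp1 : \int[exp1]_s ln (s : R) = - euler_mascheroni R.
Proof.
rewrite /euler_mascheroni opprK /Rintegral.
rewrite (integral_density_signed exp1 lebesgue_measure (exponential_pdf (1 : R)))//.
- congr fine; rewrite [RHS]integral_mkcond; apply: eq_integral => x _.
  rewrite patchE mem_setE in_itv/= andbT; case: ltP => x0; last by rewrite ln0// mulr0.
  by rewrite exponential_pdfE ?ltW// mul1r mulN1r.
- exact: measurable_exponential_pdf.
- by move=> x; apply: exponential_pdf_ge0.
Qed.

End exponential.

Section limit_law.
Context {R : realType} {d : nat}.
Local Notation V := (vec R d).
Local Notation lam := (lebesgue_vec R d).
Hypothesis hd : (0 < d)%N.
Variable mu : probability V R.
Variable f : V -> R.
Hypothesis mf : measurable_fun setT f.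
Hypothesis f0 : forall x, 0 <= f x.
Hypothesis dens : forall A, measurable A -> mu A = (\int[lam]_(x in A) (f x)%:E)%E.
Hypothesis hH : has_finite_entropy f.
Implicit Types (s e : R) (x : V) (k : nat).
Local Notation rad := (vol_radius d).
Local Notation PW := (mu \x @exp1 R)%E.

(** The variable ln S - ln f(X), on the product of the law of X and of the
    standard exponential law of S. *)
Definition log_ratio (p : V * measurableTypeR R) : R := ln (p.2 : R) - ln (f p.1).

Let mlnf : measurable_fun setT (fun x => ln (f x)).
Proof. exact: measurableT_comp (@measurable_ln R) mf. Qed.

Let mlnf1 : measurable_fun setT (fun p : V * measurableTypeR R => ln (f p.1)).
Proof. exact: (measurableT_comp mlnf measurable_fst). Qed.

Let mln2 : measurable_fun setT (fun p : V * measurableTypeR R => ln (p.2 : R)).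
Proof. exact: (measurableT_comp (@measurable_ln R) measurable_snd). Qed.

Lemma measurable_log_ratio : measurable_fun setT log_ratio.
Proof. exact: measurable_funB. Qed.

Lemma measurable_log_ratio_gt s : measurable [set p | s < log_ratio p].
Proof. exact: (measurable_gt_level _ _ measurable_log_ratio). Qed.

(** Given X = x with f x > 0, the event is S > e^s f x.  The convention that the
    logarithm vanishes on nonpositive reals matters only on the null sets
    f x = 0 and S <= 0. *)
Lemma log_ratio_gt s : PW [set p | s < log_ratio p] = void_lim mu f (expR s).
Proof.
have mG := measurable_log_ratio_gt s.
have mX : measurable_fun setT (exp1 \o xsection [set p | s < log_ratio p]).
  exact: measurable_fun_xsection.
rewrite /product_measure1/= (integral_density _ _ _ mf f0 dens)//; last first.
  by move=> x; exact: measure_ge0.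
have mv : measurable_fun setT (fun x => (expR (- (expR s * f x)))%:E).
  by apply/measurable_EFinP; exact: measurable_void_lim.
have ev0 x : (0 <= (expR (- (expR s * f x)))%:E)%E by rewrite lee_fin expR_ge0.
rewrite /void_lim (integral_density _ _ _ mf f0 dens)//.
apply: eq_integral => x _.
have [->|fx0] := eqVneq (f x) 0; first by rewrite !mule0.
have fx : 0 < f x by rewrite lt_neqAle eq_sym fx0 f0.
congr (_ * _)%E.
have a0 : 0 <= expR s * f x by rewrite mulr_ge0// expR_ge0.
rewrite -exp1_gt//.
set S := xsection _ _.
have mS : measurable S by exact: measurable_xsection.
pose I0 : set (measurableTypeR R) := `]0, +oo[%classic.
pose J0 : set (measurableTypeR R) := `]-oo, 0]%classic.
have SE : S `&` I0 = `]expR s * f x, +oo[%classic.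
  apply/seteqP; split => t; rewrite /S /I0 /xsection/= !in_itv/= !andbT inE/= /log_ratio/=.
    move=> [H1 t0]; rewrite -[t in ltRHS]lnK// -[f x]lnK// -expRD ltr_expR; lra.
  move=> H1; have t0 : 0 < t by apply: le_lt_trans H1.
  split => //; move: H1; rewrite -[t in X in X -> _]lnK// -[f x in X in X -> _]lnK// -expRD ltr_expR; lra.
have mI0 : measurable I0 by exact: measurable_itv.
have mJ0 : measurable J0 by exact: measurable_itv.
have mSI : measurable (S `&` I0) by exact: measurableI.
(* the section may differ from this interval only within ]-oo, 0] *)
rewrite -SE; apply/eqP; rewrite eq_le; apply/andP; split; last first.
  by apply: le_measure; rewrite ?inE.
apply: (@le_trans _ _ (exp1 ((S `&` I0) `|` J0))).
  apply: le_measure; rewrite ?inE//; first exact: measurableU.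
  move=> t St; have [t0|t0] := leP t 0; first by right; rewrite /J0/= in_itv.
  by left; split => //; rewrite /I0/= in_itv/= t0.
have n0E : exp1 J0 = 0%E by rewrite /J0 exp1_le// oppr0 expR0 subrr.
by rewrite -[leRHS]adde0 -n0E; exact: measureU2.
Qed.

(** The exponents m and m - 1 occur for one and for two sample points. *)
Lemma void_lim_approx s e : 0 < e -> exists N, forall m m', (N <= m)%N ->
  (m' = m \/ m'.+1 = m) ->
  (void_prob mu m' (rad m s) <= void_lim mu f (expR s) + e%:E)%E /\
  (void_lim mu f (expR s) <= void_prob mu m' (rad m s) + e%:E)%E.
Proof.
move=> e0.
have [rho rho0 H] := void_prob_approx mu f mf f0 dens hd _ _ (expR_ge0 s) e0.
have [N HN] := vol_radius_small d hd s rho rho0.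
exists N.+1 => m m' Nm mm'.
apply: (H (rad m s) m' m%:R); [exact: vol_radius_gt0|exact/HN/ltnW|by []| |].
  case: mm' => [->|<-]; first by rewrite subrr normr0.
  by rewrite -natr1 addrAC subrr add0r normr1.
by rewrite vol_radiusE// (leq_trans _ Nm).
Qed.

(** The limit inherits the bounds that are uniform in the sample size. *)
Lemma void_lim_le_upper_tail k : (void_lim mu f (expR k%:R) <= upper_tail mu k)%E.
Proof.
apply/lee_addgt0Pr => e e0; have [N H] := void_lim_approx k%:R e e0.
have [_] := H N.+1 N.+1 (leqnSn _) (or_introl erefl).
by move=> /le_trans; apply; apply: leeD2r; exact: void_prob_le_upper_tail.
Qed.

Lemma void_lim_ge_lower_tail k : (1 <= void_lim mu f (expR (- k%:R)) + lower_tail mu f k)%E.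
Proof.
apply/lee_addgt0Pr => e e0; have [N H] := void_lim_approx (- k%:R) e e0.
have [h _] := H N.+1 N.+1 (leqnSn _) (or_introl erefl).
have h1 := void_prob_ge_lower_tail hd mu f mf f0 dens N.+1 k isT.
apply: (le_trans h1); rewrite [leRHS]addeAC.
by apply: leeD2r.
Qed.

Lemma log_ratio_levels N M : (0 < N)%N ->
  (\int[PW]_p `|log_ratio p - levels (fun s => [set p | s < log_ratio p]) N M p|%:E <=
  (N%:R^-1)%:E + \sum_(M <= k <oo) (upper_tail mu k + lower_tail mu f k))%E.
Proof.
move=> N0.
have up k : (PW [set p | (k%:R < log_ratio p)%R] <= upper_tail mu k)%E.
  by rewrite log_ratio_gt void_lim_le_upper_tail.
have low k : (PW (~` [set p | (- k%:R < log_ratio p)%R]) <= lower_tail mu f k)%E.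
  have mk := measurable_log_ratio_gt (- k%:R).
  rewrite probability_setC//.
  rewrite leeBlDl; last by rewrite fin_num_measure.
  by rewrite [X in (_ <= X + _)%E]log_ratio_gt; exact: void_lim_ge_lower_tail.
apply: (le_trans (levels_L1 PW log_ratio _ measurable_log_ratio
  measurable_log_ratio_gt _ N M N0)).
  by move=> p; left.
apply: leeD2l; apply: lee_nneseries => [k _ _|k _]; first by rewrite adde_ge0.
by apply: leeD; [exact: up|exact: low].
Qed.

Hypothesis tails : (\sum_(0 <= k <oo) (upper_tail mu k + lower_tail mu f k) < +oo)%E.

Lemma integrable_log_ratio : PW.-integrable setT (EFin \o log_ratio).
Proof.
apply/integrableP; split; first by apply/measurable_EFinP; exact: measurable_log_ratio.
have := log_ratio_levels 1 0 isT.
rewrite (eq_integral (fun p => `|(log_ratio p)%:E|%E)); last first.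
  by move=> p _; rewrite /levels muln0 mul0n big_ord0 mulr0 oppr0 addr0 subr0.
by move=> /le_lt_trans; apply; rewrite lte_add_pinfty ?ltry.
Qed.

Lemma mean_log_ratio : \int[PW]_p log_ratio p = entropy f - euler_mascheroni R.
Proof.
have i1 : PW.-integrable setT (fun p => (ln (f p.1))%:E).
  have /integrableP[_ fin] := integrable_ln_density mu f mf f0 dens hH.
  apply/integrableP; split; first exact/measurable_EFinP.
  rewrite fubini_tonelli1//; last first.
    by apply: measurableT_comp => //; exact/measurable_EFinP.
  apply: le_lt_trans fin; rewrite le_eqVlt; apply/orP; left; apply/eqP.
  by apply: eq_integral => x _; rewrite /fubini_F/= integral_prob_cst.
have i2 : PW.-integrable setT (fun p => (ln (p.2 : R))%:E).
  rewrite (_ : (fun p => _) = (fun p => (log_ratio p)%:E + (ln (f p.1))%:E)%E).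
    by apply: integrableD => //; exact: integrable_log_ratio.
  by apply/funext => p; rewrite -EFinD /log_ratio subrK.
rewrite /log_ratio RintegralB//.
have -> : \int[PW]_p ln (p.2 : R) = \int[exp1]_s ln (s : R).
  rewrite /Rintegral -integral12_prod_meas1//; congr fine.
  rewrite /fubini_F/= integral_cst// [X in (_ * X)%E](_ : _ = 1%E) ?mule1//.
  exact: probability_setT.
have -> : \int[PW]_p ln (f p.1) = \int[mu]_x ln (f x).
  rewrite /Rintegral -integral21_prod_meas1//; congr fine.
  rewrite /fubini_G/= integral_cst// [X in (_ * X)%E](_ : _ = 1%E) ?mule1//.
  exact: probability_setT.
rewrite integral_ln_exp1 (integral_ln_density mu f mf f0 dens)//.
by rewrite (opprK (entropy f)) addrC.
Qed.

(** The limit law has the same tail bounds as the Z_i, so that its mean is also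
    recovered from its values on the grid. *)
Lemma mean_levels_approx N M : (0 < N)%N ->
  (`|entropy f - euler_mascheroni R - (- M%:R + N%:R^-1 *
     \sum_(k < 2 * M * N) fine (void_lim mu f (expR (- M%:R + k%:R / N%:R))))|%:E <=
  (N%:R^-1)%:E + \sum_(M <= k <oo) (upper_tail mu k + lower_tail mu f k))%E.
Proof.
move=> N0; apply: le_trans (log_ratio_levels N M N0).
have mG := measurable_log_ratio_gt; have iW := integrable_log_ratio.
have iL := integrable_levels PW _ mG N M.
rewrite -mean_log_ratio.
rewrite (_ : - M%:R + _ = \int[PW]_p levels (fun s => [set p | s < log_ratio p]) N M p); last first.
  rewrite Rintegral_levels//; congr (_ + _ * _).
  by apply: eq_bigr => k _; congr fine; exact: (esym (log_ratio_gt _)).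
rewrite -RintegralB//.
have iD : PW.-integrable setT (EFin \o (fun p =>
    log_ratio p - levels (fun s => [set p | s < log_ratio p]) N M p)).
  by have := integrableB measurableT iW iL.
rewrite EFin_normr_Rintegral//; apply: le_abse_integral => //; exact: (measurable_int _ iD).
Qed.

End limit_law.

(** * Nearest neighbour distances *)

Section other_indices.
Implicit Types (n i j : nat).

Definition others n i : seq nat := [seq j <- index_iota 1 n.+1 | j != i].

Lemma uniq_others n i : uniq (i :: others n i).
Proof. by rewrite /= mem_filter eqxx/= filter_uniq// iota_uniq. Qed.

Lemma size_others n i : (0 < i <= n)%N -> (size (others n i)).+1 = n.
Proof.
move=> ni; rewrite size_filter; have := count_predC (pred1 i) (index_iota 1 n.+1).
rewrite count_uniq_mem ?iota_uniq// mem_index_iota ltnS ni add1n size_iota subn1 /=.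
by move=> h; rewrite -[RHS]h.
Qed.

Definition others2 n i j : seq nat := [seq k <- others n i | k != j].

Lemma uniq_others2 n i j : i != j -> uniq [:: i, j & others2 n i j].
Proof.
move=> ij; rewrite /= inE negb_or ij !mem_filter !eqxx/= andbF/=.
by rewrite !filter_uniq// iota_uniq.
Qed.

Lemma size_others2 n i j : (0 < i <= n)%N -> (0 < j <= n)%N -> i != j ->
  (size (others2 n i j)).+2 = n.
Proof.
move=> ni nj ij; rewrite -[RHS](size_others n i)//; congr S.
rewrite size_filter; have := count_predC (pred1 j) (others n i).
rewrite count_uniq_mem; last by have /andP[] := uniq_others n i.
by rewrite mem_filter eq_sym ij mem_index_iota ltnS nj/= add1n.
Qed.

Lemma others2_sub n i j k : k \in others2 n i j -> k \in others n i /\ k \in others n j.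
Proof. by rewrite !mem_filter => /and3P[-> -> ->]. Qed.

End other_indices.

Section nearest_neighbor.
Context {R : realType} {d : nat}.
Implicit Types (s : seq nat) (r : R) (i j n : nat).

Lemma bigmin_finP s (g : nat -> R) : s != [::] ->
  exists c : R, [/\ (\big[mine/+oo]_(j <- s) (g j)%:E = c%:E)%E,
    exists j, c = g j & forall r, r < c <-> (forall j, j \in s -> r < g j)].
Proof.
elim: s => // a [|a' s] IH _.
  exists (g a); rewrite big_seq1; split => //; first by exists a.
  by move=> r; split => [ra j|]; [rewrite inE => /eqP->|apply; rewrite inE].
have [c [cE [j cj] cP]] := IH isT.
exists (Num.min (g a) c); rewrite big_cons cE -EFin_min; split => //.
  by rewrite /Num.min; case: ifP => _; [exists a|exists j].
move=> r; rewrite lt_min; split.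
  move=> /andP[ra /cP rc] k; rewrite inE => /predU1P[->//|]; exact: rc.
move=> H; rewrite H ?inE ?eqxx//=; apply/cP => k ks; apply: H.
by rewrite inE ks orbT.
Qed.

Variables (x : nat -> vec R d) (n i : nat).
Hypothesis n2 : (1 < n)%N.
Hypothesis ni : (0 < i <= n)%N.

Let others_neq0 : others n i != [::].
Proof.
apply/eqP => o0; have := size_others n i ni; rewrite o0/= => n1.
by move: n2; rewrite -n1.
Qed.

Lemma nn_distance_gtP r y :
  r < nn_distance x n i y <-> (forall j, j \in others n i -> r < vdist y (x j)).
Proof.
rewrite /nn_distance -big_filter.
by have [c [-> _ cP]] := bigmin_finP _ (fun j => vdist y (x j)) others_neq0.
Qed.

Lemma nn_distance_ge0 y : 0 <= nn_distance x n i y.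
Proof.
rewrite /nn_distance -big_filter.
have [c [-> [j ->] _]] := bigmin_finP _ (fun j => vdist y (x j)) others_neq0.
exact: vdist_ge0.
Qed.

End nearest_neighbor.

Section log_nearest_neighbor.
Context {R : realType} {d : nat} {dT} {T : measurableType dT} (P : probability T R).
Local Notation V := (vec R d).
Local Notation v := (unit_ball_volume R d).
Variable X : nat -> {RV P >-> V}.
Hypothesis hd : (0 < d)%N.
Implicit Types (n i : nat) (s : R) (w : T).

(** The logarithm of the rescaled nearest neighbour volume, whose mean over i is
    the estimate up to the Euler-Mascheroni constant. *)
Definition log_nn n i w : R :=
  ln ((n%:R - 1) * nn_distance (fun j => X j w) n i (X i w) ^+ d * v).

Definition log_nn_gt n i s : set T :=
  void_event P X i (others n i) (vol_radius d n.-1 s).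

Lemma measurable_log_nn_gt n i s : measurable (log_nn_gt n i s).
Proof. exact: measurable_void_event. Qed.

Lemma measurable_log_nn n i : measurable_fun setT (log_nn n i).
Proof.
apply: (measurableT_comp (@measurable_ln R)).
apply: measurable_funM => //; apply: measurable_funM => //.
apply: measurable_funX; apply: measurableT_comp => //.
under eq_fun do rewrite -big_filter.
elim: [seq _ <- _ | _] => [|j s IH].
  rewrite (_ : (fun _ => _) = cst +oo%E); first exact: measurable_cst.
  by apply/funext => w; rewrite big_nil.
under eq_fun do rewrite big_cons.
apply: measurable_mine => //; apply/measurable_EFinP.
have mX k : measurable_fun setT (fun w => X k w) by exact: measurable_funP.
exact: (measurable_vdist _ _ (fun w => X i w) (fun w => X j w)).
Qed.

(** If the nearest neighbour distance is 0, then [log_nn] is ln 0 = 0 while none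
    of the events holds: hence the second alternative. *)
Lemma log_nn_gtP n i : (1 < n)%N -> (0 < i <= n)%N -> forall w,
  (forall s, log_nn_gt n i s w <-> s < log_nn n i w) \/
  (forall s, ~ log_nn_gt n i s w).
Proof.
move=> n2 ni w; have n1 : (0 < n.-1)%N by rewrite -ltnS prednK// ltnW.
have nE : n%:R - 1 = n.-1%:R :> R by rewrite -subn1 natrB// ltnW.
set rho := nn_distance (fun j => X j w) n i (X i w).
have AP s : log_nn_gt n i s w <-> vol_radius d n.-1 s < rho.
  by split => [H|/nn_distance_gtP]; [apply/nn_distance_gtP|apply].
have rho0 : 0 <= rho by exact: nn_distance_ge0.
move: rho0; rewrite le_eqVlt => /predU1P[r0|r0]; [right|left] => s.
  by move/AP; rewrite -r0 ltNge (ltW (vol_radius_gt0 _ _ _)).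
have v0 : 0 < v := unit_ball_volume_gt0.
have n1R : 0 < n.-1%:R :> R by rewrite ltr0n.
rewrite /log_nn -/rho nE AP -[s in X in _ <-> X]expRK ltr_ln ?posrE ?expR_gt0//; last first.
  by rewrite !mulr_gt0 ?exprn_gt0.
rewrite -(vol_radiusE d hd n.-1 s n1) -mulrA ltr_pM2l// mulrC ltr_pM2r//.
by rewrite ltr_pXn2r ?nnegrE ?ltW// vol_radius_gt0.
Qed.

Lemma kl_entropyE n w : kl_entropy (fun j => X j w) n.+1 =
  n.+1%:R^-1 * (\sum_(i < n.+1) log_nn n.+1 i.+1 w) + euler_mascheroni R.
Proof. by rewrite /kl_entropy big_add1/= big_mkord. Qed.

Lemma measurable_kl_entropy n :
  measurable_fun setT (fun w => kl_entropy (fun j => X j w) n.+1).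
Proof.
under eq_fun do rewrite kl_entropyE.
apply: measurable_funD => //; apply: measurable_funM => //.
by apply: measurable_sum => i; exact: measurable_log_nn.
Qed.

End log_nearest_neighbor.

(** * Sufficiency: convergence in mean *)

Lemma integral_mean_le {dT} {T : measurableType dT} {R : realType}
  (P : {measure set T -> \bar R}) (n : nat) (c : R) (h : 'I_n -> T -> R) (B : 'I_n -> R) : 0 <= c ->
  (forall i, measurable_fun setT (h i)) -> (forall i w, 0 <= h i w) ->
  (forall i, (\int[P]_w (h i w)%:E <= (B i)%:E)%E) ->
  (\int[P]_w (c * \sum_(i < n) h i w)%:E <= (c * \sum_(i < n) B i)%:E)%E.
Proof.
move=> c0 mh h0 hB.
have h0E i w : (0 <= (h i w)%:E)%E by rewrite lee_fin.
have mhE i : measurable_fun setT (fun w => (h i w)%:E) by exact/measurable_EFinP.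
have s0 w : (0 <= \sum_(i < n) (h i w)%:E)%E by exact: sume_ge0.
have ms : measurable_fun setT (fun w => \sum_(i < n) (h i w)%:E)%E.
  exact: emeasurable_sum.
under eq_integral do rewrite EFinM -sumEFin.
rewrite ge0_integralZl_EFin// ge0_integral_sum// EFinM -sumEFin.
by apply: lee_wpmul2l; rewrite ?lee_fin//; exact: lee_sum.
Qed.

Section consistency.
Context {R : realType} {d : nat} {dT} {T : measurableType dT} (P : probability T R).
Local Notation V := (vec R d).
Local Notation lam := (lebesgue_vec R d).
Variable X : nat -> {RV P >-> V}.
Hypothesis hindep : mutually_independent X.
Variable mu : probability V R.
Hypothesis law : forall i A, measurable A -> P (X i @^-1` A) = mu A.
Hypothesis hd : (0 < d)%N.
Variable f : V -> R.
Hypothesis mf : measurable_fun setT f.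
Hypothesis f0 : forall x, 0 <= f x.
Hypothesis dens : forall A, measurable A -> mu A = (\int[lam]_(x in A) (f x)%:E)%E.
Hypothesis hH : has_finite_entropy f.
Implicit Types (n i k N M : nat) (s e : R) (w : T).
Local Notation rad := (vol_radius d).
Local Notation A := (log_nn_gt P X).
Local Notation Z := (log_nn P X).

Let ord1P n (i : 'I_n.+1) : (0 < i.+1 <= n.+1)%N.
Proof. exact: ltn_ord. Qed.

Lemma prob_log_nn_gt n i s : (0 < i <= n.+1)%N ->
  P (A n.+1 i s) = void_prob mu n (rad n s).
Proof.
move=> ni; rewrite /log_nn_gt (prob_void_event P X hindep mu law) ?uniq_others//.
by have := size_others n.+1 i ni => -[->].
Qed.

Lemma prob_log_nn_gt_pair n i j s : (0 < i <= n.+1)%N -> (0 < j <= n.+1)%N -> i != j ->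
  (P (A n.+1 i s `&` A n.+1 j s) <=
   (\int[mu]_x (ball_mass mu (2 * rad n s) x)%:E) +
   void_prob mu n.-1 (rad n s) * void_prob mu n.-1 (rad n s))%E.
Proof.
move=> ni nj ij; have us := uniq_others2 n.+1 i j ij.
have sz : size (others2 n.+1 i j) = n.-1.
  exact: (congr1 (fun k => k.-2) (size_others2 n.+1 i j ni nj ij)).
have := prob_two_void_events P X hindep mu law i j _ (rad n s) us.
rewrite sz; apply: le_trans; apply: le_measure; rewrite ?inE.
- by apply: measurableI; exact: measurable_void_event.
- by apply: measurableI; exact: measurable_void_event.
by move=> w [Hi Hj]; split => k /others2_sub[ki kj]; [exact: Hi|exact: Hj].
Qed.

Local Notation g s := (fine (void_lim mu f (expR s))).

Let void_limE_ge0 t : (0 <= void_lim mu f t)%E.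
Proof. by apply: integral_ge0 => x _; rewrite lee_fin expR_ge0. Qed.

Let void_limE_le1 t : 0 <= t -> (void_lim mu f t <= 1)%E.
Proof.
move=> t0; rewrite -[leRHS](integral_prob_cst mu 1) /void_lim.
have mv : measurable_fun setT (fun x => (expR (- (t * f x)))%:E).
  by apply/measurable_EFinP; exact: measurable_void_lim.
have v0 x : (0 <= (expR (- (t * f x)))%:E)%E by rewrite lee_fin expR_ge0.
apply: ge0_le_integral => // x _.
by rewrite lee_fin expR_le1 oppr_le0 mulr_ge0.
Qed.

Lemma void_lim_fin t : 0 <= t -> void_lim mu f t = (fine (void_lim mu f t))%:E.
Proof.
move=> t0; rewrite fineK// ge0_fin_numE// (le_lt_trans (void_limE_le1 _ t0))//.
exact: ltry.
Qed.

Lemma void_lim_ge0 t : 0 <= fine (void_lim mu f t).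
Proof. exact: fine_ge0. Qed.

Lemma void_lim_le1 t : 0 <= t -> fine (void_lim mu f t) <= 1.
Proof. by move=> t0; rewrite -lee_fin -void_lim_fin//; exact: void_limE_le1. Qed.

(** The hypotheses of [frequency_L1] hold with an error 3 a: the pair
    probabilities are bounded by a + q^2 with q at most g + a, and q^2 <= g^2 +
    2 a because both q and g are at most 1. *)
Lemma frequency_log_nn s e : 0 < e -> exists N, forall n, (N <= n)%N ->
  (\int[P]_w `|frequency n (fun i : 'I_n.+1 => A n.+1 i.+1 s) w - g s|%:E <= e%:E)%E.
Proof.
move=> e0; have t0 := expR_ge0 s.
pose a := Num.min 1 (e ^+ 2 / 100).
have a0 : 0 < a by rewrite lt_min ltr01 divr_gt0// exprn_gt0.
have a1 : a <= 1 by rewrite ge_min lexx.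
have ae : a <= e ^+ 2 / 100 by rewrite ge_min lexx orbT.
have [N1 H1] := void_lim_approx hd mu f mf f0 dens s a a0.
have [rho rho0 Hrho] := integral_ball_mass_small mu f mf f0 dens hd a a0.
have rho20 : 0 < rho / 2 by rewrite divr_gt0.
have [N2 H2] := vol_radius_small d hd s (rho / 2) rho20.
pose N3 := Num.truncn a^-1.
exists (maxn 1 (maxn N1 (maxn N2 N3))) => n; rewrite !geq_max.
move=> /andP[n1 /andP[nN1 /andP[nN2 nN3]]].
have na : n.+1%:R^-1 <= a.
  rewrite -[a]invrK lef_pV2 ?posrE ?invr_gt0 ?ltr0n// ltW//.
  by rewrite (lt_le_trans (truncnS_gt _))// ler_nat ltnS.
have a30 : 0 <= 3 * a by rewrite mulr_ge0// ltW.
have e20 : 0 < e / 2 by rewrite divr_gt0.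
have mA (i : 'I_n.+1) : measurable (A n.+1 i.+1 s) by exact: measurable_log_nn_gt.
apply: le_trans (frequency_L1 P n _ mA (g s) (3 * a) (e / 2) (void_lim_ge0 _) (void_lim_le1 _ t0) a30 e20 _ _) _.
- move=> i; rewrite prob_log_nn_gt// -void_lim_fin//.
  have [_ /le_trans] := H1 n n nN1 (or_introl erefl); apply.
  by apply: leeD2l; rewrite lee_fin; lra.
- move=> i j ij; have ij' : i.+1 != j.+1 :> nat by rewrite eqSS.
  apply: (le_trans (prob_log_nn_gt_pair n i.+1 j.+1 s (ord1P n i) (ord1P n j) ij')).
  have r0 := vol_radius_gt0 d n s.
  have Hb : (\int[mu]_x (ball_mass mu (2 * rad n s) x)%:E <= a%:E)%E.
    by apply: Hrho; [rewrite mulr_gt0|have := H2 n nN2; lra].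
  have [Hq _] := H1 n n.-1 nN1 (or_intror (prednK n1)).
  move: Hq; rewrite (void_lim_fin _ t0).
  have q1 := void_prob_le1 mu n.-1 (rad n s); have q0 := void_prob_ge0 mu n.-1 (rad n s).
  have qE := fineK (void_prob_fin mu n.-1 (rad n s)).
  move: q1 q0; rewrite -qE; set q := fine (void_prob _ _ _); rewrite !lee_fin => q1 q0 Hq.
  rewrite -EFinM; apply: (@le_trans _ _ (a%:E + (q * q)%:E)%E); first exact: leeD2r.
  rewrite -EFinD lee_fin; have G0 := void_lim_ge0 (expR s); have G1 := void_lim_le1 _ t0.
  have [qg|qg] := leP q (g s); nra.
rewrite lee_fin.
have h : (n.+1%:R^-1 + 3 * (3 * a)) / (e / 2) <= e / 2.
  rewrite ler_pdivrMr// (_ : e / 2 * (e / 2) = e ^+ 2 / 4); last by field.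
  by move: na ae; set u := _^-1; set q := e ^+ 2; lra.
by rewrite [leRHS]splitr lerD2l.
Qed.

Lemma prob_log_nn_gt_le n i k : (0 < i <= n.+1)%N -> (0 < n)%N ->
  (P (A n.+1 i k%:R) <= upper_tail mu k)%E.
Proof. by move=> ni n0; rewrite prob_log_nn_gt//; exact: void_prob_le_upper_tail. Qed.

Lemma prob_log_nn_le_le n i k : (0 < i <= n.+1)%N -> (0 < n)%N ->
  (P (~` A n.+1 i (- k%:R)) <= lower_tail mu f k)%E.
Proof.
move=> ni n0; have mA := measurable_log_nn_gt P X n.+1 i (- k%:R).
rewrite probability_setC//.
rewrite leeBlDl; last by rewrite fin_num_measure.
by rewrite prob_log_nn_gt//; exact: void_prob_ge_lower_tail.
Qed.

Hypothesis tails : (\sum_(0 <= k <oo) (upper_tail mu k + lower_tail mu f k) < +oo)%E.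

(** The error is split in three: the rounding of the Z_i, the fluctuation of
    their frequencies on the grid, and the rounding of the limit law. *)
Lemma kl_entropy_L1 n N M (eta beta : R) : (0 < n)%N -> (0 < N)%N ->
  ((N%:R^-1)%:E + \sum_(M <= k <oo) (upper_tail mu k + lower_tail mu f k) <= beta%:E)%E ->
  (forall k : 'I_(2 * M * N), (\int[P]_w `|frequency n (fun i : 'I_n.+1 =>
      A n.+1 i.+1 (- M%:R + k%:R / N%:R)) w - g (- M%:R + k%:R / N%:R)|%:E <= eta%:E)%E) ->
  (\int[P]_w `|kl_entropy (fun i => X i w) n.+1 - entropy f|%:E <=
   (beta + beta + 2 * M%:R * eta)%:E)%E.
Proof.
move=> n0 N0 Hbeta Heta.
have n1R : n.+1%:R != 0 :> R by rewrite pnatr_eq0.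
have NR : N%:R != 0 :> R by rewrite pnatr_eq0 -lt0n.
pose sk (k : nat) : R := - M%:R + k%:R / N%:R.
pose L (i : 'I_n.+1) w := levels (A n.+1 i.+1) N M w.
pose F (k : nat) w : R := frequency n (fun i : 'I_n.+1 => A n.+1 i.+1 (sk k)) w.
pose gam : R := - M%:R + N%:R^-1 * \sum_(k < 2 * M * N) g (sk k).
pose c := `|entropy f - euler_mascheroni R - gam|.
have cb : c <= beta.
  rewrite -lee_fin; apply: le_trans Hbeta.
  exact: (mean_levels_approx hd mu f mf f0 dens hH tails N M N0).
have mL (i : 'I_n.+1) : measurable_fun setT (L i).
  by apply: measurable_levels => s; exact: measurable_log_nn_gt.
have mZ (i : nat) : measurable_fun setT (Z n.+1 i) by exact: measurable_log_nn.
have mF (k : nat) : measurable_fun setT (F k).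
  by apply: measurable_frequency => i; exact: measurable_log_nn_gt.
have LE w : n.+1%:R^-1 * (\sum_(i < n.+1) L i w) =
    - M%:R + N%:R^-1 * \sum_(k < 2 * M * N) F k w.
  rewrite /L /levels big_split/= sumr_const card_ord -mulr_sumr exchange_big/= mulrDr.
  congr (_ + _); first by rewrite -[X in _ * X]mulr_natl mulKf.
  by rewrite mulrCA mulr_sumr.
have key w : `|kl_entropy (fun i => X i w) n.+1 - entropy f| <=
    n.+1%:R^-1 * (\sum_(i < n.+1) `|Z n.+1 i.+1 w - L i w|) +
    (N%:R^-1 * \sum_(k < 2 * M * N) `|F k w - g (sk k)| + beta).
  rewrite kl_entropyE.
  have h1 : `|n.+1%:R^-1 * (\sum_(i < n.+1) Z n.+1 i.+1 w) - n.+1%:R^-1 * (\sum_(i < n.+1) L i w)|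
      <= n.+1%:R^-1 * (\sum_(i < n.+1) `|Z n.+1 i.+1 w - L i w|).
    rewrite -mulrBr -sumrB normrM ger0_norm ?invr_ge0//.
    by apply: ler_wpM2l; [rewrite invr_ge0|exact: ler_norm_sum].
  have h2 : `|- M%:R + N%:R^-1 * (\sum_(k < 2 * M * N) F k w) - gam| <=
      N%:R^-1 * \sum_(k < 2 * M * N) `|F k w - g (sk k)|.
    rewrite /gam opprD addrACA subrr add0r -mulrBr -sumrB normrM ger0_norm ?invr_ge0//.
    by apply: ler_wpM2l; [rewrite invr_ge0|exact: ler_norm_sum].
  move: h1; rewrite LE => h1.
  have tri (a b p h eu x y z : R) : `|a - b| <= x -> `|b - p| <= y ->
      `|h - eu - p| <= z -> `|a + eu - h| <= x + (y + z).
    rewrite !ler_norml => /andP[? ?] /andP[? ?] /andP[? ?].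
    by apply/andP; split; lra.
  exact: (tri _ _ _ _ _ _ _ _ h1 h2 cb).
pose U1 w : R := n.+1%:R^-1 * \sum_(i < n.+1) `|Z n.+1 i.+1 w - L i w|.
pose U2 w : R := N%:R^-1 * \sum_(k < 2 * M * N) `|F k w - g (sk k)|.
have mU1 : measurable_fun setT U1.
  apply: measurable_funM => //; apply: measurable_sum => i.
  by apply: measurableT_comp => //; exact: measurable_funB.
have mU2 : measurable_fun setT U2.
  apply: measurable_funM => //; apply: measurable_sum => i.
  by apply: measurableT_comp => //; exact: measurable_funB.
have U10 w : 0 <= U1 w by rewrite mulr_ge0 ?invr_ge0// sumr_ge0.
have U20 w : 0 <= U2 w by rewrite mulr_ge0 ?invr_ge0// sumr_ge0.
have b0 : 0 <= beta by exact: le_trans (normr_ge0 _) cb.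
have mkl : measurable_fun setT (fun w => kl_entropy (fun i => X i w) n.+1).
  exact: measurable_kl_entropy.
apply: (@le_trans _ _ (\int[P]_w (U1 w + (U2 w + beta))%:E)%E).
  apply: ge0_le_integral => //.
  - by apply/measurable_EFinP/measurableT_comp => //; exact: measurable_funB.
  - apply/measurable_EFinP/measurable_funD => //; exact: measurable_funD.
  - by move=> w _; rewrite lee_fin; exact: key.
have U1E w : (0 <= (U1 w)%:E)%E by rewrite lee_fin.
have U2E w : (0 <= (U2 w)%:E)%E by rewrite lee_fin.
have b0E : (0 <= beta%:E)%E by rewrite lee_fin.
have mU1E : measurable_fun setT (fun w => (U1 w)%:E) by exact/measurable_EFinP.
have mU2E : measurable_fun setT (fun w => (U2 w)%:E) by exact/measurable_EFinP.
have U2bE w : (0 <= (U2 w)%:E + beta%:E)%E by exact: adde_ge0.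
have mU2bE : measurable_fun setT (fun w => (U2 w)%:E + beta%:E)%E.
  exact: emeasurable_funD.
under eq_integral do rewrite EFinD EFinD.
rewrite ge0_integralD// ge0_integralD// integral_prob_cst.
have I1 : (\int[P]_w (U1 w)%:E <= beta%:E)%E.
  have -> : beta = n.+1%:R^-1 * \sum_(i < n.+1) beta.
    by rewrite sumr_const card_ord -[X in _ * X]mulr_natl mulKf.
  apply: integral_mean_le => //.
  - by move=> i; apply: measurableT_comp => //; exact: measurable_funB.
  move=> i; apply: le_trans Hbeta.
  apply: (le_trans (levels_L1 P (Z n.+1 i.+1) (A n.+1 i.+1) (mZ _) _ _ N M N0)).
  - by move=> s; exact: measurable_log_nn_gt.
  - exact: log_nn_gtP.
  apply: leeD2l; apply: lee_nneseries => [k _ _|k _]; first exact: adde_ge0.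
  by apply: leeD; [exact: prob_log_nn_gt_le|exact: prob_log_nn_le_le].
have I2 : (\int[P]_w (U2 w)%:E <= (2 * M%:R * eta)%:E)%E.
  have -> : 2 * M%:R * eta = N%:R^-1 * \sum_(k < 2 * M * N) eta.
    rewrite sumr_const card_ord -[X in _ = _ * X]mulr_natl !natrM.
    by field.
  apply: (integral_mean_le P _ _ (fun k : 'I__ => fun w => `|F k w - g (sk k)|) (fun=> eta)) => //.
  - by move=> i; apply: measurableT_comp => //; exact: measurable_funB.
apply: (@le_trans _ _ (beta%:E + ((2 * M%:R * eta)%:E + beta%:E))%E).
  by apply: leeD => //; exact: leeD.
by rewrite -!EFinD lee_fin; set q := 2 * _ * _; lra.
Qed.

(** The mesh 1/N and the cut M are chosen first; as the grid is then finite, all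
    its frequencies converge simultaneously. *)
Lemma kl_entropy_L1_small e : 0 < e -> exists n0, forall n, (n0 <= n)%N ->
  (\int[P]_w `|kl_entropy (fun i => X i w) n - entropy f|%:E <= e%:E)%E.
Proof.
move=> e0; have e10 : 0 < e / 10 by rewrite divr_gt0.
pose N := (Num.truncn (e / 10)^-1).+1.
have Ne : N%:R^-1 <= e / 10 :> R.
  by rewrite -[e / 10]invrK lef_pV2 ?posrE ?invr_gt0 ?ltr0n// ltW// truncnS_gt.
have t0 k : (0 <= upper_tail mu k + lower_tail mu f k)%E.
  by rewrite adde_ge0 ?upper_tail_ge0 ?lower_tail_ge0.
have e10E : (0 < (e / 10)%:E)%E by rewrite lte_fin.
have [M HM] := cvge_eventually_lt _ _ _ (nneseries_tail_cvg tails (fun k _ => t0 k)) e10E.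
pose eta := e / (5 * (2 * M%:R + 1)).
have den0 : 0 < 5 * (2 * M%:R + 1) :> R by rewrite mulr_gt0// ltr_wpDl// mulr_ge0.
have eta0 : 0 < eta by rewrite divr_gt0.
have /choice[n1 Hn1] (k : 'I_(2 * M * N)) := frequency_log_nn (- M%:R + k%:R / N%:R) eta eta0.
exists (\max_(k < 2 * M * N) n1 k).+2 => -[//|n]; rewrite ltnS => nn.
have n0 : (0 < n)%N by apply: leq_trans nn.
apply: (le_trans (kl_entropy_L1 n N M eta (e / 5) n0 isT _ _)).
- have := HM M (leqnn M) => /ltW HM'.
  have NeE : ((N%:R^-1)%:E <= (e / 10)%:E)%E by rewrite lee_fin.
  apply: (le_trans (leeD NeE HM')).
  by rewrite -EFinD lee_fin; lra.
- move=> k; apply: Hn1; apply: (leq_trans _ (ltnW nn)).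
  exact: leq_bigmax.
rewrite lee_fin.
have : 2 * M%:R * eta <= e / 5.
  rewrite /eta mulrA ler_pdivrMr// -subr_ge0.
  rewrite (_ : _ - _ = e); first exact: ltW.
  by field.
by set q := 2 * _ * _; lra.
Qed.

End consistency.

(** * Necessity of the log moment *)

Section counting_levels.
Context {R : realType}.

Lemma count_upper_le (z : R) (c : R -> bool) : (forall s, c s -> s < z) ->
  (\sum_(0 <= k <oo) ((c k%:R)%:R : R)%:E <= (1 + Num.max z 0)%:E)%E.
Proof.
move=> H; apply: (@le_trans _ _ (\sum_(0 <= k <oo) ((k%:R < z)%R%:R : R)%:E)%E).
  apply: lee_nneseries => [k _ _|k _]; first by rewrite lee_fin.
  by rewrite lee_fin; have := H k%:R; case: (c _) => [->|].
apply: le_trans (count_series_le z) _.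
rewrite lee_fin ge_max addr_ge0 ?le_max ?lexx ?orbT//=.
by rewrite addrC lerD2l le_max lexx.
Qed.

Lemma count_lower_ge (z : R) (c : R -> bool) : (forall s, c s -> s < z) ->
  ((Num.max (- z) 0)%:E <= \sum_(0 <= k <oo) ((~~ c (- k%:R))%:R : R)%:E)%E.
Proof.
move=> H; apply: le_trans (count_series_ge _) _.
apply: lee_nneseries => [k _ _|k _]; first by rewrite lee_fin.
rewrite lee_fin lt_max [_ < 0]ltNge ler0n orbF.
case: ltP => // kz; case: (boolP (c _)) => // /H; rewrite ltrNl => /(lt_trans kz).
by rewrite ltxx.
Qed.

End counting_levels.

Section necessity.
Context {R : realType} {d : nat} {dT} {T : measurableType dT} (P : probability T R).
Local Notation V := (vec R d).
Local Notation lam := (lebesgue_vec R d).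
Variable X : nat -> {RV P >-> V}.
Hypothesis hindep : mutually_independent X.
Variable mu : probability V R.
Hypothesis law : forall i A, measurable A -> P (X i @^-1` A) = mu A.
Hypothesis hd : (0 < d)%N.
Variable f : V -> R.
Hypothesis mf : measurable_fun setT f.
Hypothesis f0 : forall x, 0 <= f x.
Hypothesis dens : forall A, measurable A -> mu A = (\int[lam]_(x in A) (f x)%:E)%E.
Hypothesis hH : has_finite_entropy f.
Local Notation A := (log_nn_gt P X).
Local Notation Z := (log_nn P X).

(** Z_1^+ is at most the sum of the Z_i plus the sum of the Z_i^-.  The first sum
    is bounded by the error of the estimate, and the second one is integrable
    by the lower tail bound. *)
Lemma log_moment_of_finite_error n : (0 < n)%N ->
  (\int[P]_w `|kl_entropy (fun i => X i w) n.+1 - entropy f|%:E < +oo)%E ->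
  (\int[mu]_x (Num.max (ln (enorm x)) 0)%:E < +oo)%E.
Proof.
move=> n0 fin; apply: (log_moment_lty hd mu n n0).
have ni (i : 'I_n.+1) : (0 < i.+1 <= n.+1)%N by exact: ltn_ord.
have mA i s : measurable (A n.+1 i s) by exact: measurable_log_nn_gt.
have mAc i s : measurable (~` A n.+1 i s) by exact: measurableC.
have AZ (i : 'I_n.+1) w s : `[< A n.+1 i.+1 s w >] -> s < Z n.+1 i.+1 w.
  move=> /asboolP As; have [H|H] := log_nn_gtP P X hd n.+1 i.+1 n0 (ni i) w.
    exact/H.
  by have := H s.
have mi (C : set T) : measurable C -> measurable_fun setT (fun w => (\1_C w : R)%:E).
  by move=> mC; apply/measurable_EFinP; exact: measurable_indic.
have i0 (C : set T) w : (0 <= (\1_C w : R)%:E)%E by rewrite lee_fin.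
have mkl : measurable_fun setT (fun w => kl_entropy (fun i => X i w) n.+1).
  exact: measurable_kl_entropy.
pose E w := `|kl_entropy (fun i => X i w) n.+1 - entropy f|.
pose up w : \bar R := (\sum_(0 <= k <oo) (\1_(A n.+1 1 k%:R) w)%:E)%E.
pose low (i : 'I_n.+1) w : \bar R :=
  (\sum_(0 <= k <oo) (\1_(~` A n.+1 i.+1 (- k%:R)) w)%:E)%E.
pose c : R := 1 + n.+1%:R * (`|entropy f| + `|euler_mascheroni R|).
have c0 : 0 <= c by rewrite addr_ge0// mulr_ge0// addr_ge0.
have low0 i w : (0 <= low i w)%E by exact: nneseries_ge0.
have mlow i : measurable_fun setT (low i).
  by apply: ge0_emeasurable_sum => [k w _ _|k _]; [exact: i0|exact: mi].
have mup : measurable_fun setT up.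
  by apply: ge0_emeasurable_sum => [k w _ _|k _]; [exact: i0|exact: mi].
have up0 w : (0 <= up w)%E by exact: nneseries_ge0.
have key w : (up w <= c%:E + (n.+1%:R%:E * (E w)%:E + \sum_(i < n.+1) low i w))%E.
  have U : (up w <= (1 + Num.max (Z n.+1 1 w) 0)%:E)%E.
    exact: (count_upper_le _ (fun s => `[< A n.+1 1 s w >]) (AZ ord0 w)).
  have Lo (i : 'I_n.+1) : ((Num.max (- Z n.+1 i.+1 w) 0)%:E <= low i w)%E.
    have := count_lower_ge _ (fun s => `[< A n.+1 i.+1 s w >]) (AZ i w).
    move=> /le_trans; apply; rewrite le_eqVlt; apply/orP; left; apply/eqP.
    by apply: eq_eseriesr => k _; rewrite [in RHS]indicE in_setC.
  apply: (le_trans U).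
  apply: (@le_trans _ _ (c%:E + (n.+1%:R%:E * (E w)%:E +
      \sum_(i < n.+1) (Num.max (- Z n.+1 i.+1 w) 0)%:E)))%E; last first.
    by apply: leeD2l; apply: leeD2l; exact: lee_sum.
  rewrite sumEFin -EFinM -!EFinD lee_fin.
  have maxE (z : R) : Num.max z 0 = z + Num.max (- z) 0.
    have [z0|z0] := leP 0 z.
      by rewrite max_r ?addr0// oppr_le0.
    by rewrite max_l ?subrr// oppr_ge0 ltW.
  have S1 : Num.max (Z n.+1 1 w) 0 <= \sum_(i < n.+1) Num.max (Z n.+1 i.+1 w) 0.
    by rewrite big_ord_recl lerDl sumr_ge0// => i _; rewrite le_max lexx orbT.
  have S2 : \sum_(i < n.+1) Num.max (Z n.+1 i.+1 w) 0 =
      \sum_(i < n.+1) Z n.+1 i.+1 w + \sum_(i < n.+1) Num.max (- Z n.+1 i.+1 w) 0.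
    by rewrite -big_split; apply: eq_bigr => i _; exact: maxE.
  have S3 : \sum_(i < n.+1) Z n.+1 i.+1 w =
      n.+1%:R * (kl_entropy (fun i => X i w) n.+1 - euler_mascheroni R).
    by rewrite kl_entropyE addrK mulVKf// pnatr_eq0.
  have S4 : kl_entropy (fun i => X i w) n.+1 - euler_mascheroni R <=
      E w + (`|entropy f| + `|euler_mascheroni R|).
    have h1 := ler_norm (kl_entropy (fun i => X i w) n.+1 - entropy f).
    have h2 := ler_norm (entropy f); have h3 := ler_norm (- euler_mascheroni R).
    rewrite normrN in h3; rewrite /E.
    move: h1 h2 h3; set a := kl_entropy _ _; set b := entropy f; set e := euler_mascheroni R.
    by set p := `|_|; set q := `|_|; set r := `|_|; lra.
  have S5 := ler_wpM2l (ler0n R n.+1) S4; rewrite [leRHS]mulrDr in S5.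
  move: S1; rewrite S2 S3 => S1.
  have sum5 (p1 p2 p3 p4 p5 : R) : p1 <= p3 + p2 -> p3 <= p4 + p5 ->
    1 + p1 <= 1 + p5 + (p4 + p2) by lra.
  exact: sum5 S1 S5.
have upE : (\int[P]_w up w = \sum_(0 <= k <oo) void_prob mu n (vol_radius d n k%:R))%E.
  rewrite integral_nneseries//; last by move=> k; exact: mi.
  apply: eq_eseriesr => k _; rewrite integral_indic// setIT.
  exact: (prob_log_nn_gt P X hindep mu law).
have lowE i : (\int[P]_w low i w <= \sum_(0 <= k <oo) lower_tail mu f k)%E.
  rewrite integral_nneseries//; last by move=> k; exact: mi.
  apply: lee_nneseries => [k _ _|k _]; first by apply: integral_ge0 => w _; exact: i0.
  rewrite integral_indic// setIT.
  exact: (prob_log_nn_le_le P X hindep mu law hd f mf f0 dens).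
have E0 w : (0 <= (E w)%:E)%E by rewrite lee_fin /E.
have mE : measurable_fun setT (fun w => (E w)%:E).
  by apply/measurable_EFinP/measurableT_comp => //; exact: measurable_funB.
have n0E : (0 <= (n.+1%:R : R)%:E)%E by rewrite lee_fin.
have nE0 w : (0 <= n.+1%:R%:E * (E w)%:E)%E by exact: mule_ge0.
have mnE : measurable_fun setT (fun w => n.+1%:R%:E * (E w)%:E)%E.
  exact: measurable_funeM.
have s0 w : (0 <= \sum_(i < n.+1) low i w)%E by exact: sume_ge0.
have ms : measurable_fun setT (fun w => \sum_(i < n.+1) low i w)%E.
  exact: emeasurable_sum.
have r0 w : (0 <= n.+1%:R%:E * (E w)%:E + \sum_(i < n.+1) low i w)%E by exact: adde_ge0.
have mr : measurable_fun setT (fun w => n.+1%:R%:E * (E w)%:E + \sum_(i < n.+1) low i w)%E.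
  exact: emeasurable_funD.
have c0E : (0 <= c%:E)%E by rewrite lee_fin.
rewrite -upE.
apply: (@le_lt_trans _ _ (\int[P]_w (c%:E + (n.+1%:R%:E * (E w)%:E + \sum_(i < n.+1) low i w)))%E).
  apply: ge0_le_integral => //; first exact: emeasurable_funD.
rewrite ge0_integralD// integral_prob_cst ge0_integralD// ge0_integralZl_EFin// ge0_integral_sum//.
apply: lte_add_pinfty; first exact: ltry.
apply: lte_add_pinfty.
  by rewrite lte_mul_pinfty.
apply: lte_sum_pinfty => i _; apply: le_lt_trans (lowE i) _.
exact: (lower_tail_sum mu f mf f0 dens hH).
Qed.

End necessity.

(* X 0 is the generic vector X; X 1, X 2, ... is the sample. *)
Theorem theorem2 (R : realType) (d : nat) (hd : (1 <= d)%N)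
    (f : vec R d -> R) (hf : is_density f) (hH : has_finite_entropy f)
    (dT : measure_display) (T : measurableType dT) (P : probability T R)
    (X : nat -> {RV P >-> vec R d})
    (hindep : mutually_independent X)
    (hdens : forall i : nat, has_density (X i) f) :
  (fun n : nat =>
     ('E_P[fun w => `|kl_entropy (fun i => X i w) n - entropy f|%R])%E) @ \oo
    --> 0%E
  <->
  ('E_P[fun w => Num.max (ln (enorm (X 0%N w))) 0%R] < +oo)%E.
Proof.
have [mf f0 _] := hf.
pose mu := distribution P (X 0).
have dens A : measurable A -> mu A = (\int[lebesgue_vec R d]_(x in A) (f x)%:E)%E.
  exact: hdens.
have law i A : measurable A -> P (X i @^-1` A) = mu A.
  by move=> mA; rewrite dens// -(hdens i).
have mlog : measurable_fun setT (fun x : vec R d => (Num.max (ln (enorm x)) 0)%:E).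
  apply/measurable_EFinP; apply: measurable_maxr => //.
  by apply: (measurableT_comp (@measurable_ln R)); exact: measurable_enorm.
have momentE : ('E_P[fun w => Num.max (ln (enorm (X 0%N w))) 0%R] =
    \int[mu]_x (Num.max (ln (enorm x)) 0)%:E)%E.
  rewrite unlock ge0_integral_distribution//.
  by move=> x; rewrite lee_fin le_max lexx orbT.
rewrite momentE; split => [H|Hlog].
  have [N HN] := cvge_eventually_lt _ _ _ H lte01.
  pose n := N.+1.
  apply: (log_moment_of_finite_error P X hindep mu law hd f mf f0 dens hH n isT).
  have := HN n.+1 (leqW (leqnSn N)); rewrite unlock => /lt_trans; apply.
  exact: ltry.
have tails : (\sum_(0 <= k <oo) (upper_tail mu k + lower_tail mu f k) < +oo)%E.
  rewrite nneseriesD; last 2 first.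
  - by move=> *; exact: upper_tail_ge0.
  - by move=> *; exact: lower_tail_ge0.
  by rewrite lte_add_pinfty// ?upper_tail_sum// (lower_tail_sum mu f mf f0 dens hH).
apply: cvge0_ge0P => [n|e e0].
  by rewrite unlock; apply: integral_ge0 => w _; rewrite lee_fin.
rewrite unlock.
exact: (kl_entropy_L1_small P X hindep mu law hd f mf f0 dens hH tails e e0).
Qed.
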